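(* Let $q>2$ and let $\chi$ be a primitive Dirichlet character mod $q$. Let $\rho'=\beta'+i\gamma'$ run over the critical points of the Riemann zeta function (points with $\zeta'(\rho')=0$) satisfying $\beta'>1$. Then $$\limsup_{\gamma'\to\infty}\frac{|L(\rho',\chi)|}{\log\log\gamma'}\geq e^{C_0}\frac{\phi(q)}{q}.$$
   Context: $\zeta$ is the Riemann zeta function, $L(s,\chi)$ is the Dirichlet $L$-function of $\chi$, $\phi$ is Euler's totient function, and $C_0$ is Euler's constant. The limsup is taken over the critical points $\rho'=\beta'+i\gamma'$ of $\zeta$ with $\beta'>1$ as $\gamma'\to+\infty$, with $q$ and $\chi$ fixed. The statement is unconditional. *)

(* Defs.v *)
From HB Require Import structures.
From mathcomp Require Import all_boot all_order all_algebra.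
From mathcomp Require Import all_classical all_reals all_analysis.
From mathcomp Require Import complex.

Set Implicit Arguments.
Unset Strict Implicit.
Unset Printing Implicit Defensive.

Import Order.TTheory GRing.Theory Num.Theory.
Import numFieldNormedType.Exports.

Local Open Scope classical_set_scope.
Local Open Scope ring_scope.
Local Open Scope complex_scope.

(* [R[i]^o] is [R[i]] with the topology given by the complex modulus. *)

Definition cexp (R : realType) (z : R[i]) : R[i] :=
  (expR (complex.Re z))%:C * (cos (complex.Im z) +i* sin (complex.Im z)).

(* [n ^ s] for [n >= 1] only: [ln 0 = 0] makes the value at [n = 0] junk. *)
Definition natpowc (R : realType) (n : nat) (s : R[i]) : R[i] :=
  cexp (s * (ln (n%:R : R))%:C).

(* The limit of the partial sums of [\sum_(n >= 1) a n / n ^ s]; a meaningful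
   value only where the series converges. *)
Definition dirichlet_series (R : realType) (a : nat -> R[i]) (s : R[i]^o) :
    R[i]^o :=
  limn (fun N => \sum_(1 <= n < N.+1) a n * natpowc n (- s) : R[i]^o).

(* Coincides with the Riemann zeta function on the half-plane [1 < Re s]. That
   region being open, the complex derivatives coincide there as well. *)
Definition zeta (R : realType) : R[i]^o -> R[i]^o :=
  dirichlet_series (fun=> 1).

(* Coincides with [L(s, chi)] on the half-plane [1 < Re s]. *)
Definition dirichlet_L (R : realType) (chi : int -> R[i]) : R[i]^o -> R[i]^o :=
  dirichlet_series (fun n => chi n%:Z).

Definition dirichlet_character (R : realType) (q : nat) (chi : int -> R[i]) :
    Prop :=
  [/\ forall m n, chi (m * n) = chi m * chi n,
      forall n, chi (n + q%:Z) = chi n &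
      forall n, (chi n != 0) = coprimez n q%:Z].

Definition primitive_character (R : realType) (q : nat) (chi : int -> R[i]) :
    Prop :=
  dirichlet_character q chi /\
  forall (d : nat) (psi : int -> R[i]),
    (d %| q)%N -> (d < q)%N -> dirichlet_character d psi ->
    ~ (forall n, coprimez n q%:Z -> chi n = psi n).

Definition euler_constant (R : realType) : R :=
  limn (fun n => (\sum_(1 <= k < n.+1) (k%:R)^-1) - ln (n%:R) : R).

(* Only the critical points with [1 < Re s]. Over the field [R[i]],
   [is_derive s 1 f 0] means that [f] is complex differentiable at [s] with
   derivative [0]. *)
Definition zeta_critical_points (R : realType) : set R[i] :=
  [set s : R[i] | 1 < complex.Re s /\ is_derive (s : R[i]^o) 1 (@zeta R) 0].

(* The limsup of [f s] as [Im s -> +oo] with [s] in [A]; it is [-oo] when [Im]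
   is bounded above on [A]. *)
Definition limsup_Im_pinfty (R : realType) (A : set R[i]) (f : R[i] -> R) :
    \bar R :=
  limf_esup (fun s : R[i]^o => (f s)%:E)
    (filter_from [set: R] (fun T => [set s : R[i]^o | A s /\ T < complex.Im s])).

(* Main.v *)
(* For [Re s > 1] one has [zeta' = - zeta * F] with [F s = sum_n Lambda(n)
   n^(-s)], so the critical points of zeta there are the zeros of [F]. Put
   [s0 = 1 + kappa / ln y + i t] with [kappa] small. A resonator (a long
   Dirichlet polynomial whose square modulus is used as a density in [t])
   produces [t], of size [exp (y^(1 + o(1)))], such that [p^(-i t)] is
   close to [conj (chi p)] for almost all primes [p < y], is close to [1]
   or [-1] on the two halves of a short window [[y, Y)], and is such that
   the primes beyond [Y] contribute almost nothing. The first condition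
   gives [F s0 = O(1)] through the boundedness of [sum_(n < x) chi(n)
   Lambda(n) / n], that is, through [L(1, chi) <> 0]; the cancelling signs
   on the window keep [F s0] bounded but force [|F' s0|] to be of order
   [(ln y)^2], so that Newton's iteration finds a zero [s] of [F] within
   [o(1 / ln y)] of [s0]. At that point the Euler product of [L(s, chi)]
   over [p < y] imitates [prod_(p | q) (1 - 1/p) * zeta (Re s0)], which by
   Mertens' theorem is about [e^gamma phi(q)/q ln y], whereas [ln (ln (Im
   s))] is [(1 + o(1)) ln y]. *)

Require Import Defs.
From mathcomp Require Import all_boot all_order all_algebra.
From mathcomp Require Import all_classical all_reals all_analysis.
From mathcomp Require Import complex.
From mathcomp Require Import zify ring lra.

Import Order.TTheory GRing.Theory Num.Theory.
Import numFieldNormedType.Exports.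

Set Implicit Arguments.
Unset Strict Implicit.
Unset Printing Implicit Defensive.

Local Open Scope classical_set_scope.
Local Open Scope ring_scope.
Local Open Scope complex_scope.


(** The precision [K] (with kappa equal to [1 / K]) is fixed while [u] tends to infinity, and only
    then is [K] increased. The window is what makes Newton's iteration possible: imitating
    [conj (chi p)] alone bounds F, but of F' it says only that it is O(ln y), which leaves room for
    F' to vanish. A change of sign inside a window whose logarithmic length is a fixed proportion of
    [ln y] adds to F' a term of order [(ln y)^2], dominant for large [u]; as this proportion is
    [1 / K], the window costs L(s, chi) a factor [exp (O (1 / K))] only. Forcing the directions of
    the primes below [Y] with [m] powers of each makes [ln t] about [m * Y], so it cannot be
    afforded for larger primes without spoiling the constant. Of the primes between [Y] and [X] only
    three sums are made small on average, one for each of F, F' and L; from [X] on, absolute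
    convergence at distance [d] from the line of real part 1 suffices. Averages over [t] are finite
    sums over equally spaced points in place of integrals. *)

Notation normc := ComplexField.Normc.normc.
Notation ReC := complex.Re.
Notation ImC := complex.Im.

(** * Modulus, real and imaginary parts of complex numbers *)

Section ComplexBasics.
Context {R : realType}.
Implicit Types (z w u : R[i]) (x y : R).

Lemma normc_ge0 z : 0 <= normc z.
Proof. by case: z => a b; exact: sqrtr_ge0. Qed.

Lemma normcD z w : normc (z + w) <= normc z + normc w.
Proof. exact: le_normcD. Qed.

Lemma normcNE z : normc (- z) = normc z.
Proof. exact: complex.normcN. Qed.

Lemma normcB z w : normc (z - w) <= normc z + normc w.
Proof. by rewrite -(normcNE w); exact: normcD. Qed.

Lemma normcBC z w : normc (z - w) = normc (w - z).
Proof. by rewrite -normcNE opprB. Qed.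

Lemma normcM z w : normc (z * w) = normc z * normc w.
Proof. exact: ComplexField.Normc.normcM. Qed.

Lemma normc0E : normc (0 : R[i]) = 0.
Proof. exact: ComplexField.Normc.normc0. Qed.

Lemma normc1E : normc (1 : R[i]) = 1.
Proof. exact: ComplexField.Normc.normc1. Qed.

Lemma normc_sqr z : normc z ^+ 2 = ReC z ^+ 2 + ImC z ^+ 2.
Proof. by case: z => a b /=; rewrite sqr_sqrtr // addr_ge0 // sqr_ge0. Qed.

Lemma normc_eq0 z : (normc z == 0) = (z == 0).
Proof.
apply/eqP/eqP => [|->]; last exact: normc0E.
exact: ComplexField.Normc.eq0_normc.
Qed.

Lemma normc_gt0 z : (0 < normc z) = (z != 0).
Proof. by rewrite lt_def normc_ge0 andbT normc_eq0. Qed.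

Lemma normcVE z : normc z^-1 = (normc z)^-1.
Proof. exact: ComplexField.Normc.normcV. Qed.

Lemma normcXE z n : normc (z ^+ n) = normc z ^+ n.
Proof. by elim: n => [|n IH]; rewrite ?expr0 ?normc1E // !exprS normcM IH. Qed.

Lemma normc_real x : normc x%:C = `|x|.
Proof. by rewrite /= expr0n addr0 sqrtr_sqr. Qed.

Lemma normc_re z : `|ReC z| <= normc z.
Proof.
rewrite -(@ler_sqr _ `|_|) ?nnegrE ?normc_ge0 //.
by rewrite normc_sqr -normrX ger0_norm ?sqr_ge0 // lerDl sqr_ge0.
Qed.

Lemma normc_im z : `|ImC z| <= normc z.
Proof.
rewrite -(@ler_sqr _ `|_|) ?nnegrE ?normc_ge0 //.
by rewrite normc_sqr -normrX ger0_norm ?sqr_ge0 // lerDr sqr_ge0.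
Qed.

Lemma normc_le_reim z : normc z <= `|ReC z| + `|ImC z|.
Proof.
rewrite -ler_sqr ?nnegrE ?normc_ge0 ?addr_ge0 //.
rewrite normc_sqr sqrrD !real_normK ?num_real // lerD2r lerDl.
by rewrite mulrn_wge0 // mulr_ge0.
Qed.

Lemma normc_sum (I : Type) (r : seq I) (P : pred I) (F : I -> R[i]) :
  normc (\sum_(i <- r | P i) F i) <= \sum_(i <- r | P i) normc (F i).
Proof.
elim/big_ind2: _ => [|z a w b za wb|//]; first by rewrite normc0E.
by rewrite (le_trans (normcD _ _)) // lerD.
Qed.

Lemma normc_prod (I : Type) (r : seq I) (P : pred I) (F : I -> R[i]) :
  normc (\prod_(i <- r | P i) F i) = \prod_(i <- r | P i) normc (F i).
Proof. by elim/big_rec2: _ => [|i a b _ <-]; rewrite ?normc1E ?normcM. Qed.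

Lemma normc_triB z w : normc z - normc w <= normc (z - w).
Proof. by rewrite lerBlDr -{1}(subrK w z) normcD. Qed.

Lemma normcE_norm z : `|z| = (normc z)%:C.
Proof. by rewrite normc_def; case: z. Qed.

Lemma ltc_real x y : (x%:C < y%:C) = (x < y).
Proof. by rewrite ltcR. Qed.

Lemma ReD z w : ReC (z + w) = ReC z + ReC w.
Proof. by case: z w => [a b] [c d]. Qed.

Lemma ImD z w : ImC (z + w) = ImC z + ImC w.
Proof. by case: z w => [a b] [c d]. Qed.

Lemma ReN z : ReC (- z) = - ReC z.
Proof. by case: z. Qed.

Lemma ImN z : ImC (- z) = - ImC z.
Proof. by case: z. Qed.

Lemma ReM z w : ReC (z * w) = ReC z * ReC w - ImC z * ImC w.
Proof. by case: z w => [a b] [c d]. Qed.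

Lemma ImM z w : ImC (z * w) = ReC z * ImC w + ImC z * ReC w.
Proof. by case: z w => [a b] [c d]. Qed.

Lemma Re_sum (I : Type) (r : seq I) (P : pred I) (F : I -> R[i]) :
  ReC (\sum_(i <- r | P i) F i) = \sum_(i <- r | P i) ReC (F i).
Proof. by elim/big_rec2: _ => [//|i a b _ <-]; rewrite ReD. Qed.

Lemma real_sum (I : Type) (r : seq I) (P : pred I) (F : I -> R) :
  (\sum_(i <- r | P i) F i)%:C = \sum_(i <- r | P i) (F i)%:C.
Proof. exact: rmorph_sum. Qed.

Lemma sqrt_normc_conj z : z * z^*%C = (normc z ^+ 2)%:C.
Proof. by rewrite rmorphXn /= -normcE_norm sqr_normc. Qed.

Lemma normcJE z : normc z^*%C = normc z.
Proof. by case: z => a b /=; rewrite sqrrN. Qed.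

Lemma complex_eqP z w : ReC z = ReC w -> ImC z = ImC w -> z = w.
Proof. by case: z w => [a b] [c d] /= -> ->. Qed.

(** * Limits of complex sequences *)

(** Convergence with a real [e] and the real-valued [normc]. Limits are handled in this form
    throughout; the topology of [R[i]^o], whose norm is itself complex-valued, is met only in
    [tends_limn] and [is_derive_quadratic]. *)
Definition tends (u : nat -> R[i]) (l : R[i]) :=
  forall e : R, 0 < e ->
    exists N, forall n, (N <= n)%N -> normc (u n - l) < e.

Lemma tends_unique (u : nat -> R[i]) l l' : tends u l -> tends u l' -> l = l'.
Proof.
move=> ul ul'; apply/eqP; rewrite -subr_eq0 -normc_eq0 eq_le normc_ge0 andbT.
rewrite leNgt; apply/negP => e0.
have e2 : 0 < normc (l - l') / 2 by rewrite divr_gt0.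
have [N HN] := ul _ e2; have [M HM] := ul' _ e2.
have h1 := HN (maxn N M) (leq_maxl _ _).
have h2 := HM (maxn N M) (leq_maxr _ _).
have := normcB (u (maxn N M) - l') (u (maxn N M) - l).
rewrite (_ : _ - _ - _ = l - l'); last by ring.
move: h1 h2; lra.
Qed.

Lemma tends_le (u : nat -> R[i]) l (B : R) :
  tends u l -> (exists N, forall n, (N <= n)%N -> normc (u n) <= B) ->
  normc l <= B.
Proof.
move=> ul [M uB]; rewrite leNgt; apply/negP => e0.
have [N HN] := ul (normc l - B) ltac:(by rewrite subr_gt0).
have h1 := HN (maxn N M) (leq_maxl _ _).
have h2 := uB (maxn N M) (leq_maxr _ _).
have := normc_triB l (u (maxn N M)); rewrite normcBC; move: h1 h2; lra.
Qed.

(** Most estimates of infinite series below are estimates of partial sums, carried to the limit by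
    this lemma or by [tends_le]. *)
Lemma tends_dist_le (u : nat -> R[i]) l w (B : R) :
  tends u l -> (exists N, forall n, (N <= n)%N -> normc (u n - w) <= B) ->
  normc (l - w) <= B.
Proof.
move=> ul [M uB]; apply: (@tends_le (fun n => u n - w)) => [e e0|]; last by exists M.
have [N HN] := ul e e0; exists N => n /HN.
by rewrite (_ : _ - _ - _ = u n - l) //; ring.
Qed.

Lemma tendsD (u v : nat -> R[i]) l m :
  tends u l -> tends v m -> tends (fun n => u n + v n) (l + m).
Proof.
move=> ul vm e e0; have e2 : 0 < e / 2 by rewrite divr_gt0.
have [N HN] := ul _ e2; have [M HM] := vm _ e2.
exists (maxn N M) => n; rewrite geq_max => /andP[/HN h1 /HM h2].
have := normcD (u n - l) (v n - m).
rewrite (_ : u n - l + _ = u n + v n - (l + m)); last by ring.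
move: h1 h2; lra.
Qed.

Lemma tendsMl (u : nat -> R[i]) l w : tends u l -> tends (fun n => w * u n) (w * l).
Proof.
move=> ul e e0.
have w1 : 0 < normc w + 1 by rewrite ltr_wpDl ?normc_ge0.
have [N HN] := ul (e / (normc w + 1)) (divr_gt0 e0 w1).
exists N => n /HN; rewrite ltr_pdivlMr // => h.
rewrite -mulrBr normcM; apply: le_lt_trans h; rewrite mulrC.
by rewrite ler_wpM2l ?normc_ge0 // lerDl.
Qed.

Lemma tends_eq (u v : nat -> R[i]) l :
  (exists N, forall n, (N <= n)%N -> u n = v n) -> tends u l -> tends v l.
Proof.
move=> [M uv] ul e e0; have [N HN] := ul _ e0; exists (maxn N M) => n.
by rewrite geq_max => /andP[/HN h1 /uv <-].
Qed.

Lemma tends_cst l : tends (fun=> l) l.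
Proof. by move=> e e0; exists 0%N => n _; rewrite subrr normc0E. Qed.

Lemma tends_close (u v : nat -> R[i]) l (b : nat -> R) :
  (forall n, normc (u n - v n) <= b n) ->
  (forall e, 0 < e -> exists N, forall n, (N <= n)%N -> b n < e) ->
  tends u l -> tends v l.
Proof.
move=> uv b0 ul e e0; have e2 : 0 < e / 2 by rewrite divr_gt0.
have [N HN] := ul _ e2; have [M HM] := b0 _ e2.
exists (maxn N M) => n; rewrite geq_max => /andP[/HN h1 /HM h2].
have := normcB (u n - l) (u n - v n).
rewrite (_ : _ - _ - _ = v n - l); last by ring.
move: h1 h2 (uv n); lra.
Qed.

Lemma tends_limn (u : nat -> R[i]) l : tends u l -> limn (u : nat -> R[i]^o) = l.
Proof.
move=> ul; apply: cvg_lim; first exact: norm_hausdorff.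
apply/cvgrPdist_lt => e; rewrite ltcE => /andP[/eqP ime ree].
have [N HN] := ul (ReC e) ree; exists N => // n /= /HN h.
by rewrite distrC normcE_norm ltcE /= h ime eqxx.
Qed.

(** Comparison test. Completeness is used for the real and the imaginary parts separately: both are
    dominated by [b], whose partial sums increase and are bounded. *)
Lemma tends_series (u : nat -> R[i]) (b : nat -> R) (B : R) :
  (forall n, normc (u n) <= b n) ->
  (forall n, \sum_(0 <= k < n) b k <= B) ->
  exists l, tends (fun n => \sum_(0 <= k < n) u k) l.
Proof.
move=> ub bB.
have b0 n : 0 <= b n by rewrite (le_trans (normc_ge0 _) (ub n)).
have cb : cvgn (series b).
  apply: nondecreasing_is_cvgn.
    by apply/nondecreasing_seqP => n; rewrite /series /= big_nat_recr //= lerDl.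
  by exists B => _ [n _ <-]; exact: bB.
have part (f : R[i] -> R) : (forall z, `|f z| <= normc z) ->
    exists r : R, series (f \o u) @ \oo --> r.
  move=> fz; have : cvgn (series (f \o u)); last by move=> h; eexists; exact: h.
  apply: normed_cvg; apply: (@series_le_cvg _ _ b) => // n /=.
    exact: normr_ge0.
  exact: le_trans (fz _) (ub n).
have [r1 /cvgrPdist_lt c1] := part _ normc_re.
have [r2 /cvgrPdist_lt c2] := part _ normc_im.
exists (r1 +i* r2) => e e0; have e2 : 0 < e / 2 by rewrite divr_gt0.
have [N1 _ H1] := c1 _ e2; have [N2 _ H2] := c2 _ e2.
exists (maxn N1 N2) => n; rewrite geq_max => /andP[/H1 /= h1 /H2 /= h2].
apply: le_lt_trans (normc_le_reim _) _.
have -> : \sum_(0 <= k < n) u k =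
    series (@complex.Re R \o u) n +i* series (@complex.Im R \o u) n.
  rewrite /series /=; elim: n {h1 h2} => [|n IH]; first by rewrite !big_geq.
  by rewrite !big_nat_recr //= IH; case: (u n).
rewrite ReD ImD ReN ImN /= distrC (distrC _ r2).
by move: h1 h2; rewrite /comp /=; lra.
Qed.

(** * The complex exponential *)

Lemma expRB1_le x : `|expR x - 1| <= `|x| * expR `|x|.
Proof.
have h1 := expR_ge1Dx x; have h2 := expR_ge1Dx (- x).
have h3 : expR x - 1 <= x * expR x.
  have : expR x * (1 - x) <= expR x * expR (- x).
    by rewrite ler_wpM2l ?expR_ge0.
  by rewrite -expRD subrr expR0 mulrBr mulr1 [expR x * x]mulrC; lra.
have [x0|x0] := leP 0 x.
  by rewrite !ger0_norm //; lra.
have e1 : expR x <= 1 by rewrite expR_le1 ltW.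
rewrite distrC ger0_norm; last by lra.
rewrite (le_trans (_ : _ <= - x)) //; first by lra.
by rewrite ltr0_norm // ler_peMr ?oppr_ge0 ?ltW //; lra.
Qed.

Lemma expRB1Bx_le x : `|expR x - 1 - x| <= `|x| ^+ 2 * expR `|x|.
Proof.
have h1 := expR_ge1Dx x; have h2 := expR_ge1Dx (- x).
have h3 : expR x - 1 <= x * expR x.
  have : expR x * (1 - x) <= expR x * expR (- x).
    by rewrite ler_wpM2l ?expR_ge0.
  by rewrite -expRD subrr expR0 mulrBr mulr1 [expR x * x]mulrC; lra.
rewrite ger0_norm; last by lra.
apply: (@le_trans _ _ (x * (expR x - 1))); first by lra.
rewrite expr2 -mulrA (le_trans (ler_norm _)) // normrM ler_wpM2l //.
exact: expRB1_le.
Qed.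

Lemma sin_abs_le_pos x : 0 <= x -> `|sin x| <= x.
Proof.
move=> x0; have [|c] := @MVT_segment R sin cos 0 x x0.
- by apply: continuous_subspaceT => y; exact: continuous_sin.
rewrite sin0 !subr0 => _ ->.
rewrite normrM (ger0_norm x0) ler_piMl // ler_norml cos_le1 andbT.
exact: cos_geN1.
Qed.

Lemma sin_abs_le x : `|sin x| <= `|x|.
Proof.
have [x0|x0] := leP 0 x; first by rewrite (ger0_norm x0) sin_abs_le_pos.
by rewrite -normrN -sinN (ltr0_norm x0) sin_abs_le_pos // oppr_ge0 ltW.
Qed.

Lemma cosB1_MVT x : exists2 c, `|c| <= `|x| & cos x - 1 = - sin c * x.
Proof.
wlog x0 : x / 0 <= x => [H|].
  have [/H//|x0] := leP 0 x.
  have [|c cx e] := H (- x); first by rewrite oppr_ge0 ltW.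
  exists (- c); first by rewrite normrN -(normrN x).
  by rewrite -cosN e sinN; ring.
have [|c] := @MVT_segment R cos (fun y => - sin y) 0 x x0.
- by apply: continuous_subspaceT => y; exact: continuous_cos.
rewrite in_itv /= => /andP[c0 cx]; rewrite cos0 subr0 => e; exists c => //.
by rewrite !ger0_norm.
Qed.

Lemma cosB1_le x : `|cos x - 1| <= `|x|.
Proof.
have [c _ ->] := cosB1_MVT x; rewrite normrM ler_piMl // normrN ler_norml.
by rewrite sin_le1 sin_geN1.
Qed.

Lemma cosB1_le2 x : `|cos x - 1| <= x ^+ 2.
Proof.
have [c cx ->] := cosB1_MVT x; rewrite normrM -(real_normK (num_real x)) expr2.
by rewrite ler_wpM2r // normrN (le_trans (sin_abs_le _)).
Qed.

Lemma sinBx_le x : `|sin x - x| <= x ^+ 2.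
Proof.
wlog x0 : x / 0 <= x => [H|].
  have [/H//|x0] := leP 0 x.
  have := H (- x) ltac:(by rewrite oppr_ge0 ltW).
  by rewrite sinN -opprD normrN sqrrN.
have [|c] := @MVT_segment R sin cos 0 x x0.
- by apply: continuous_subspaceT => y; exact: continuous_sin.
rewrite in_itv /= => /andP[c0 cx]; rewrite sin0 !subr0 => ->.
rewrite -{2}(mul1r x) -mulrBl normrM (ger0_norm x0) expr2 ler_wpM2r //.
by rewrite (le_trans (cosB1_le _)) // ger0_norm.
Qed.

Lemma cexpD z w : cexp (z + w) = cexp z * cexp w.
Proof.
rewrite /cexp ReD ImD expRD cosD sinD; apply: complex_eqP;
  by rewrite ?(ReM, ImM) /=; ring.
Qed.

Lemma cexp0 : cexp (0 : R[i]) = 1.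
Proof.
by rewrite /cexp /= expR0 cos0 sin0; apply: complex_eqP; rewrite ?(ReM, ImM) /=; ring.
Qed.

Lemma normc_cexp z : normc (cexp z) = expR (ReC z).
Proof.
rewrite /cexp normcM normc_real ger0_norm ?expR_ge0 //=.
by rewrite cos2Dsin2 sqrtr1 mulr1.
Qed.

Lemma cexp_real x : cexp x%:C = (expR x)%:C.
Proof.
by rewrite /cexp /= cos0 sin0; apply: complex_eqP; rewrite ?(ReM, ImM) /=; ring.
Qed.

Lemma cexpM_nat z n : cexp (z *+ n) = cexp z ^+ n.
Proof. by elim: n => [|n IH]; rewrite ?mulr0n ?cexp0 // mulrS cexpD IH exprS. Qed.

Let cis y : R[i] := cos y +i* sin y.

Let cexpE z : cexp z = (expR (ReC z))%:C * cis (ImC z).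
Proof. by []. Qed.

Lemma cexpB1_le z : normc (cexp z - 1) <= 3 * normc z * expR (normc z).
Proof.
set n := normc z.
have rn : `|ReC z| <= n := normc_re z.
have jn : `|ImC z| <= n := normc_im z.
have -> : cexp z - 1 =
    (expR (ReC z))%:C * (cis (ImC z) - 1) + (expR (ReC z) - 1)%:C.
  by rewrite cexpE rmorphB /=; ring.
have n0 : 0 <= n := normc_ge0 z.
have E : expR (ReC z) <= expR n by rewrite ler_expR (le_trans (ler_norm _)).
have h1 : normc (cis (ImC z) - 1) <= 2 * n.
  rewrite (le_trans (normc_le_reim _)) //= subr0.
  have := cosB1_le (ImC z); have := sin_abs_le (ImC z); lra.
have h2 : `|expR (ReC z) - 1| <= n * expR n.
  rewrite (le_trans (expRB1_le _)) // ler_pM ?normr_ge0 ?expR_ge0 //.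
  by rewrite ler_expR.
rewrite (le_trans (normcD _ _)) // normcM !normc_real ger0_norm ?expR_ge0 //.
have : expR (ReC z) * normc (cis (ImC z) - 1) <= expR n * (2 * n).
  by rewrite ler_pM ?expR_ge0 ?normc_ge0.
lra.
Qed.

(** Only the quadratic shape matters. It gives the second order expansion of [n ^ (- s)] in
    [natpowc_diff2] and the lower bound [cexp_i_lower]. *)
Lemma cexpB1Bz_le z : normc (cexp z - 1 - z) <= 4 * normc z ^+ 2 * expR (normc z).
Proof.
set n := normc z.
have rn : `|ReC z| <= n := normc_re z.
have jn : `|ImC z| <= n := normc_im z.
have n0 : 0 <= n := normc_ge0 z.
have E : expR (ReC z) <= expR n by rewrite ler_expR (le_trans (ler_norm _)).
have E1 : expR `|ReC z| <= expR n by rewrite ler_expR.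
have -> : cexp z - 1 - z =
    (expR (ReC z))%:C * (cis (ImC z) - 1 - 0 +i* ImC z)
    + (expR (ReC z) - 1 - ReC z)%:C + (0 +i* ImC z) * (expR (ReC z) - 1)%:C.
  rewrite cexpE; apply: complex_eqP; rewrite ?(ReD, ImD, ReM, ImM, ReN, ImN) /=;
    rewrite ?(ReD, ImD, ReM, ImM, ReN, ImN) /=; ring.
have h1 : normc (cis (ImC z) - 1 - 0 +i* ImC z) <= 2 * n ^+ 2.
  rewrite (le_trans (normc_le_reim _)) //= !subr0.
  have : ImC z ^+ 2 <= n ^+ 2.
    by rewrite -(real_normK (num_real _)) ler_sqr ?nnegrE.
  have := cosB1_le2 (ImC z); have := sinBx_le (ImC z); lra.
have h2 : `|expR (ReC z) - 1 - ReC z| <= n ^+ 2 * expR n.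
  rewrite (le_trans (expRB1Bx_le _)) // ler_pM ?sqr_ge0 ?expR_ge0 //.
  by rewrite ler_sqr ?nnegrE.
have h3 : `|ImC z| * `|expR (ReC z) - 1| <= n * (n * expR n).
  rewrite ler_pM // (le_trans (expRB1_le _)) // ler_pM ?expR_ge0 //.
rewrite (le_trans (normcD _ _)) // (le_trans (lerD (normcD _ _) (lexx _))) //.
rewrite !normcM !normc_real (ger0_norm (expR_ge0 _)).
rewrite (_ : normc (0 +i* ImC z) = `|ImC z|); last first.
  by rewrite /= expr0n add0r sqrtr_sqr.
have : expR (ReC z) * normc (cis (ImC z) - 1 - 0 +i* ImC z) <= expR n * (2 * n ^+ 2).
  by rewrite ler_pM ?expR_ge0 ?normc_ge0.
have h4 : 0 <= n ^+ 2 * expR n by rewrite mulr_ge0 ?sqr_ge0 ?expR_ge0.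
rewrite [n * (n * _)]mulrA -expr2 in h3.
lra.
Qed.

End ComplexBasics.

(** * The von Mangoldt function and its summatory estimates *)

Section VonMangoldt.
Context {R : realType}.

Lemma sum0_nat (V : nmodType) (a b : nat) (P : pred nat) (F : nat -> V) :
  (forall i, (a <= i < b)%N -> P i -> F i = 0) ->
  \sum_(a <= i < b | P i) F i = 0.
Proof.
by move=> h; rewrite big_nat_cond big1 // => i /andP[iab Pi]; exact: h.
Qed.

Lemma sum_multiples (V : zmodType) (d Z : nat) (G : nat -> V) : (0 < d)%N ->
  \sum_(1 <= n < Z.+1 | (d %| n)%N) G n =
  \sum_(1 <= m < (Z %/ d).+1) G (d * m)%N.
Proof.
move=> d0; elim: Z => [|Z IH]; first by rewrite div0n !big_geq.
rewrite big_mkcond big_nat_recr //= -big_mkcond IH divnS //.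
case: ifP => dZ; last by rewrite addr0.
have e := divnK dZ; rewrite divnS // dZ in e.
rewrite -[(true + _)%N]/((Z %/ d).+1) [RHS]big_nat_recr //=; congr (_ + G _).
by rewrite mulnC -{1}e.
Qed.

Lemma sum_divisor_pairs (V : zmodType) (Z : nat) (H : nat -> nat -> V) :
  \sum_(1 <= n < Z.+1) \sum_(1 <= d < n.+1 | (d %| n)%N) H d n =
  \sum_(1 <= d < Z.+1) \sum_(1 <= m < (Z %/ d).+1) H d (d * m)%N.
Proof.
transitivity (\sum_(1 <= n < Z.+1) \sum_(1 <= d < Z.+1 | (d %| n)%N) H d n).
  apply: eq_big_nat => n /andP[n0 nZ]; rewrite [RHS](@big_cat_nat _ _ _ n.+1) //=.
  rewrite [X in _ = _ + X]sum0_nat ?addr0 // => d /andP[nd _].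
  by move=> /dvdn_leq -/(_ n0); rewrite leqNgt nd.
rewrite (@exchange_big_dep_nat _ _ _ _ _ _ _ xpredT _ xpredT) //=.
apply: eq_big_nat => d /andP[d0 _]; rewrite -(sum_multiples _ (H d)) //.
Qed.

Lemma ln_nat_ge0 (n : nat) : 0 <= ln n%:R :> R.
Proof.
case: n => [|n]; first by rewrite ln0.
by rewrite ln_ge0 // ler1n.
Qed.

Lemma lnM_nat (m n : nat) : (0 < m)%N -> (0 < n)%N ->
  ln (m * n)%:R = ln m%:R + ln n%:R :> R.
Proof. by move=> m0 n0; rewrite natrM lnM ?posrE ?ltr0n. Qed.

Lemma lnX_nat (m k : nat) : (0 < m)%N -> ln (m ^ k)%:R = k%:R * ln m%:R :> R.
Proof. by move=> m0; rewrite natrX lnXn ?ltr0n // mulr_natl. Qed.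

Lemma ler_ln_nat (m n : nat) : (0 < m)%N -> (m <= n)%N -> ln m%:R <= ln n%:R :> R.
Proof.
move=> m0 mn; rewrite ler_ln ?posrE ?ltr0n ?ler_nat //; exact: leq_trans mn.
Qed.

(** At most one pair [(p, k)] contributes. The double sum, in place of a test on the factorization
    of [n], allows both ranges to be enlarged to a common bound ([vonME]) and then exchanged with a
    sum over [n]. *)
Definition vonM (n : nat) : R :=
  \sum_(0 <= p < n.+1 | prime p) \sum_(1 <= k < n.+1)
    (if (p ^ k)%N == n then ln p%:R else 0).

Lemma vonM_ge0 n : 0 <= vonM n.
Proof.
apply: sumr_ge0 => p _; apply: sumr_ge0 => k _; case: ifP => // _.
exact: ln_nat_ge0.
Qed.

Lemma vonME n N : (0 < n < N)%N -> vonM n =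
  \sum_(0 <= p < N | prime p) \sum_(1 <= k < N)
    (if (p ^ k)%N == n then ln p%:R else 0).
Proof.
move=> /andP[n0 nN]; rewrite /vonM [RHS](@big_cat_nat _ _ _ n.+1) //=.
rewrite [X in _ = _ + X]sum0_nat ?addr0; last first.
  move=> p /andP[np _] pp; rewrite sum0_nat // => k.
  case/andP => k1 _ _; case: eqP => // pk.
  have : (p ^ 1 <= p ^ k)%N by exact: leq_pexp2l (prime_gt0 pp) k1.
  by rewrite pk expn1; move: np; lia.
apply: eq_bigr => p pp; rewrite [RHS](@big_cat_nat _ _ _ n.+1) //=.
rewrite [X in _ = _ + X]sum0_nat ?addr0 // => k.
case/andP => k1 _ _; case: eqP => // pk.
by have := ltn_expl k (prime_gt1 pp); rewrite pk; move: k1; lia.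
Qed.

Lemma vonM_prime p : prime p -> vonM p = ln p%:R.
Proof.
move=> pp; have p1 : (1 < p.+1)%N by rewrite ltnS prime_gt0.
rewrite /vonM big_mkcond (bigD1_seq p) ?iota_uniq ?mem_index_iota ?leqnn //=.
rewrite pp (bigD1_seq 1%N) ?iota_uniq ?mem_index_iota ?p1 //=.
rewrite expn1 eqxx big_nat_cond big1 ?addr0; last first.
  move=> k /andP[/andP[k1 _] k1']; case: eqP => // e.
  have : (p ^ 1 < p ^ k)%N by rewrite (ltn_exp2l _ _ (prime_gt1 pp)); move: k1 k1'; lia.
  by rewrite expn1 e ltnn.
rewrite big1 ?addr0 // => r rp; case: ifP => // pr; rewrite big_nat_cond big1 //.
move=> k /andP[/andP[k1 _] _]; case: eqP => // e.
have : (r %| p)%N by rewrite -e dvdn_exp.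
by rewrite dvdn_prime2 // (negPf rp).
Qed.

(** For a fixed prime [p], the divisors [p ^ k] of [n] are those with [1 <= k <= logn p n]; their
    weights add up to [logn p n * ln p], the share of [p] in the logarithm of the factorization of
    [n]. *)
Lemma sum_vonM_divisors n : (0 < n)%N ->
  \sum_(1 <= d < n.+1 | (d %| n)%N) vonM d = ln n%:R.
Proof.
move=> n0.
transitivity (\sum_(1 <= d < n.+1 | (d %| n)%N) \sum_(0 <= p < n.+1 | prime p)
    \sum_(1 <= k < n.+1) (if (p ^ k)%N == d then ln p%:R else 0) : R).
  by rewrite big_nat_cond [RHS]big_nat_cond; apply: eq_bigr => d /andP[/vonME].
rewrite (@exchange_big_nat _ _ _ _ _ _ _ (fun d => d %| n)%N prime) /=.
rewrite -[in RHS](partnT n0) /partn.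
have lnprod (r : seq nat) : ln (\prod_(p <- r | p \in predT) p ^ logn p n)%N%:R =
    \sum_(p <- r | prime p) (logn p n)%:R * ln p%:R :> R.
  elim: r => [|p r IH]; first by rewrite !big_nil ln1.
  rewrite !big_cons /= lnM_nat ?pfactor_gt0 //; last first.
    by apply: prodn_gt0 => i; exact: pfactor_gt0.
  rewrite IH; case: ifP => pp; last by rewrite lognE pp expn0 ln1 add0r.
  by rewrite lnX_nat // prime_gt0.
rewrite lnprod; apply: eq_bigr => p pp.
rewrite (@exchange_big_nat _ _ _ _ _ _ _ (fun d => d %| n)%N xpredT) /=.
have -> : (logn p n)%:R * ln p%:R =
    \sum_(1 <= k < n.+1) (if (k <= logn p n)%N then ln p%:R else 0) :> R.
  rewrite (@big_cat_nat _ _ _ (logn p n).+1) //=; last by rewrite ltnS ltnW // ltn_logl.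
  rewrite (eq_big_nat _ _ (F2 := fun=> ln p%:R)); last by move=> k /andP[_]; rewrite ltnS => ->.
  rewrite sumr_const_nat subSS subn0 mulr_natl sum0_nat ?addr0 // => k.
  by case/andP => h _ _; rewrite leqNgt h.
apply: eq_big_nat => k /andP[k1 _]; rewrite -pfactor_dvdn //.
case: ifP => pk; last first.
  rewrite big1 // => d dn; case: eqP => // e; by rewrite e dn in pk.
rewrite big_mkcond (bigD1_seq (p ^ k)%N) ?iota_uniq //=; last first.
  by rewrite mem_index_iota expn_gt0 prime_gt0 // ltnS dvdn_leq.
rewrite pk eqxx big1 ?addr0 // => d; case: ifP => // _.
by rewrite eq_sym => /negPf ->.
Qed.

Lemma vonM_le_ln n : (0 < n)%N -> vonM n <= ln n%:R.
Proof.
move=> n0; rewrite -(sum_vonM_divisors n0) big_mkcond.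
rewrite big_nat_recr //= dvdnn lerDr sumr_ge0 // => d _.
by case: ifP => // _; exact: vonM_ge0.
Qed.

Lemma sum_vonM_primepow Z (F : nat -> R) :
  \sum_(1 <= n < Z) vonM n * F n =
  \sum_(1 <= n < Z) \sum_(0 <= p < Z | prime p) \sum_(1 <= k < Z)
    (if (p ^ k)%N == n then ln p%:R * F n else 0).
Proof.
apply: eq_big_nat => n nZ; rewrite (vonME nZ) mulr_suml; apply: eq_bigr => p _.
by rewrite mulr_suml; apply: eq_bigr => k _; case: ifP; rewrite ?mul0r.
Qed.

(* [f] completely multiplicative: [f * ln = (f * vonM) * f] for the Dirichlet
   convolution [*] on the right, summed up to [Z]. *)
Lemma sum_ln_convol (A : comNzRingType) (phi : {additive R -> A}) (f : nat -> A) Z :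
  (forall m n, (0 < m)%N -> (0 < n)%N -> f (m * n)%N = f m * f n) ->
  \sum_(1 <= n < Z.+1) f n * phi (ln n%:R) =
  \sum_(1 <= d < Z.+1) (f d * phi (vonM d) * \sum_(1 <= m < (Z %/ d).+1) f m).
Proof.
move=> fM.
transitivity (\sum_(1 <= n < Z.+1) \sum_(1 <= d < n.+1 | (d %| n)%N)
                 f n * phi (vonM d)).
  apply: eq_big_nat => n /andP[n0 _].
  by rewrite -(sum_vonM_divisors n0) raddf_sum mulr_sumr.
rewrite (sum_divisor_pairs _ (fun d n => f n * phi (vonM d))).
apply: eq_big_nat => d /andP[d0 _]; rewrite mulr_sumr.
by apply: eq_big_nat => m /andP[m0 _]; rewrite fM // mulrAC.
Qed.

(** Legendre's formula for the logarithm of [Z!], the case [f = 1] of the convolution identity. *)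
Lemma sum_ln_vonM Z :
  \sum_(1 <= n < Z.+1) ln n%:R = \sum_(1 <= d < Z.+1) vonM d * (Z %/ d)%:R :> R.
Proof.
have h := @sum_ln_convol R idfun (fun=> 1) Z; rewrite /= in h.
transitivity (\sum_(1 <= n < Z.+1) 1 * ln n%:R : R).
  by apply: eq_bigr => n _; rewrite mul1r.
rewrite h; last by move=> *; rewrite mulr1.
apply: eq_bigr => d _; rewrite mul1r sumr_const_nat subSS subn0 //.
Qed.

(** * Summation by parts *)

(** Summation by parts: the variation of [g] telescopes to [g a - g b] and the boundary term costs
    [K * g b], so that no factor 2 appears. The induction carries the identity and the bound
    together. *)
Lemma abel_decr (c : nat -> R[i]) (g : nat -> R) (a b : nat) (K : R) :
  (a <= b)%N ->
  (forall n, (a <= n <= b)%N -> normc (\sum_(a <= k < n) c k) <= K) ->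
  (forall n, (a <= n)%N -> 0 <= g n) ->
  (forall n, (a <= n)%N -> g n.+1 <= g n) ->
  normc (\sum_(a <= k < b) c k * (g k)%:C) <= K * g a.
Proof.
move=> ab cK g0 gd.
suff [e h] : \sum_(a <= k < b) c k * (g k)%:C =
    (\sum_(a <= k < b) c k) * (g b)%:C +
    \sum_(a <= k < b) (\sum_(a <= j < k.+1) c j) * (g k - g k.+1)%:C /\
    normc (\sum_(a <= k < b) (\sum_(a <= j < k.+1) c j) * (g k - g k.+1)%:C)
      <= K * (g a - g b).
  rewrite e (le_trans (normcD _ _)) // normcM normc_real ger0_norm ?g0 //.
  have := ler_wpM2r (g0 _ ab) (cK b ltac:(by rewrite ab leqnn)).
  by move: h; lra.
elim: b ab cK => [|b IH] ab cK.
  by move: ab; rewrite leqn0 => /eqP ->; rewrite !big_geq // subrr mul0r addr0 normc0E mulr0.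
move: ab; rewrite leq_eqVlt => /predU1P[->|ab].
  by rewrite !big_geq // subrr mul0r addr0 normc0E mulr0.
have [|e h] := IH ab; first by move=> n /andP[an nb]; apply: cK; rewrite an ltnW.
rewrite !(big_nat_recr b) //= e; split.
  rewrite rmorphB /=; ring.
rewrite (le_trans (normcD _ _)) // normcM normc_real ger0_norm ?subr_ge0 ?gd //.
have := cK b.+1 ltac:(by rewrite leqnn ltnW); rewrite big_nat_recr //= => hb.
have := ler_wpM2r (_ : 0 <= g b - g b.+1) hb; rewrite subr_ge0 gd // => /(_ isT).
by move: h; lra.
Qed.

Lemma abel_window (c : nat -> R[i]) (a0 a n : nat) (K : R) : (a0 <= a <= n)%N ->
  (forall n, (a0 <= n)%N -> normc (\sum_(a0 <= k < n) c k) <= K) ->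
  normc (\sum_(a <= k < n) c k) <= 2 * K.
Proof.
move=> /andP[aa an] cK.
have := normcB (\sum_(a0 <= k < n) c k) (\sum_(a0 <= k < a) c k).
have -> : \sum_(a0 <= k < n) c k - \sum_(a0 <= k < a) c k = \sum_(a <= k < n) c k.
  by rewrite (@big_cat_nat _ _ _ a) //=; ring.
have := cK a aa; have := cK n (leq_trans aa an); lra.
Qed.

(** Here the boundary term costs [K * g b] and the variation [K * (g b - g a)], whence the factor
    2. *)
Lemma abel_incr (c : nat -> R[i]) (g : nat -> R) (a b : nat) (K : R) :
  (a <= b)%N ->
  (forall n, (a <= n <= b)%N -> normc (\sum_(a <= k < n) c k) <= K) ->
  (forall n, (a <= n)%N -> 0 <= g n) ->
  (forall n, (a <= n)%N -> g n <= g n.+1) ->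
  normc (\sum_(a <= k < b) c k * (g k)%:C) <= 2 * K * g b.
Proof.
move=> ab cK g0 gd.
suff [e h] : \sum_(a <= k < b) c k * (g k)%:C =
    (\sum_(a <= k < b) c k) * (g b)%:C -
    \sum_(a <= k < b) (\sum_(a <= j < k.+1) c j) * (g k.+1 - g k)%:C /\
    normc (\sum_(a <= k < b) (\sum_(a <= j < k.+1) c j) * (g k.+1 - g k)%:C)
      <= K * (g b - g a).
  rewrite e (le_trans (normcB _ _)) // normcM normc_real ger0_norm ?g0 //.
  have K0 : 0 <= K by rewrite (le_trans (normc_ge0 _) (cK b _)) // ab leqnn.
  have := ler_wpM2r (g0 _ ab) (cK b ltac:(by rewrite ab leqnn)).
  have := mulr_ge0 K0 (g0 _ (leqnn a)).
  by move: h; lra.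
elim: b ab cK => [|b IH] ab cK.
  by move: ab; rewrite leqn0 => /eqP ->; rewrite !big_geq // subrr mul0r subr0 normc0E mulr0.
move: ab; rewrite leq_eqVlt => /predU1P[->|ab].
  by rewrite !big_geq // subrr mul0r subr0 normc0E mulr0.
have [|e h] := IH ab; first by move=> n /andP[an nb]; apply: cK; rewrite an ltnW.
rewrite !(big_nat_recr b) //= e; split.
  rewrite rmorphB /=; ring.
rewrite (le_trans (normcD _ _)) // normcM normc_real ger0_norm ?subr_ge0 ?gd //.
have := cK b.+1 ltac:(by rewrite leqnn ltnW); rewrite big_nat_recr //= => hb.
have := ler_wpM2r (_ : 0 <= g b.+1 - g b) hb; rewrite subr_ge0 gd // => /(_ isT).
by move: h; lra.
Qed.

Lemma abel_decr_real (c : nat -> R) (g : nat -> R) (a b : nat) (K : R) :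
  (a <= b)%N ->
  (forall n, (a <= n <= b)%N -> `|\sum_(a <= k < n) c k| <= K) ->
  (forall n, (a <= n)%N -> 0 <= g n) ->
  (forall n, (a <= n)%N -> g n.+1 <= g n) ->
  `|\sum_(a <= k < b) c k * g k| <= K * g a.
Proof.
move=> ab cK g0 gd.
have := @abel_decr (fun k => (c k)%:C) g a b K ab _ g0 gd.
under eq_bigr do rewrite -rmorphM /=.
rewrite -real_sum normc_real; apply => n /cK.
by rewrite -real_sum normc_real.
Qed.

(** * Chebyshev and Mertens estimates *)

Lemma ln_le_harmonic_step (n : nat) : (0 < n)%N ->
  n.+1%:R^-1 <= ln n.+1%:R - ln n%:R :> R.
Proof.
move=> n0; have n0' : 0 < n%:R :> R by rewrite ltr0n.
rewrite -ln_div ?posrE ?ltr0n //.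
have := @le_ln1Dx R (- n.+1%:R^-1).
rewrite (_ : 1 - _ = (n.+1%:R / n%:R)^-1); last first.
  by rewrite invf_div -natr1; field; rewrite !gt_eqF // addr_gt0.
rewrite lnV ?posrE ?divr_gt0 ?ltr0n //.
have h : -1 < - n.+1%:R^-1 :> R by rewrite ltrN2 invf_lt1 ?ltr1n ?ltr0n // ltnS.
by move/(_ h); rewrite lerN2.
Qed.

Lemma ln_step_le (n : nat) : (0 < n)%N ->
  ln n.+1%:R - ln n%:R <= n%:R^-1 :> R.
Proof.
move=> n0; have n0' : 0 < n%:R :> R by rewrite ltr0n.
rewrite -ln_div ?posrE ?ltr0n //.
have -> : n.+1%:R / n%:R = 1 + n%:R^-1 :> R by rewrite -natr1; field; rewrite gt_eqF.
by apply: le_ln1Dx; rewrite (@lt_trans _ _ 0) // invr_gt0.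
Qed.

Lemma harmonic_le (n : nat) : (0 < n)%N ->
  \sum_(1 <= k < n.+1) k%:R^-1 <= 1 + ln n%:R :> R.
Proof.
elim: n => // -[_ _|n IH _]; first by rewrite big_nat1 invr1 ln1 addr0.
rewrite big_nat_recr //= (le_trans (lerD (IH isT) (ln_le_harmonic_step _))) //.
by lra.
Qed.

Lemma harmonic_ge (n : nat) :
  ln n.+1%:R <= \sum_(1 <= k < n.+1) k%:R^-1 :> R.
Proof.
elim: n => [|n IH]; first by rewrite big_geq // ln1.
rewrite big_nat_recr //=; have h := @ln_step_le n.+1 isT.
by rewrite (le_trans (_ : _ <= ln n.+1%:R + n.+1%:R^-1)) ?lerD2r // addrC -lerBlDr.
Qed.

Lemma sum_ln_ge (n : nat) : (0 < n)%N ->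
  n%:R * ln n%:R - n%:R <= \sum_(1 <= k < n.+1) ln k%:R :> R.
Proof.
elim: n => // -[_ _|n IH _]; first by rewrite big_nat1 ln1 mulr0 sub0r lerN10.
rewrite big_nat_recr //=; have h1 := IH isT.
have h2 := @ln_step_le n.+1 isT; have n0 : 0 < n.+1%:R :> R by rewrite ltr0n.
have : n.+1%:R * (ln n.+2%:R - ln n.+1%:R) <= 1 :> R.
  by rewrite mulrC -ler_pdivlMr // div1r.
by rewrite -(@natr1 _ n.+1); lra.
Qed.

Lemma sum_ln_le (n : nat) : (0 < n)%N ->
  \sum_(1 <= k < n.+1) ln k%:R <= n%:R * ln n%:R :> R.
Proof.
move=> n0; apply: (@le_trans _ _ (\sum_(1 <= k < n.+1) ln n%:R)).
  by apply: ler_sum_nat => k /andP[k1 kn]; exact: ler_ln_nat.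
by rewrite sumr_const_nat subSS subn0 mulr_natl.
Qed.

Definition chebpsi (n : nat) : R := \sum_(1 <= d < n.+1) vonM d.

(** The left side is the logarithm of [n! / (n./2)! ^ 2], essentially a central binomial
    coefficient. In [ev] the odd factor [2 m + 1] is replaced by [2 m + 2], and each pair then costs
    [2 ln 2 <= 2]. *)
Lemma sum_ln_half (n : nat) :
  \sum_(1 <= k < n.+1) ln k%:R - 2 * \sum_(1 <= k < (n./2).+1) ln k%:R
    <= 2 * n%:R :> R.
Proof.
have ev m : \sum_(1 <= k < (m.*2).+1) ln k%:R <=
    2 * (\sum_(1 <= k < m.+1) ln k%:R) + (m.*2)%:R :> R.
  elim: m => [|m IH]; first by rewrite !big_geq // mulr0 addr0.
  rewrite doubleS !(big_nat_recr _.+2) //= (big_nat_recr _.+1) //= (big_nat_recr m.+1) //=.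
  have h1 : ln (m.*2.+2)%:R = ln 2 + ln m.+1%:R :> R.
    by rewrite -doubleS -mul2n lnM_nat.
  have h2 : ln (m.*2.+1)%:R <= ln (m.*2.+2)%:R :> R by rewrite ler_ln_nat.
  have h3 : ln 2 <= 1 :> R.
    have : ln (1 + 1) <= 1 :> R by rewrite le_ln1Dx //; lra.
    by rewrite -(natrD _ 1 1).
  have h4 : (m.*2.+2)%:R = (m.*2)%:R + 2 :> R by rewrite -addn2 natrD.
  rewrite [X in _ <= _ + X]h4; rewrite h1 in h2 *.
  move: IH h2; lra.
have := odd_double_half n; set m := n./2; case: (odd n) => /= <-.
  rewrite add1n big_nat_recr //=; have := ev m.
  have := @ln_sublinear R m.*2.+1%:R; rewrite ltr0n => /(_ isT).
  rewrite -!natr1; have : 0 <= (m.*2)%:R :> R by []. lra.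
rewrite add0n; have := ev m; have : 0 <= (m.*2)%:R :> R by []. lra.
Qed.

(** With [h = n %/ 2], the coefficient [n %/ d - 2 (h %/ d)] of [vonM d] in the logarithm of
    [n! / h! ^ 2] is nonnegative, and at least 1 for [h < d <= n]. So
    [chebpsi n - chebpsi h <= 2 n], and induction gives [2 n + 4 h <= 4 n]. *)
Lemma chebyshev (n : nat) : chebpsi n <= 4 * n%:R.
Proof.
elim/ltn_ind: n => -[|n] IH; first by rewrite /chebpsi big_geq // mulr0.
have h2 : (n.+1./2 < n.+1)%N by rewrite ltn_half_double; lia.
have hd : (n.+1./2 = n.+1 %/ 2)%N by rewrite divn2.
have h3 : (2 * (n.+1./2)%:R <= n.+1%:R :> R).
  by rewrite -natrM ler_nat mul2n -geq_half_double.
have h4 := IH _ h2; move: (n.+1./2) hd h2 h3 h4 (sum_ln_half n.+1) => h hd h2 h3 h4 h5.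
have : chebpsi n.+1 - chebpsi h <= 2 * n.+1%:R.
  apply: le_trans h5.
  rewrite !sum_ln_vonM /chebpsi.
  rewrite [in X in X - _ <= _](@big_cat_nat _ _ _ h.+1) //=; last by rewrite ltnS ltnW.
  rewrite [in X in _ <= X - _](@big_cat_nat _ _ _ h.+1) //=; last by rewrite ltnS ltnW.
  have l1 : 2 * \sum_(1 <= d < h.+1) vonM d * (h %/ d)%:R <=
      \sum_(1 <= d < h.+1) vonM d * (n.+1 %/ d)%:R.
    rewrite mulr_sumr; apply: ler_sum_nat => d /andP[d0 _].
    rewrite mulrCA ler_wpM2l ?vonM_ge0 //.
    rewrite -natrM ler_nat hd leq_divRL //.
    have := leq_trunc_div (n.+1 %/ 2) d; have := leq_trunc_div n.+1 2.
    by move: (n.+1 %/ 2)%N => a h1 h6; rewrite mulnAC -mulnA mulnC; nia.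
  have l2 : \sum_(h.+1 <= d < n.+2) vonM d <=
      \sum_(h.+1 <= d < n.+2) vonM d * (n.+1 %/ d)%:R.
    apply: ler_sum_nat => d /andP[d1 d2]; rewrite ler_peMr ?vonM_ge0 // ler1n.
    by rewrite divn_gt0 //; lia.
  by move: l1 l2; lra.
by move: h3 h4; lra.
Qed.

(** Replacing [n / d] by its integer part turns [n] times the sum into the logarithm of [n!], which
    lies between [n ln n - n] and [n ln n]; the fractional parts cost at most [chebpsi n <= 4 n]. *)
Lemma mertens1 (n : nat) : (0 < n)%N ->
  `|\sum_(1 <= d < n.+1) vonM d / d%:R - ln n%:R| <= 4.
Proof.
move=> n0; have n0' : 0 < n%:R :> R by rewrite ltr0n.
set S := \sum_(_ <= _ < _) _.
have e : n%:R * S = \sum_(1 <= d < n.+1) vonM d * (n%:R / d%:R).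
  by rewrite mulr_sumr; apply: eq_bigr => d _; ring.
have l1 : \sum_(1 <= k < n.+1) ln k%:R <= n%:R * S.
  rewrite sum_ln_vonM e; apply: ler_sum_nat => d /andP[d1 _].
  rewrite ler_wpM2l ?vonM_ge0 // ler_pdivlMr ?ltr0n // -natrM ler_nat.
  exact: leq_trunc_div.
have l2 : n%:R * S <= \sum_(1 <= k < n.+1) ln k%:R + chebpsi n.
  rewrite sum_ln_vonM e -big_split /=; apply: ler_sum_nat => d /andP[d1 _].
  rewrite -[X in _ + X]mulr1 -mulrDr ler_wpM2l ?vonM_ge0 // natr1.
  rewrite ler_pdivrMr ?ltr0n // -natrM ler_nat ltnW // ltn_ceil //.
have c1 := sum_ln_ge n0; have c2 := sum_ln_le n0; have c3 := chebyshev n.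
rewrite ler_norml; apply/andP; split.
  rewrite -(ler_pM2l n0') mulrBr; lra.
rewrite -(ler_pM2l n0') mulrBr; lra.
Qed.

(** The form of Mertens' estimate that feeds summation by parts: against [1 / k], [vonM] may be
    replaced by 1 at bounded cost. *)
Lemma mertens1_harmonic (n : nat) :
  `|\sum_(1 <= k < n) (vonM k - 1) / k%:R| <= 5.
Proof.
case: n => [|[|n]]; do ?by rewrite big_geq ?normr0.
rewrite (eq_bigr (fun k => vonM k / k%:R - k%:R^-1)); last by move=> k _; ring.
rewrite sumrB; have := mertens1 (ltn0Sn n); have := @harmonic_le n.+1 isT.
have := harmonic_ge n.+1.
have : ln n.+1%:R <= ln n.+2%:R :> R by rewrite ler_ln_nat.
rewrite !ler_norml => h1 h2 h3 /andP[h4 h5]; apply/andP; split; lra.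
Qed.

End VonMangoldt.

(** * Real powers and sums over primes *)

Section Powers.
Context {R : realType}.
Implicit Types (x y d : R) (n m a b : nat).

(* [pw n x] is the real power [n ^ (- x)]. *)
Definition pw n x : R := expR (- (x * ln n%:R)).

Lemma pw_gt0 n x : 0 < pw n x. Proof. exact: expR_gt0. Qed.
Lemma pw_ge0 n x : 0 <= pw n x. Proof. exact: expR_ge0. Qed.

Lemma pw_1 x : pw 1 x = 1. Proof. by rewrite /pw ln1 mulr0 oppr0 expR0. Qed.

Lemma pwM m n x : (0 < m)%N -> (0 < n)%N -> pw (m * n) x = pw m x * pw n x.
Proof. by move=> m0 n0; rewrite /pw lnM_nat // -expRD; congr expR; ring. Qed.

Lemma pwD n x y : pw n (x + y) = pw n x * pw n y.
Proof. by rewrite /pw -expRD; congr expR; ring. Qed.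

Lemma pw_inv n : (0 < n)%N -> pw n 1 = n%:R^-1.
Proof. by move=> n0; rewrite /pw mul1r expRN lnK // posrE ltr0n. Qed.

Lemma pw_le n x y : x <= y -> pw n y <= pw n x.
Proof.
by move=> xy; rewrite ler_expR lerN2 ler_wpM2r // ln_nat_ge0.
Qed.

Lemma pw_le1 n x : 0 <= x -> pw n x <= 1.
Proof. by move=> x0; rewrite /pw expR_le1 oppr_le0 mulr_ge0 // ln_nat_ge0. Qed.

Lemma pw_mono m n x : 0 <= x -> (0 < m <= n)%N -> pw n x <= pw m x.
Proof.
move=> x0 /andP[m0 mn]; rewrite ler_expR lerN2 ler_wpM2l //; exact: ler_ln_nat.
Qed.

Lemma pw_decr n x : 0 <= x -> (0 < n)%N -> pw n.+1 x <= pw n x.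
Proof. by move=> x0 n0; rewrite pw_mono // n0 leqnSn. Qed.

Lemma pw_1D n x : (0 < n)%N -> pw n (1 + x) = n%:R^-1 * pw n x.
Proof. by move=> n0; rewrite pwD pw_inv. Qed.

Lemma normc_natpowc n (s : R[i]) : normc (natpowc n (- s)) = pw n (ReC s).
Proof.
rewrite /natpowc normc_cexp /pw; congr expR.
by rewrite ReM ReN /= mulr0 subr0 mulNr.
Qed.

Lemma natpowcM m n (s : R[i]) : (0 < m)%N -> (0 < n)%N ->
  natpowc (m * n) s = natpowc m s * natpowc n s.
Proof. by move=> m0 n0; rewrite /natpowc -cexpD lnM_nat // rmorphD mulrDr. Qed.

Lemma natpowcD n (s t : R[i]) : natpowc n (s + t) = natpowc n s * natpowc n t.
Proof. by rewrite /natpowc -cexpD mulrDl. Qed.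

Lemma natpowc1 (s : R[i]) : natpowc 1 s = 1.
Proof. by rewrite /natpowc ln1 mulr0 cexp0. Qed.

Lemma natpowc_real n x : natpowc n (- x%:C) = (pw n x)%:C.
Proof. by rewrite /natpowc -rmorphN -rmorphM cexp_real mulNr. Qed.

(** Comparison with the integral of [x ^ (- 1 - d)] over [[n, n + 1]], obtained from
    [1 + x <= expR x]. Together with [pw_step_le] it makes the sums of [n ^ (- 1 - d)] telescope. *)
Lemma pw_step_ge n d : 0 < d -> (0 < n)%N ->
  pw n.+1 (1 + d) <= (pw n d - pw n.+1 d) / d.
Proof.
move=> d0 n0; rewrite ler_pdivlMr // pw_1D //.
have e : pw n d = pw n.+1 d * expR (d * (ln n.+1%:R - ln n%:R)).
  by rewrite /pw -expRD; congr expR; ring.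
have h1 := @ln_le_harmonic_step R _ n0.
have h2 : 1 + d * n.+1%:R^-1 <= expR (d * (ln n.+1%:R - ln n%:R)).
  by rewrite (le_trans _ (expR_ge1Dx _)) // lerD2l ler_pM2l.
have := ler_wpM2l (pw_ge0 n.+1 d) h2; rewrite -e.
by move: (n.+1%:R^-1) => u; lra.
Qed.

Lemma pw_step_le n d : 0 < d -> (0 < n)%N ->
  (pw n d - pw n.+1 d) / d <= pw n (1 + d).
Proof.
move=> d0 n0; rewrite ler_pdivrMr // pw_1D //.
have e : pw n.+1 d = pw n d * expR (- (d * (ln n.+1%:R - ln n%:R))).
  by rewrite /pw -expRD; congr expR; ring.
have h1 := @ln_step_le R _ n0.
have h2 : 1 - d * n%:R^-1 <= expR (- (d * (ln n.+1%:R - ln n%:R))).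
  by rewrite (le_trans _ (expR_ge1Dx _)) // lerD2l lerN2 ler_pM2l.
have := ler_wpM2l (pw_ge0 n d) h2; rewrite -e; lra.
Qed.

Lemma sum_pw_tail a b d : 0 < d -> (1 < a)%N ->
  \sum_(a <= n < b) pw n (1 + d) <= pw a.-1 d / d.
Proof.
case: a => [|[|a]] // d0 _.
have [ba|ab] := leqP b a.+2; first by rewrite big_geq // divr_ge0 ?pw_ge0 // ltW.
suff : \sum_(a.+2 <= n < b) pw n (1 + d) <= (pw a.+1 d - pw b.-1 d) / d.
  move=> h; rewrite (le_trans h) // ler_pM2r ?invr_gt0 // gerBl; exact: pw_ge0.
elim: b ab => // b IH; rewrite ltnS leq_eqVlt => /predU1P[<-|ab].
  by rewrite big_nat1; exact: pw_step_ge.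
rewrite big_nat_recr //=; last exact: ltnW.
have := IH ab; case: b ab {IH} => // b ab /= h.
have := @pw_step_ge b d d0 ltac:(by move: ab; lia); move: h.
by rewrite !mulrBl; lra.
Qed.

Lemma sum_pw_le b d : 0 < d -> \sum_(1 <= n < b) pw n (1 + d) <= 1 + d^-1.
Proof.
move=> d0; case: b => [|[|b]].
- by rewrite big_geq // addr_ge0 // invr_ge0 ltW.
- by rewrite big_geq // addr_ge0 // invr_ge0 ltW.
rewrite big_ltn // pw_1 lerD2l (le_trans (sum_pw_tail _ d0 _)) //=.
by rewrite pw_1 div1r.
Qed.

Lemma sum_pw_ge b d : 0 < d -> (0 < b)%N ->
  (1 - pw b d) / d <= \sum_(1 <= n < b) pw n (1 + d).
Proof.
move=> d0; elim: b => // -[|b] IH _; first by rewrite big_geq // pw_1 subrr mul0r.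
rewrite big_nat_recr //=; have := IH isT; have := @pw_step_le b.+1 d d0 isT.
by rewrite !mulrBl; lra.
Qed.

(** From [1 + x <= expR x] at [x = d ln n]: a logarithm is absorbed by the power [n ^ d] at the
    price [1 / d]. *)
Lemma ln_pw_le n d : 0 < d -> ln n%:R * pw n d <= d^-1.
Proof.
move=> d0; rewrite /pw expRN ler_pdivrMr ?expR_gt0 //.
rewrite mulrC ler_pdivlMr // mulrC (le_trans _ (expR_ge1Dx _)) //; lra.
Qed.

Lemma ln_pw_le_exp n k d : 0 < d -> ln n%:R ^+ k * pw n (k%:R * d) <= d^-1 ^+ k.
Proof.
move=> d0; have -> : pw n (k%:R * d) = pw n d ^+ k.
  by rewrite /pw -expRM_natl; congr expR; ring.
by rewrite -exprMn lerXn2r ?nnegrE ?mulr_ge0 ?ln_nat_ge0 ?pw_ge0 ?invr_ge0 ?ln_pw_le // ltW.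
Qed.

(** The part [vonM n - 1] is summed by parts and costs 5, the sum of [n ^ (- 1 - d)] costs
    [1 + 1 / d], and [6 + 1 / d <= 7 / d]. *)
Lemma sum_vonM_pw b d : 0 < d <= 1 ->
  \sum_(1 <= n < b) vonM n * pw n (1 + d) <= 7 / d.
Proof.
move=> /andP[d0 d1].
have i1 : 1 <= d^-1 by rewrite invf_ge1.
have [b1|b1] := leqP b 1; first by rewrite big_geq //; lra.
have -> : \sum_(1 <= n < b) vonM n * pw n (1 + d) =
    \sum_(1 <= n < b) ((vonM n - 1) / n%:R) * pw n d + \sum_(1 <= n < b) pw n (1 + d).
  rewrite -big_split /=; apply: eq_big_nat => n /andP[n0 _].
  by rewrite pw_1D //; ring.
have := @abel_decr_real R (fun n => (vonM n - 1) / n%:R) (fun n => pw n d) 1 b 5 (ltnW b1).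
rewrite pw_1 => h.
have := sum_pw_le b d0.
have {h} : `|\sum_(1 <= k < b) (vonM k - 1) / k%:R * pw k d| <= 5 * 1.
  apply: h => [n _|n _|n n0]; [exact: mertens1_harmonic|exact: pw_ge0|].
  by apply: pw_decr => //; exact: ltW.
rewrite ler_norml => /andP[_]; lra.
Qed.

(** Half of the exponent [d] absorbs the power of the logarithm, the other half makes the sum
    converge. *)
Lemma sum_vonM_lnk_pw b k d : 0 < d <= 1 -> (0 < k)%N ->
  \sum_(1 <= n < b) vonM n * ln n%:R ^+ k * pw n (1 + d) <=
    14 / d * (2 * k%:R / d) ^+ k.
Proof.
move=> /andP[d0 d1] k0; have k0' : 0 < k%:R :> R by rewrite ltr0n.
have e0 : 0 < d / (2 * k%:R) by rewrite divr_gt0 ?mulr_gt0.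
apply: (@le_trans _ _ (\sum_(1 <= n < b) vonM n * pw n (1 + d / 2) * (2 * k%:R / d) ^+ k)).
  apply: ler_sum_nat => n _.
  have -> : 1 + d = (1 + d / 2) + k%:R * (d / (2 * k%:R)) by field; rewrite gt_eqF.
  rewrite pwD -!mulrA ler_wpM2l ?vonM_ge0 // mulrCA ler_wpM2l ?pw_ge0 //.
  by rewrite (le_trans (ln_pw_le_exp _ _ e0)) // invf_div mulrA.
rewrite -mulr_suml ler_wpM2r //.
  by rewrite exprn_ge0 // divr_ge0 ?mulr_ge0 // ltW.
rewrite (le_trans (sum_vonM_pw _ _)) //; last by rewrite invf_div; lra.
by apply/andP; split; lra.
Qed.

Lemma sum_ln_exp_sq_tail a b k : (1 < a)%N -> (0 < k)%N ->
  \sum_(a <= n < b) ln n%:R ^+ k / n%:R ^+ 2 <=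
    2 * (2 * k%:R) ^+ k * pw a.-1 (1 / 2).
Proof.
move=> a1 k0; have k0' : 0 < k%:R :> R by rewrite ltr0n.
have e0 : 0 < (1 / (2 * k%:R) : R) by rewrite divr_gt0 ?mulr_gt0.
apply: (@le_trans _ _ (\sum_(a <= n < b) pw n (1 + 1 / 2) * (2 * k%:R) ^+ k)).
  apply: ler_sum_nat => n /andP[an _]; have n0 : (0 < n)%N by move: a1 an; lia.
  have -> : n%:R ^- 2 = pw n (1 + 1 / 2) * pw n (k%:R * (1 / (2 * k%:R))).
    rewrite -pwD (_ : _ + _ + _ = 1 + 1); last by field; rewrite gt_eqF.
    by rewrite pwD pw_inv // expr2 invfM.
  rewrite mulrCA ler_wpM2l ?pw_ge0 // (le_trans (ln_pw_le_exp _ _ e0)) //.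
  by rewrite div1r invrK.
rewrite -mulr_suml mulrAC ler_wpM2r ?exprn_ge0 ?mulr_ge0 ?ler0n //.
rewrite (le_trans (sum_pw_tail _ _ _)) //; first by lra.
Qed.

Lemma sum_ln_sq_le b : \sum_(1 <= n < b) ln n%:R ^+ 2 / n%:R ^+ 2 <= 32 :> R.
Proof.
have [b1|b1] := leqP b 1; first by rewrite big_geq.
rewrite big_ltn // ln1 expr0n /= mul0r add0r.
by rewrite (le_trans (sum_ln_exp_sq_tail _ _ _)) //= pw_1; lra.
Qed.

(** The constant 6 is reached in the limit at [x = 1 / 2]. The strengthened claim carries the exact
    remainder at that point, which makes the induction close. *)
Lemma sum_kxk_le x m : 0 <= x <= 1 / 2 ->
  \sum_(2 <= k < m.+2) k%:R * x ^+ k <= 6 * x ^+ 2.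
Proof.
move=> /andP[x0 x1].
suff : \sum_(2 <= k < m.+2) k%:R * x ^+ k <=
    x ^+ 2 * (6 - 2 * (m + 3)%:R * (1 / 2) ^+ m).
  move=> h; rewrite (le_trans h) // mulrC ler_wpM2r ?exprn_ge0 // gerBl.
  by rewrite mulr_ge0 // exprn_ge0.
elim: m => [|m IH]; first by rewrite big_geq // expr0 mulr1 add0n; lra.
rewrite big_nat_recr //= (le_trans (lerD IH (lexx _))) //.
have : x ^+ m <= (1 / 2) ^+ m by rewrite lerXn2r ?nnegrE.
move=> h; have := ler_wpM2l (_ : 0 <= x ^+ 2 * m.+2%:R) h.
rewrite mulr_ge0 ?exprn_ge0 // => /(_ isT).
have -> : x ^+ m.+2 = x ^+ 2 * x ^+ m by rewrite -exprD.
have -> : m.+2%:R = m%:R + 2 :> R by rewrite -addn2 natrD.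
have -> : (m.+1 + 3)%:R = m%:R + 4 :> R by rewrite addSnnS natrD.
by rewrite natrD [(1 / 2) ^+ m.+1]exprS; move: (x ^+ m) ((1 / 2) ^+ m) (m%:R) => u v w; lra.
Qed.

(** [F] vanishes at primes, so that only the powers [p ^ k] with [k >= 2] remain. For each [p] they
    give at most [(ln p) ^ 2 * sum_(k >= 2) k / p ^ k <= 6 (ln p / p) ^ 2], and [192 = 6 * 32]. *)
Lemma sum_vonM_nonprime_ln Z :
  \sum_(1 <= n < Z | ~~ prime n) vonM n * (ln n%:R / n%:R) <= 192 :> R.
Proof.
pose F n : R := if prime n then 0 else ln n%:R / n%:R.
have F0 n : 0 <= F n.
  by rewrite /F; case: ifP => // _; rewrite divr_ge0 // ln_nat_ge0.
have -> : \sum_(1 <= n < Z | ~~ prime n) vonM n * (ln n%:R / n%:R) =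
    \sum_(1 <= n < Z) vonM n * F n :> R.
  rewrite big_mkcond; apply: eq_bigr => n _; rewrite /F.
  by case: (prime n) => /=; rewrite ?mulr0.
rewrite sum_vonM_primepow (@exchange_big_nat _ _ _ _ _ _ _ xpredT prime) /=.
have step p : prime p ->
    \sum_(1 <= n < Z) \sum_(1 <= k < Z) (if (p ^ k)%N == n then ln p%:R * F n else 0)
    <= 6 * (ln p%:R ^+ 2 / p%:R ^+ 2).
  move=> pp; have p0 := prime_gt0 pp; rewrite exchange_big_nat /=.
  have p0' : 0 < p%:R :> R by rewrite ltr0n.
  apply: (@le_trans _ _ (\sum_(1 <= k < Z) ln p%:R * F (p ^ k)%N)).
    apply: ler_sum_nat => k _.
    rewrite (eq_bigr (fun n => if n == (p ^ k)%N then ln p%:R * F (p ^ k)%N else 0)); last first.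
      by move=> n _; rewrite eq_sym; case: eqP => // ->.
    rewrite -big_mkcond /= big_const_seq.
    have : (count (fun i : nat => i == (p ^ k)%N) (index_iota 1 Z) <= 1)%N.
      by rewrite (@count_uniq_mem _ _ (p ^ k)%N) ?iota_uniq // leq_b1.
    have h : 0 <= ln p%:R * F (p ^ k)%N by rewrite mulr_ge0 ?ln_nat_ge0.
    by case: (count _ _) => [|[|]] //= _; rewrite addr0.
  have [Z1|Z1] := leqP Z 1.
    by rewrite big_geq // mulr_ge0 // divr_ge0 ?exprn_ge0 ?ln_nat_ge0.
  rewrite big_ltn // {1}/F expn1 pp mulr0 add0r.
  case: Z Z1 => [|[|Z]] // _.
  apply: (@le_trans _ _ (ln p%:R ^+ 2 * \sum_(2 <= k < Z.+2) k%:R * p%:R^-1 ^+ k)).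
    rewrite mulr_sumr; apply: ler_sum_nat => k _; rewrite /F; case: ifP => _.
      by rewrite mulr0 mulr_ge0 ?exprn_ge0 ?ln_nat_ge0 // mulr_ge0 // exprn_ge0 ?invr_ge0.
    by rewrite lnX_nat // natrX exprVn le_eqVlt; apply/orP; left; apply/eqP; ring.
  rewrite mulrCA -exprVn ler_wpM2l ?exprn_ge0 ?ln_nat_ge0 //.
  apply: sum_kxk_le; rewrite invr_ge0 ltW //= div1r lef_pV2 ?posrE //.
  by rewrite ler_nat prime_gt1.
rewrite (le_trans (ler_sum _ step)) //.
rewrite -mulr_sumr (_ : 192 = 6 * 32) ?ler_pM2l //; last by ring.
have [Z0|Z0] := posnP Z; first by rewrite Z0 big_geq.
apply: le_trans (sum_ln_sq_le Z).
rewrite big_mkcond big_ltn //= add0r; apply: ler_sum_nat => n _.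
by case: ifP => // _; rewrite divr_ge0 ?exprn_ge0 ?ln_nat_ge0.
Qed.

Lemma ln4_ge1 n : (4 <= n)%N -> 1 <= ln n%:R :> R.
Proof.
move=> n4; apply: (@le_trans _ _ (ln (2 * 2)%N%:R)); last exact: ler_ln_nat.
rewrite lnM_nat //; have := @ln_le_harmonic_step R 1 isT; rewrite ln1; lra.
Qed.

Lemma vonM_1 : vonM 1 = 0 :> R.
Proof. by apply/eqP; rewrite eq_le vonM_ge0 andbT (le_trans (vonM_le_ln _)) ?ln1. Qed.

(** The least nonprime above 1 is 4, and [ln n >= 1] from there on, so the sum with the extra
    logarithm dominates. *)
Lemma sum_vonM_nonprime Z : \sum_(1 <= n < Z | ~~ prime n) vonM n / n%:R <= 192 :> R.
Proof.
apply: le_trans (sum_vonM_nonprime_ln Z).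
rewrite big_nat_cond [X in _ <= X]big_nat_cond; apply: ler_sum => n /andP[/andP[n1 _] np].
have [->|n1'] := eqVneq n 1%N; first by rewrite vonM_1 !mul0r.
rewrite ler_wpM2l ?vonM_ge0 //.
have [n4|n4] := leqP 4 n.
  by rewrite ler_peMl ?invr_ge0 // ln4_ge1.
by case: n n1 n1' np n4 => [|[|[|[|]]]].
Qed.

Lemma ln_le_ln_next n : ln n%:R <= ln n.+1%:R :> R.
Proof. by case: n => [|n]; [rewrite ln0 // ln1|exact: ler_ln_nat]. Qed.

Lemma sum_vonM_window a b : (0 < a <= b)%N ->
  `|\sum_(a <= n < b) vonM n / n%:R - (ln b%:R - ln a%:R)| <= 11 :> R.
Proof.
move=> /andP[a0 ab].
have h1 := @mertens1_harmonic R a; have h2 := @mertens1_harmonic R b.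
have e : \sum_(1 <= k < b) (vonM k - 1) / k%:R = \sum_(1 <= k < a) (vonM k - 1) / k%:R
   + \sum_(a <= n < b) vonM n / n%:R - \sum_(a <= n < b) n%:R^-1 :> R.
  rewrite (@big_cat_nat _ _ _ a) //= -addrA -sumrB; congr (_ + _).
  by apply: eq_bigr => k _; ring.
have [h3 h4] : ln b%:R - ln a%:R <= \sum_(a <= n < b) n%:R^-1 :> R /\
    \sum_(a <= n < b) n%:R^-1 <= ln b%:R - ln a%:R + 1 :> R.
  move: ab; rewrite leq_eqVlt => /predU1P[<-|ab].
    by rewrite big_geq // subrr; split => //; lra.
  split.
    elim: b ab {h2 e} => // b IH; rewrite ltnS leq_eqVlt => /predU1P[<-|ab].
      by rewrite big_nat1; exact: ln_step_le.
    rewrite big_nat_recr //=; last exact: ltnW.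
    have b0 : (0 < b)%N by move: ab a0; lia.
    have := IH ab; have := @ln_step_le R _ b0; lra.
  rewrite big_ltn // addrC lerD //; last by rewrite invf_le1 ?ltr0n // ler1n.
  case: b ab {h2 e} => // b; rewrite ltnS => ab.
  apply: (@le_trans _ _ (ln b%:R - ln a%:R)); last by rewrite lerD2r ln_le_ln_next.
  elim: b ab => [|b IH]; first by move: a0; lia.
  rewrite leq_eqVlt => /predU1P[<-|ab]; first by rewrite big_geq // subrr.
  rewrite big_nat_recr //=; have b0 : (0 < b)%N by move: ab a0; lia.
  have h3 := IH ab; have h4 := @ln_le_harmonic_step R b b0.
  by move: h3 h4; move: (b.+1%:R^-1) => u; lra.
move: h1 h2; rewrite e !ler_norml => /andP[h5 h6] /andP[h7 h8].
by apply/andP; split; lra.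
Qed.

(** [203 = 11 + 192]: the error of [sum_vonM_window], and the proper prime powers that are
    removed. *)
Lemma prime_window a b : (0 < a <= b)%N ->
  ln b%:R - ln a%:R - 203 <= \sum_(a <= p < b | prime p) ln p%:R / p%:R :> R /\
  \sum_(a <= p < b | prime p) ln p%:R / p%:R <= ln b%:R - ln a%:R + 11 :> R.
Proof.
move=> ab; have := sum_vonM_window ab; have /andP[a0 ab'] := ab.
rewrite (bigID prime) /=.
rewrite (eq_bigr (fun p => ln p%:R / p%:R)); last by move=> p /vonM_prime ->.
have h1 : \sum_(a <= n < b | ~~ prime n) vonM n / n%:R <= 192 :> R.
  apply: le_trans (sum_vonM_nonprime b).
  rewrite [X in _ <= X](@big_cat_nat _ _ _ a) //= lerDr sumr_ge0 // => n _.
  by rewrite divr_ge0 ?vonM_ge0.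
have h2 : 0 <= \sum_(a <= n < b | ~~ prime n) vonM n / n%:R :> R.
  by rewrite sumr_ge0 // => n _; rewrite divr_ge0 ?vonM_ge0.
rewrite ler_norml => /andP[h3 h4]; split; lra.
Qed.

End Powers.

(** * Finite Euler products of absolutely convergent series *)

Section EulerProduct.
Context {R : realType}.
Variables (f : nat -> R[i]) (d : R).
Hypothesis f1 : f 1%N = 1.
Hypothesis fM : forall m n, (0 < m)%N -> (0 < n)%N -> f (m * n)%N = f m * f n.
Hypothesis d0 : 0 < d.
Hypothesis fd : forall n, (0 < n)%N -> normc (f n) <= pw n (1 + d).

Lemma abs_series_cvg : exists l, tends (fun Z => \sum_(1 <= n < Z.+1) f n) l.
Proof.
have [|n|l hl] := @tends_series R (fun n => f n.+1) (fun n => pw n.+1 (1 + d)) (1 + d^-1).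
- by move=> n; exact: fd.
- by rewrite -(big_add1 _ _ 0 n.+1 xpredT (fun n => pw n (1 + d))); exact: sum_pw_le.
exists l; apply: tends_eq hl; exists 0%N => n _.
by rewrite big_add1.
Qed.

Let cop P n := all (fun p => prime p ==> ~~ (p %| n)%N) (iota 0 P).

Let copS P n : cop P.+1 n = cop P n && (prime P ==> ~~ (P %| n)%N).
Proof. by rewrite /cop -addn1 iotaD all_cat /= andbT. Qed.

Let copM P n : prime P -> cop P (P * n) = cop P n.
Proof.
move=> pP; rewrite /cop; apply: eq_in_all => p; rewrite mem_iota add0n /= => pP'.
case: (boolP (prime p)) => //= pp; rewrite Euclid_dvdM // dvdn_prime2 //.
by rewrite (ltn_eqF pP').
Qed.

Let A P Z := \sum_(1 <= n < Z.+1 | cop P n) f n.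

(** [A P Z] keeps the [n <= Z] without prime factor below [P]. Those divisible by the prime [P] are
    the [P * m] with [m <= Z %/ P], where [m] passes the same test. *)
Let A_step P Z : prime P -> A P.+1 Z = A P Z - f P * A P (Z %/ P).
Proof.
move=> pP; have P0 := prime_gt0 pP; rewrite /A.
rewrite [in X in _ = X - _](bigID (fun n => (P %| n)%N)) /=.
have -> : \sum_(1 <= n < Z.+1 | cop P n && (P %| n)%N) f n =
    f P * \sum_(1 <= n < (Z %/ P).+1 | cop P n) f n.
  transitivity (\sum_(1 <= n < Z.+1 | (P %| n)%N) (if cop P n then f n else 0)).
    by rewrite -big_mkcondr; apply: eq_bigl => n; rewrite andbC.
  rewrite sum_multiples // mulr_sumr [RHS]big_mkcond.
  by apply: eq_big_nat => m /andP[m0 _]; rewrite copM // fM //; case: ifP.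
rewrite addrC addrK; apply: eq_bigl => n; by rewrite copS pP.
Qed.

Lemma tends_comp (u : nat -> R[i]) (g : nat -> nat) l : tends u l ->
  (forall N, exists M, forall n, (M <= n)%N -> (N <= g n)%N) ->
  tends (fun n => u (g n)) l.
Proof.
move=> ul hg e e0; have [N HN] := ul e e0; have [M HM] := hg N.
by exists M => n /HM /HN.
Qed.

(* Sieve of Eratosthenes: multiplying by [1 - f p] removes the multiples of
   [p], so that the first [n > 1] surviving is at least [P]. *)
Lemma euler_product_tail L P : (1 < P)%N ->
  tends (fun Z => \sum_(1 <= n < Z.+1) f n) L ->
  normc (\prod_(0 <= p < P | prime p) (1 - f p) * L - 1) <= pw P.-1 d / d.
Proof.
move=> P1 hL.
have hA Q : tends (A Q) (\prod_(0 <= p < Q | prime p) (1 - f p) * L).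
  elim: Q => [|Q IH].
    by rewrite big_geq // mul1r.
  rewrite big_mkcond big_nat_recr //= -big_mkcond.
  case: (boolP (prime Q)) => pQ; last first.
    rewrite mulr1; apply: tends_eq IH; exists 0%N => n _; apply: eq_bigl => m.
    by rewrite copS (negPf pQ) andbT.
  have h : tends (fun Z => A Q Z + (- f Q) * A Q (Z %/ Q))
     (\prod_(0 <= i < Q | prime i) (1 - f i) * L +
       - f Q * (\prod_(0 <= i < Q | prime i) (1 - f i) * L)).
    apply: tendsD => //; apply: tendsMl; apply: tends_comp => // N.
    by exists (N * Q)%N => n; rewrite leq_divRL ?prime_gt0.
  rewrite [X in tends _ X](_ : _ = \prod_(0 <= i < Q | prime i) (1 - f i) * L +
       - f Q * (\prod_(0 <= i < Q | prime i) (1 - f i) * L)); last by ring.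
  by apply: tends_eq h; exists 0%N => n _; rewrite A_step // mulNr.
apply: (tends_dist_le (hA P)); exists P => Z PZ.
have -> : A P Z - 1 = \sum_(P <= n < Z.+1 | cop P n) f n.
  rewrite /A big_mkcond big_ltn; last by move: P1 PZ; lia.
  have -> : cop P 1.
    by apply/allP => p _; apply/implyP => /prime_gt1; rewrite dvdn1 => /gtn_eqF ->.
  rewrite f1 /= [1 + _]addrC addrK -big_mkcond (@big_cat_nat _ _ _ P) //=; last exact: leqW.
  rewrite sum0_nat ?add0r // => n /andP[n1 nP] /allP /(_ (pdiv n)).
  rewrite mem_iota add0n /= (leq_ltn_trans (pdiv_leq _) nP); last by move: n1; lia.
  by move=> /(_ isT); rewrite pdiv_prime //= pdiv_dvd.
rewrite (le_trans (normc_sum _ _ _)) //.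
apply: le_trans (sum_pw_tail Z.+1 d0 P1).
rewrite big_mkcond; apply: ler_sum_nat => n /andP[Pn _].
by case: ifP => _; rewrite ?pw_ge0 // fd //; move: Pn P1; lia.
Qed.

End EulerProduct.

(** * Characters and the value L(1, chi) *)

Section Characters.
Context {R : realType}.
Variables (q : nat) (chi : int -> R[i]).
Hypothesis q1 : (1 < q)%N.
Hypothesis chiP : dirichlet_character q chi.

Local Notation f n := (chi (Posz n)).

Lemma chi_nat1 : f 1 = 1.
Proof.
have [cM _ cN] := chiP; have c1 : f 1 != 0 by rewrite cN coprimezE /= coprime1n.
by apply: (mulfI c1); rewrite mulr1 -cM mulr1.
Qed.

Lemma chi_natM m n : f (m * n) = f m * f n.
Proof. by have [cM _ _] := chiP; rewrite PoszM cM. Qed.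

Lemma chi_nat_neq0 n : (f n != 0) = coprime n q.
Proof. by have [_ _ cN] := chiP; rewrite cN /coprimez. Qed.

Lemma chi_nat_eq0 n : ~~ coprime n q -> f n = 0.
Proof. by rewrite -chi_nat_neq0 negbK => /eqP. Qed.

Lemma chi_nat0 : f 0 = 0.
Proof. by apply: chi_nat_eq0; rewrite /coprime gcd0n gtn_eqF. Qed.

Lemma chi_natD n : f (n + q) = f n.
Proof. by have [_ cD _] := chiP; rewrite PoszD cD. Qed.

Lemma chi_nat_modn n : f (n %% q)%N = f n.
Proof.
rewrite [in RHS](divn_eq n q) addnC; elim: (n %/ q)%N => [|k IH].
  by rewrite mul0n addn0.
by rewrite mulSn addnCA addnC chi_natD.
Qed.

Lemma chi_natX n k : f (n ^ k) = f n ^+ k.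
Proof. by elim: k => [|k IH]; rewrite ?expn0 ?chi_nat1 // expnS chi_natM IH exprS. Qed.

(** By Euler's theorem [f n] is a root of unity. *)
Lemma chi_nat_norm1 n : coprime n q -> normc (f n) = 1.
Proof.
move=> nq; have e : f n ^+ totient q = 1.
  rewrite -chi_natX -chi_nat_modn cyclic.Euler_exp_totient // chi_nat_modn.
  exact: chi_nat1.
have : normc (f n) ^+ totient q = 1 by rewrite -normcXE e normc1E.
by move/eqP; rewrite pexpr_eq1 ?normc_ge0 ?totient_gt0 ?(ltnW q1) // => /eqP.
Qed.

Lemma chi_nat_norm_le1 n : normc (f n) <= 1.
Proof.
case: (boolP (coprime n q)) => [/chi_nat_norm1 -> //|/chi_nat_eq0 ->].
by rewrite normc0E.
Qed.

(** Multiplication by [b] permutes the residues modulo [q] and multiplies the sum by [f b]. *)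
Lemma chi_sum_period b : coprime b q -> f b != 1 -> \sum_(0 <= a < q) f a = 0.
Proof.
move=> bq fb; rewrite big_mkord.
have q0 : (0 < q)%N by lia.
pose s (a : 'I_q) := Ordinal (ltn_pmod (b * a) q0).
have s_inj : injective s.
  move=> a a' [/eqP e]; apply: val_inj => /=.
  have {e} : a = a' %[mod q].
    move: e; wlog aa : a a' / (a <= a')%N => [H|] e.
      by have [/H|/ltnW/H] := leqP a a'; [exact|move=> H'; symmetry; apply: H'; rewrite eq_sym].
    move: e; rewrite eq_sym eqn_mod_dvd ?leq_mul2l ?aa ?orbT // -mulnBr.
    by rewrite Gauss_dvdr 1?coprime_sym // -eqn_mod_dvd // => /eqP.
  by rewrite !modn_small.
have e : f b * \sum_(a < q) f a = \sum_(a < q) f a.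
  rewrite mulr_sumr [RHS](reindex_inj s_inj) /=; apply: eq_bigr => a _.
  by rewrite chi_nat_modn chi_natM.
apply/eqP; have : (f b - 1) * \sum_(a < q) f a == 0 by rewrite mulrBl mul1r e subrr.
by rewrite mulf_eq0 subr_eq0 (negPf fb).
Qed.

(** Whole periods contribute 0, and what remains has fewer than [q] terms of modulus at most 1. *)
Lemma chi_partial_sum b Z : coprime b q -> f b != 1 ->
  normc (\sum_(1 <= n < Z) f n) <= q%:R.
Proof.
move=> bq fb.
have -> : \sum_(1 <= n < Z) f n = \sum_(0 <= n < Z) f n.
  case: Z => [|Z]; first by rewrite !big_geq.
  by rewrite [RHS]big_ltn // chi_nat0 add0r.
elim/ltn_ind: Z => Z IH.
have [Zq|qZ] := ltnP Z q.
  rewrite (le_trans (normc_sum _ _ _)) //.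
  apply: (@le_trans _ _ (\sum_(0 <= n < Z) 1)).
    by apply: ler_sum => n _; exact: chi_nat_norm_le1.
  by rewrite sumr_const_nat subn0 ler_nat ltnW.
rewrite (@big_cat_nat _ _ _ q) //= (chi_sum_period bq fb) add0r.
rewrite -{1}(add0n q) big_addn.
rewrite (eq_bigr (fun n => f n)) => [|n _]; last by rewrite chi_natD.
by apply: IH; lia.
Qed.

End Characters.

(** * Completely multiplicative functions with bounded partial sums *)

Section BoundedCharacterSums.
Context {R : realType}.
Variables (q : nat) (f : nat -> R[i]).
Hypothesis f1 : f 1%N = 1.
Hypothesis fM : forall m n, f (m * n)%N = f m * f n.
Hypothesis fle1 : forall n, normc (f n) <= 1.
Hypothesis fsum : forall Z, normc (\sum_(1 <= n < Z) f n) <= q%:R.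

Lemma abel_identity (c : nat -> R[i]) (g : nat -> R) (a b : nat) : (a <= b)%N ->
  \sum_(a <= k < b) c k * (g k)%:C =
    (\sum_(a <= k < b) c k) * (g b)%:C +
    \sum_(a <= k < b) (\sum_(a <= j < k.+1) c j) * (g k - g k.+1)%:C.
Proof.
elim: b => [|b IH]; first by rewrite leqn0 => /eqP ->; rewrite !big_geq // mul0r addr0.
rewrite leq_eqVlt => /predU1P[->|ab]; first by rewrite !big_geq // mul0r addr0.
rewrite !(big_nat_recr b) //= IH // rmorphB /=; ring.
Qed.

Let T Z := \sum_(1 <= n < Z.+1) f n * (n%:R^-1)%:C.

Lemma L1_cvg : exists l, tends T l.
Proof.
pose u k : R[i] := (\sum_(1 <= j < k.+2) f j) * (k.+1%:R^-1 - k.+2%:R^-1)%:C.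
have inv_le k : 0 <= k.+1%:R^-1 - k.+2%:R^-1 :> R.
  by rewrite subr_ge0 lef_pV2 ?posrE ?ltr0n // ler_nat.
have [|n|l hl] := @tends_series R u (fun k => q%:R * (k.+1%:R^-1 - k.+2%:R^-1)) q%:R.
- move=> n; rewrite normcM normc_real ger0_norm // ler_wpM2r //.
- rewrite -mulr_sumr ler_piMr //.
  rewrite (eq_bigr (fun k => - (k.+2%:R^-1) - - (k.+1%:R^-1))); last by move=> k _; ring.
  rewrite (telescope_sumr (fun k => - (k.+1%:R^-1))) // invr1 opprK addrC.
  by rewrite gerBl invr_ge0.
exists l; apply: (@tends_close _ (fun n => \sum_(0 <= k < n) u k) _ _ (fun n => q%:R * n.+1%:R^-1)); last exact: hl.
  move=> n; rewrite normcBC /T (abel_identity f (fun n => n%:R^-1)) //.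
  rewrite [X in _ + X - _]big_add1 /= addrK.
  rewrite normcM normc_real ger0_norm ?invr_ge0 // ler_wpM2r ?invr_ge0 //.
move=> e e0; have h : 0 <= q%:R / e by rewrite divr_ge0 // ltW.
exists (Num.bound (q%:R / e)) => n hn.
rewrite ltr_pdivrMr ?ltr0n // mulrC -ltr_pdivrMr //.
rewrite (lt_le_trans (archi_boundP h)) // ler_nat; exact: leqW.
Qed.

Lemma L1_tail l Z : tends T l -> normc (T Z - l) <= 2 * q%:R / Z.+1%:R.
Proof.
move=> hl; rewrite normcBC; apply: (tends_dist_le hl); exists Z => n Zn.
rewrite /T (@big_cat_nat _ _ _ Z.+1) //= [X in X - _]addrC addrK.
apply: (@abel_decr _ f (fun n => n%:R^-1)) => // [m /andP[Zm _]|m Zm].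
  by apply: (@abel_window _ f 1) => //; rewrite Zm.
by rewrite lef_pV2 ?posrE ?ltr0n ?ler_nat //; lia.
Qed.

Lemma lnn_decr n : (4 <= n)%N -> ln n.+1%:R / n.+1%:R <= ln n%:R / n%:R :> R.
Proof.
move=> n4; have n0 : (0 < n)%N by lia.
rewrite ler_pdivrMr ?ltr0n // mulrAC ler_pdivlMr ?ltr0n //.
have h := @ln_step_le R n n0.
have : (ln n.+1%:R - ln n%:R) * n%:R <= 1 :> R.
  by rewrite -ler_pdivlMr ?ltr0n // div1r.
have := @ln4_ge1 R n n4; rewrite -(@natr1 R n); lra.
Qed.

Lemma sum_chi_ln_bounded Z :
  normc (\sum_(1 <= n < Z) f n * (ln n%:R / n%:R)%:C) <= 2 * q%:R + 3.
Proof.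
have small n : (0 < n)%N -> normc (f n * (ln n%:R / n%:R)%:C) <= 1.
  move=> n0; rewrite normcM normc_real ger0_norm ?divr_ge0 ?ln_nat_ge0 //.
  rewrite mulr_ile1 ?normc_ge0 ?divr_ge0 ?ln_nat_ge0 //.
  by rewrite ler_pdivrMr ?ltr0n // mul1r ltW // ln_sublinear // ltr0n.
(* The decrease of [ln n / n] is used from 4 on; the terms [n = 1, 2, 3] are bounded by 1 each,
   whence the 3. *)
have [Z4|Z4] := leqP Z 4.
  rewrite (le_trans (normc_sum _ _ _)) // (le_trans (_ : _ <= \sum_(1 <= n < Z) 1)) //.
    by apply: ler_sum_nat => n /andP[n0 _]; exact: small.
  rewrite sumr_const_nat (le_trans (_ : _ <= 3)) // ?lerDr ?mulr_ge0 //.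
  by rewrite (ler_nat _ _ 3); lia.
rewrite (@big_cat_nat _ _ _ 4) //=; last exact: ltnW.
rewrite (le_trans (normcD _ _)) // addrC lerD //; last first.
  rewrite (le_trans (normc_sum _ _ _)) // (le_trans (_ : _ <= \sum_(1 <= n < 4) 1)) //.
    by apply: ler_sum_nat => n /andP[n0 _]; exact: small.
  by rewrite sumr_const_nat.
have := @abel_decr R f (fun n => ln n%:R / n%:R) 4 Z (2 * q%:R) (ltnW Z4).
move=> h; rewrite (le_trans (h _ _ _)) //.
- by move=> n /andP[n4 _]; apply: (@abel_window _ f 1) => //; rewrite n4.
- by move=> n _; rewrite divr_ge0 ?ln_nat_ge0.
- by move=> n; exact: lnn_decr.
rewrite ler_piMr ?mulr_ge0 // ler_pdivrMr ?ltr0n // mul1r ltW // ln_sublinear //.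
Qed.

(** By convolution, the sum of [f n * ln n / n] is that of [f d * vonM d / d * T (Z %/ d)].
    Replacing [T (Z %/ d)] by its limit [l] costs at most [2 q d / Z] per factor, hence
    [2 q / Z * chebpsi Z <= 8 q] in all. The left side is bounded by [2 q + 3], and division by [l]
    is where [l != 0] enters. *)
Lemma sum_chi_vonM_bounded l : tends T l -> l != 0 ->
  exists2 C : R, 0 <= C &
    forall Z, normc (\sum_(1 <= n < Z) f n * (vonM n / n%:R)%:C) <= C.
Proof.
move=> hl l0; rewrite -normc_gt0 in l0.
exists ((10 * q%:R + 3) / normc l).
  by rewrite divr_ge0 ?normc_ge0 // addr_ge0 ?mulr_ge0.
case=> [|Z].
  by rewrite big_geq // normc0E divr_ge0 ?normc_ge0 // addr_ge0 ?mulr_ge0.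
rewrite ler_pdivlMr // -normcM mulr_suml.
have gM m n : (0 < m)%N -> (0 < n)%N -> f (m * n)%N * ((m * n)%:R^-1)%:C =
    f m * (m%:R^-1)%:C * (f n * (n%:R^-1)%:C).
  by move=> _ _; rewrite fM natrM invfM rmorphM /=; ring.
have /= e := @sum_ln_convol R _ (real_complex R) (fun n => f n * (n%:R^-1)%:C) Z gM.
have -> : \sum_(1 <= n < Z.+1) f n * (vonM n / n%:R)%:C * l =
    \sum_(1 <= n < Z.+1) f n * (ln n%:R / n%:R)%:C -
    \sum_(1 <= d < Z.+1) f d * (d%:R^-1)%:C * (vonM d)%:C * (T (Z %/ d) - l).
  rewrite [X in _ = X - _](eq_bigr (fun n => f n * (n%:R^-1)%:C * (ln n%:R)%:C)); last first.
    by move=> n _; rewrite rmorphM /=; ring.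
  rewrite e -sumrB; apply: eq_bigr => d _; rewrite rmorphM /= /T; ring.
rewrite (le_trans (normcB _ _)) //.
have h1 := sum_chi_ln_bounded Z.+1.
suff : normc (\sum_(1 <= d < Z.+1) f d * (d%:R^-1)%:C * (vonM d)%:C * (T (Z %/ d) - l))
    <= 8 * q%:R by move: h1; lra.
have [->|Z0] := posnP Z; first by rewrite big_geq // normc0E mulr_ge0.
have Z0' : 0 < Z%:R :> R by rewrite ltr0n.
apply: (@le_trans _ _ (2 * q%:R / Z%:R * chebpsi Z)); last first.
  rewrite (_ : 8 * q%:R = 2 * q%:R / Z%:R * (4 * Z%:R)); last by field; rewrite gt_eqF.
  by rewrite ler_wpM2l ?chebyshev // divr_ge0 ?mulr_ge0.
rewrite (le_trans (normc_sum _ _ _)) // /chebpsi mulr_sumr.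
apply: ler_sum_nat => d /andP[d0 _].
rewrite !normcM !normc_real !ger0_norm ?vonM_ge0 ?invr_ge0 //.
have d0' : 0 < d%:R :> R by rewrite ltr0n.
have h2 := L1_tail (Z %/ d) hl.
have h3 : 2 * q%:R / (Z %/ d).+1%:R <= 2 * q%:R / Z%:R * d%:R :> R.
  rewrite (_ : _ / Z%:R * _ = 2 * q%:R * (d%:R / Z%:R)); last by ring.
  rewrite ler_wpM2l ?mulr_ge0 // -[X in X <= _]div1r ler_pdivrMr ?ltr0n // mulrAC ler_pdivlMr // mul1r.
  by rewrite -natrM ler_nat ltnW // mulnC ltn_ceil.
have h4 : normc (f d) * d%:R^-1 <= d%:R^-1 by rewrite ler_piMl ?invr_ge0.
apply: (@le_trans _ _ (d%:R^-1 * vonM d * (2 * q%:R / Z%:R * d%:R))).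
  rewrite ler_pM ?normc_ge0 ?mulr_ge0 ?invr_ge0 ?normc_ge0 ?vonM_ge0 //.
    by rewrite ler_wpM2r ?vonM_ge0.
  exact: le_trans h2 h3.
by rewrite le_eqVlt; apply/orP; left; apply/eqP; field; rewrite !gt_eqF.
Qed.

End BoundedCharacterSums.

(** * Inequalities for Euler factors *)

Section LocalBounds.
Context {R : realType}.

Lemma pw_small (d e : R) : 0 < d -> 0 < e ->
  exists N, forall n, (N <= n)%N -> pw n d < e.
Proof.
move=> d0 e0; pose A := expR (- ln e / d); have A0 : 0 <= A := expR_ge0 _.
exists (Num.bound A).+1 => n hn.
have hA : A < n%:R.
  by rewrite (lt_le_trans (archi_boundP A0)) // ler_nat; exact: ltnW.
have : ln A < ln n%:R by rewrite ltr_ln ?posrE ?expR_gt0 // (lt_trans _ hA) ?expR_gt0.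
rewrite /A expRK ltr_pdivrMr // => h.
by rewrite -[X in _ < X](lnK (_ : e \in Num.pos)) ?posrE // /pw ltr_expR; lra.
Qed.

(** From [|1 - z| ^ 2 = 1 - 2 Re z + |z| ^ 2] and [1 + x <= expR x]: Euler factors are bounded with
    no complex logarithm. *)
Lemma normc_1B_le_exp (z : R[i]) :
  normc (1 - z) <= expR (- ReC z + normc z ^+ 2 / 2).
Proof.
rewrite -ler_sqr ?nnegrE ?normc_ge0 ?expR_ge0 // -expRM_natl.
apply: le_trans (expR_ge1Dx _).
by rewrite !normc_sqr !ReD !ImD !ReN !ImN /=; lra.
Qed.

(** Since product times [L] tends to 1, an upper bound for finite products bounds [|L|] from below.
    The constant [1 / 2] does not depend on [d]; only the threshold [P0] does. *)
Lemma euler_product_half (f : nat -> R[i]) (d : R) (L : R[i]) :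
  f 1%N = 1 ->
  (forall m n, (0 < m)%N -> (0 < n)%N -> f (m * n)%N = f m * f n) ->
  0 < d -> (forall n, (0 < n)%N -> normc (f n) <= pw n (1 + d)) ->
  tends (fun Z => \sum_(1 <= n < Z.+1) f n) L ->
  exists P0, forall P, (P0 <= P)%N ->
    1 / 2 <= \prod_(0 <= p < P | prime p) normc (1 - f p) * normc L.
Proof.
move=> f1 fM d0 fd hL; have e0 : 0 < d / 2 by rewrite divr_gt0.
have [N HN] := pw_small d0 e0; exists (N.+2) => P NP.
have P1 : (1 < P)%N by lia.
have := euler_product_tail f1 fM d0 fd P1 hL.
have := HN P.-1 ltac:(lia); rewrite -normc_prod -normcM.
set z := _ * L => h1 h2.
have : normc (z - 1) <= 1 / 2.
  by rewrite (le_trans h2) // ler_pdivrMr // ltW //; move: h1; lra.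
have := normc_triB 1 z; rewrite normc1E normcBC; lra.
Qed.

Lemma sum_primes_sq_le P : \sum_(0 <= p < P | prime p) (p%:R ^- 2) <= 2 :> R.
Proof.
case: P => [|P]; first by rewrite big_geq.
rewrite big_mkcond big_ltn //= add0r.
apply: (@le_trans _ _ (\sum_(1 <= n < P.+1) pw n (1 + 1))); last first.
  by rewrite (le_trans (sum_pw_le _ _)) // invr1; lra.
apply: ler_sum_nat => n /andP[n0 _]; rewrite pwD pw_inv // -invfM -expr2.
by case: ifP => // _; rewrite invr_ge0 exprn_ge0.
Qed.

End LocalBounds.

(** * L(1, chi) for characters with nontrivial square *)

Section NonVanishingComplex.
Context {R : realType}.
Variables (q : nat) (chi : int -> R[i]).
Hypothesis q1 : (1 < q)%N.
Hypothesis chiP : dirichlet_character q chi.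

Local Notation f n := (chi (Posz n)).

Lemma dirichlet_character_sqr : dirichlet_character q (fun n => chi n ^+ 2).
Proof.
have [cM cD cN] := chiP; split => [m n|n|n]; first by rewrite cM exprMn.
  by rewrite cD.
by rewrite expf_eq0 /= cN.
Qed.

Let fw k s n : R[i] := f n ^+ k * (pw n s)%:C.

Let fw1 k s : fw k s 1 = 1.
Proof. by rewrite /fw (chi_nat1 chiP) expr1n pw_1 mulr1. Qed.

Let fwM k s m n : (0 < m)%N -> (0 < n)%N -> fw k s (m * n) = fw k s m * fw k s n.
Proof.
by move=> m0 n0; rewrite /fw (chi_natM chiP) pwM // rmorphM exprMn mulrACA.
Qed.

Let fw_le k s n : (0 < n)%N -> normc (fw k s n) <= pw n s.
Proof.
move=> n0; rewrite /fw normcM normcXE normc_real ger0_norm ?pw_ge0 //.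
by rewrite ler_piMl ?pw_ge0 // exprn_ile1 ?normc_ge0 // (chi_nat_norm_le1 q1 chiP).
Qed.

(* [3 + 4 cos t + cos (2 t) = 2 (1 + cos t) ^ 2 >= 0] *)
Let local_341 s p : 1 <= s -> prime p ->
  normc (1 - (pw p s)%:C) ^+ 3 * normc (1 - fw 1 s p) ^+ 4 * normc (1 - fw 2 s p)
    <= expR (4 * p%:R ^- 2).
Proof.
move=> s1 pp; have p0 := prime_gt0 pp.
set r := pw p s.
have r0 : 0 <= r := pw_ge0 _ _.
have rp : r ^+ 2 <= p%:R ^- 2.
  rewrite -exprVn lerXn2r ?nnegrE ?invr_ge0 // -pw_inv //; exact: pw_le.
have h0 := normc_1B_le_exp (r%:C); have h1 := normc_1B_le_exp (fw 1 s p).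
have h2 := normc_1B_le_exp (fw 2 s p).
apply: (@le_trans _ _ (expR (- r + r ^+ 2 / 2) ^+ 3 *
   expR (- ReC (fw 1 s p) + r ^+ 2 / 2) ^+ 4 * expR (- ReC (fw 2 s p) + r ^+ 2 / 2))).
  have mono k : normc (1 - fw k s p) <= expR (- ReC (fw k s p) + r ^+ 2 / 2).
    rewrite (le_trans (normc_1B_le_exp _)) // ler_expR lerD2l ler_pM2r //.
    by rewrite lerXn2r ?nnegrE ?normc_ge0 // fw_le.
  rewrite ler_pM ?mulr_ge0 ?exprn_ge0 ?normc_ge0 //.
  rewrite ler_pM ?exprn_ge0 ?normc_ge0 //.
    rewrite lerXn2r ?nnegrE ?normc_ge0 ?expR_ge0 // (le_trans h0) //.
    by rewrite normc_real ger0_norm.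
  by rewrite lerXn2r ?nnegrE ?normc_ge0 ?expR_ge0.
have e3 (x : R) : expR x ^+ 3 = expR (3 * x) by rewrite -expRM_natl.
have e4 (x : R) : expR x ^+ 4 = expR (4 * x) by rewrite -expRM_natl.
rewrite e3 e4 -!expRD ler_expR.
suff : 0 <= 3 * r + 4 * ReC (fw 1 s p) + ReC (fw 2 s p) by lra.
rewrite /fw expr1 -/r !ReM /= !mulr0 !subr0.
case: (boolP (coprime p q)) => [|/(chi_nat_eq0 chiP) e]; last first.
  by rewrite e /=; lra.
move/(chi_nat_norm1 q1 chiP) => e.
have : ReC (f p) ^+ 2 + ImC (f p) ^+ 2 = 1 by rewrite -normc_sqr e expr1n.
set a := ReC _; set b := ImC _ => ab.
rewrite (_ : _ + _ = 2 * r * (1 + a) ^+ 2); last first.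
  have -> : b * b = 1 - a ^+ 2 by rewrite -ab; ring.
  by ring.
by rewrite mulr_ge0 ?sqr_ge0 // mulr_ge0.
Qed.

(** The 3-4-1 inequality on the real axis, at [1 + d]. If L(1, chi) vanished, the product of
    [|zeta| ^ 3], [|L(chi)| ^ 4] and [|L(chi ^ 2)|] would be at most a constant times
    [d ^ (- 3) * d ^ 4 * 1 = d], while the finite Euler products keep it above a positive
    constant. *)
Lemma L1_neq0_complex b l : coprime b q -> f b ^+ 2 != 1 ->
  tends (fun Z => \sum_(1 <= n < Z.+1) f n * (n%:R^-1)%:C) l -> l != 0.
Proof.
move=> bq fb2 hl; have fb : f b != 1 by apply: contra fb2 => /eqP ->; rewrite expr1n.
apply/eqP => l0; rewrite {}l0 in hl.
have fle1 := chi_nat_norm_le1 q1 chiP.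
have fsum Z := chi_partial_sum q1 chiP Z bq fb.
have f2sum Z := chi_partial_sum q1 dirichlet_character_sqr Z bq fb2.
have q0 : 0 < q%:R :> R by rewrite ltr0n ltnW.
(* The exponent [8 = 3 + 4 + 1] counts the halves of [euler_product_half]. [expR 8] bounds the
   product of the local factors, since the sum of [p ^ (- 2)] is at most 2; the rest comes from
   [b0], [b1] and [b2]. *)
have key (d : R) : 0 < d <= 1 ->
    (1 / 2) ^+ 8 <= expR 8 * (8 * (2 * q%:R) ^+ 4 * q%:R * d).
  move=> /andP[d0 d1].
  have s1 : 1 <= 1 + d by lra.
  have fle k n (n0 : (0 < n)%N) := @fw_le k (1 + d) n n0.
  have zM m n : (0 < m)%N -> (0 < n)%N ->
      (pw (m * n) (1 + d))%:C = (pw m (1 + d))%:C * (pw n (1 + d))%:C.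
    by move=> m0 n0; rewrite pwM // rmorphM.
  have zle n : (0 < n)%N -> normc ((pw n (1 + d))%:C) <= pw n (1 + d).
    by move=> _; rewrite normc_real ger0_norm // pw_ge0.
  have z1 : (pw 1 (1 + d))%:C = 1 :> R[i] by rewrite pw_1.
  have [Z0 hZ0] := abs_series_cvg d0 zle.
  have [Z1 hZ1] := abs_series_cvg d0 (fle 1%N).
  have [Z2 hZ2] := abs_series_cvg d0 (fle 2%N).
  have [P0 HP0] := euler_product_half z1 zM d0 zle hZ0.
  have [P1 HP1] := euler_product_half (fw1 1 _) (@fwM 1 _) d0 (fle 1%N) hZ1.
  have [P2 HP2] := euler_product_half (fw1 2 _) (@fwM 2 _) d0 (fle 2%N) hZ2.
  pose P := maxn P0 (maxn P1 P2).
  have {HP0} := HP0 P (leq_maxl _ _).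
  have {HP1} := HP1 P ltac:(by rewrite /P !leq_max leqnn orbT).
  have {HP2} := HP2 P ltac:(by rewrite /P !leq_max leqnn !orbT).
  set A2 := \prod_(_ <= _ < _ | _) _; set A1 := \prod_(_ <= _ < _ | _) _.
  set A0 := \prod_(_ <= _ < _ | _) _ => h2 h1 h0.
  have A0p : 0 <= A0 by rewrite prodr_ge0 // => p _; exact: normc_ge0.
  have A1p : 0 <= A1 by rewrite prodr_ge0 // => p _; exact: normc_ge0.
  have A2p : 0 <= A2 by rewrite prodr_ge0 // => p _; exact: normc_ge0.
  have hA : A0 ^+ 3 * A1 ^+ 4 * A2 <= expR 8.
    rewrite /A0 /A1 /A2 -!prodrXl -!big_split /=.
    apply: (@le_trans _ _ (\prod_(0 <= p < P | prime p) expR (4 * p%:R ^- 2))).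
      apply: ler_prod => p pp; rewrite local_341 // andbT.
      by rewrite !mulr_ge0 ?exprn_ge0 ?normc_ge0.
    rewrite -expR_sum ler_expR -mulr_sumr.
    by have := @sum_primes_sq_le R P; lra.
  have b0 : normc Z0 <= 2 / d.
    apply: (tends_le hZ0); exists 0%N => n _.
    rewrite -real_sum normc_real ger0_norm ?sumr_ge0 // => [|i _]; last exact: pw_ge0.
    rewrite (le_trans (sum_pw_le _ d0)) //.
    have : 1 <= d^-1 by rewrite invf_ge1.
    by lra.
  have b2 : normc Z2 <= q%:R.
    apply: (tends_le hZ2); exists 0%N => n _.
    have := @abel_decr R (fun n => f n ^+ 2) (fun n => pw n (1 + d)) 1 n.+1 q%:R isT.
    rewrite pw_1 mulr1; apply => [m _|m _|m m0]; [exact: f2sum|exact: pw_ge0|].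
    by apply: pw_decr => //; lra.
  (* Here the vanishing at 1 is used: the partial sums at 1 are at most [2 q / (k + 1)], the weight
     [k ^ (- d)] varies by at most [d / k], and the sum of [1 / (k (k + 1))] is at most 1. *)
  have b1 : normc Z1 <= 2 * q%:R * d.
    apply/ler_addgt0Pr => e e0; apply: (tends_le hZ1).
    exists (Num.bound (2 * q%:R / e)) => n hn.
    rewrite (eq_big_nat _ _ (F2 := fun n => f n * (n%:R^-1)%:C * (pw n d)%:C)); last first.
      by move=> m /andP[m0 _]; rewrite /fw expr1 pw_1D // rmorphM mulrA.
    rewrite abel_identity // addrC (le_trans (normcD _ _)) // lerD //; last first.
      have hT := L1_tail fsum n hl; rewrite subr0 in hT.
      rewrite normcM normc_real ger0_norm ?pw_ge0 //.
      rewrite (le_trans (ler_piMr _ _)) ?normc_ge0 ?pw_le1 ?(ltW d0) ?ltW //.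
      rewrite (le_lt_trans hT) // ltr_pdivrMr ?ltr0n // [e * _]mulrC -ltr_pdivrMr //.
      have h : 0 <= 2 * q%:R / e by rewrite divr_ge0 ?mulr_ge0 // ltW.
      apply: lt_le_trans (archi_boundP h) _; rewrite ler_nat; exact: leqW.
    rewrite (le_trans (normc_sum _ _ _)) //.
    apply: (@le_trans _ _ (\sum_(1 <= k < n.+1)
        2 * q%:R * d * (- (k.+1%:R^-1) - - (k%:R^-1)))).
      apply: ler_sum_nat => k /andP[k0 _]; rewrite normcM normc_real.
      have k0' : 0 < k%:R :> R by rewrite ltr0n.
      have hT := L1_tail fsum k hl; rewrite subr0 in hT.
      rewrite ger0_norm ?subr_ge0 ?pw_decr ?(ltW d0) //.
      have hp : pw k d - pw k.+1 d <= d * k%:R^-1.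
        have := pw_step_le d0 k0; rewrite ler_pdivrMr // => h.
        have h' : pw k (1 + d) <= k%:R^-1 by rewrite -(pw_inv k0); apply: pw_le; lra.
        by rewrite (le_trans h) // mulrC ler_wpM2l // ltW.
      apply: (@le_trans _ _ (2 * q%:R / k.+1%:R * (d * k%:R^-1))).
        by rewrite ler_pM ?normc_ge0 ?subr_ge0 ?pw_decr ?(ltW d0).
      rewrite le_eqVlt; apply/orP; left; apply/eqP.
      by rewrite -natr1; field; rewrite !gt_eqF // ltr_wpDl.
    rewrite -mulr_sumr (telescope_sumr (fun k => - (k%:R^-1))) // invr1 opprK.
    by rewrite ler_piMr ?mulr_ge0 ?(ltW d0) // addrC gerBl invr_ge0.
  have hh : (1 / 2) ^+ 8 <= (A0 * normc Z0) ^+ 3 * (A1 * normc Z1) ^+ 4 * (A2 * normc Z2).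
    rewrite (_ : (1 / 2) ^+ 8 = (1 / 2) ^+ 3 * (1 / 2) ^+ 4 * (1 / 2)); last by ring.
    have hX (u v : R) k : 0 <= u -> u <= v -> u ^+ k <= v ^+ k.
      by move=> u0 uv; rewrite lerXn2r ?nnegrE // (le_trans u0).
    have half0 : 0 <= 1 / 2 :> R by [].
    by apply: ler_pM => //; rewrite ?mulr_ge0 ?exprn_ge0 //; apply: ler_pM; rewrite ?exprn_ge0 ?hX.
  rewrite (le_trans hh) //.
  rewrite (_ : _ * _ * _ = (A0 ^+ 3 * A1 ^+ 4 * A2) *
      (normc Z0 ^+ 3 * normc Z1 ^+ 4 * normc Z2)); last by ring.
  rewrite ler_pM ?mulr_ge0 ?exprn_ge0 ?normc_ge0 //.
  apply: (@le_trans _ _ ((2 / d) ^+ 3 * (2 * q%:R * d) ^+ 4 * q%:R)).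
    have hX (u v : R) k : 0 <= u -> u <= v -> u ^+ k <= v ^+ k.
      by move=> u0 uv; rewrite lerXn2r ?nnegrE // (le_trans u0).
    apply: ler_pM => //; rewrite ?mulr_ge0 ?exprn_ge0 ?normc_ge0 //.
    by apply: ler_pM; rewrite ?exprn_ge0 ?normc_ge0 ?hX ?normc_ge0.
  rewrite le_eqVlt; apply/orP; left; apply/eqP; field; by rewrite gt_eqF.
pose C : R := expR 8 * (8 * (2 * q%:R) ^+ 4 * q%:R).
have C0 : 0 < C by rewrite !mulr_gt0 ?expR_gt0 ?exprn_gt0 ?mulr_gt0.
set e : R := (1 / 2) ^+ 8; have e0 : 0 < e by rewrite exprn_gt0 // divr_gt0.
have h1 : 0 < Num.min 1 (e / (2 * C)) <= 1.
  by rewrite lt_min ltr01 divr_gt0 ?mulr_gt0 //= ge_min lexx.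
have := key _ h1; rewrite -/e mulrA -/C.
have h2 : C * Num.min 1 (e / (2 * C)) <= C * (e / (2 * C)).
  by rewrite ler_pM2l // ge_min lexx orbT.
have h3 : C * (e / (2 * C)) = e / 2 by field; rewrite gt_eqF.
rewrite h3 in h2.
move: h2 e0; lra.
Qed.

End NonVanishingComplex.

Lemma expr_antitone {R : realType} (x : R) m n : 0 < x < 1 -> (m <= n)%N ->
  x ^+ n <= x ^+ m.
Proof. by move=> /andP[x0 x1] mn; apply: ler_wiXn2l => //; exact: ltW. Qed.

(** * L(1, chi) for real characters *)

Section NonVanishingReal.
Context {R : realType}.
Variables (q : nat) (h : nat -> R).
Hypothesis h1 : h 1%N = 1.
Hypothesis hM : forall m n, h (m * n)%N = h m * h n.
Hypothesis h01 : forall n, h n = 0 \/ h n ^+ 2 = 1.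
Hypothesis hsum : forall Z, `|\sum_(1 <= n < Z) h n| <= q%:R.

Lemma sum_divisors_widen (V : nmodType) (F : nat -> V) n N : (0 < n < N)%N ->
  \sum_(1 <= d < N | (d %| n)%N) F d = \sum_(1 <= d < n.+1 | (d %| n)%N) F d.
Proof.
move=> /andP[n0 nN]; rewrite (@big_cat_nat _ _ _ n.+1) //=.
rewrite [X in _ + X]sum0_nat ?addr0 // => d /andP[nd _].
by move=> /dvdn_leq -/(_ n0); rewrite leqNgt nd.
Qed.

(** The coefficients of [zeta(s) L(s, h)]. They are nonnegative and at least 1 at squares, so
    [sum r n x ^ n] grows without bound as [x] tends to 1, whereas a zero of L at 1 would keep it at
    most [q]. *)
Let r n := \sum_(1 <= d < n.+1 | (d %| n)%N) h d.

(** The divisors prime to [p] are those of [m]; the others are [p * d] with [d] a divisor of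
    [p ^ e * m]. *)
Let r_step p e m : prime p -> ~~ (p %| m)%N -> (0 < m)%N ->
  r (p ^ e.+1 * m) = r m + h p * r (p ^ e * m).
Proof.
move=> pp pm m0; have p0 := prime_gt0 pp.
have pe0 k : (0 < p ^ k * m)%N by rewrite muln_gt0 expn_gt0 p0 m0.
rewrite {1}/r (bigID (fun d => (p %| d)%N)) /= addrC; congr (_ + _).
  rewrite /r -(@sum_divisors_widen _ h m (p ^ e.+1 * m).+1); last first.
    by rewrite m0 ltnS leq_pmull // expn_gt0 p0.
  apply: eq_bigl => d; apply/andP/idP => [[dn pd]|dm].
    rewrite Gauss_dvdr in dn => //.
    by rewrite coprimeXr // coprime_sym prime_coprime.
  by rewrite dvdn_mull //; split => //; apply: contra pm => /dvdn_trans; apply.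
rewrite -big_andbC.
transitivity (\sum_(1 <= d < (p ^ e.+1 * m).+1 | (p %| d)%N)
   (if (d %| p ^ e.+1 * m)%N then h d else 0)).
  by rewrite -big_mkcondr; apply: eq_bigl => d; rewrite andbC.
rewrite sum_multiples // expnS -mulnA mulKn // /r mulr_sumr [RHS]big_mkcond.
by apply: eq_bigr => d _; rewrite dvdn_pmul2l // hM; case: ifP => _; rewrite ?mulr0.
Qed.

Let r_prod p e m : prime p -> ~~ (p %| m)%N -> (0 < m)%N ->
  r (p ^ e * m) = r m * \sum_(0 <= i < e.+1) h p ^+ i.
Proof.
move=> pp pm m0; elim: e => [|e IH]; first by rewrite expn0 mul1n big_nat1 expr0 mulr1.
rewrite r_step // IH [in RHS]big_nat_recl // expr0 mulrDr mulr1; congr (_ + _).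
rewrite mulrCA mulr_sumr; congr (_ * _); apply: eq_bigr => i _; by rewrite exprS.
Qed.

(** The ratio is 0, 1 or -1; for -1 the sum is 1 when [e] is even and 0 when [e] is odd. *)
Let geom_ge (x : R) e : x = 0 \/ x ^+ 2 = 1 ->
  0 <= \sum_(0 <= i < e.+1) x ^+ i /\ (~~ odd e -> 1 <= \sum_(0 <= i < e.+1) x ^+ i).
Proof.
case=> [->|/eqP]; last (rewrite sqrf_eq1 => /orP[] /eqP ->).
- rewrite big_nat_recl // expr0 big1 ?addr0 // => i _; by rewrite exprS mul0r.
- under eq_bigr do rewrite expr1n.
  by rewrite sumr_const_nat subn0 ler0n ler1n.
- have e1 n : \sum_(0 <= i < n) (-1) ^+ i = (odd n)%:R :> R.
    elim: n => [|n IH]; first by rewrite big_geq.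
    by rewrite big_nat_recr //= IH -signr_odd; case: (odd n); rewrite ?expr0 ?expr1 ?subrr ?add0r.
  by rewrite e1 /=; case: (odd e).
Qed.

Let r_ge0 n : 0 <= r n.
Proof.
elim/ltn_ind: n => -[|[|n]] IH; first by rewrite /r big_geq.
  by rewrite /r big_mkcond big_nat1 /= h1 ler01.
set N := n.+2 in IH *; have N0 : (0 < N)%N by [].
have pp : prime (pdiv N) := pdiv_prime (isT : (1 < N)%N).
have [m pm e] := pfactor_coprime pp N0.
have m0 : (0 < m)%N by move: N0; rewrite e muln_gt0 => /andP[].
rewrite e mulnC r_prod //; last by rewrite -prime_coprime.
rewrite mulr_ge0 //; last by have [] := geom_ge (logn (pdiv N) N) (h01 (pdiv N)).
apply: IH; rewrite [X in (_ < X)%N]e ltn_Pmulr // -{1}(expn0 (pdiv N)).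
by rewrite ltn_exp2l ?prime_gt1 // logn_gt0 pi_pdiv.
Qed.

Let r_sqr_ge1 k : (0 < k)%N -> 1 <= r (k ^ 2).
Proof.
elim/ltn_ind: k => -[|[|n]] IH // _; first by rewrite /r big_mkcond big_nat1 /= h1.
set N := n.+2 in IH *; have N0 : (0 < N)%N by [].
have pp : prime (pdiv N) := pdiv_prime (isT : (1 < N)%N).
have [m pm e] := pfactor_coprime pp N0.
have m0 : (0 < m)%N by move: N0; rewrite e muln_gt0 => /andP[].
have -> : (N ^ 2 = pdiv N ^ (logn (pdiv N) N * 2) * m ^ 2)%N.
  by rewrite [in LHS]e expnMn mulnC expnM.
rewrite r_prod //; last 2 first.
- by rewrite -prime_coprime // coprimeXr.
- by rewrite expn_gt0 m0.
have [_ /(_ _)] := geom_ge (logn (pdiv N) N * 2) (h01 (pdiv N)).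
rewrite oddM andbF => /(_ isT) g1.
rewrite -[1]mulr1 ler_pM //; apply: IH => //.
rewrite [X in (_ < X)%N]e ltn_Pmulr // -{1}(expn0 (pdiv N)).
by rewrite ltn_exp2l ?prime_gt1 // logn_gt0 pi_pdiv.
Qed.

Variable y : R.
Hypothesis y01 : 0 < y < 1.
(** Written as a square so that the geometric mean of [1, x, ..., x ^ d] is [y ^ d]. *)
Let x := y ^+ 2.
Let s d := \sum_(0 <= i < d) x ^+ i.

Let y0 : 0 < y. Proof. by case/andP: y01. Qed.
Let y1 : y < 1. Proof. by case/andP: y01. Qed.
Let x0 : 0 < x. Proof. by rewrite exprn_gt0. Qed.
Let x1 : x < 1. Proof. by rewrite exprn_ilt1 // ltW. Qed.

Let x01 : 0 < x < 1. Proof. by rewrite x0 x1. Qed.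

Let sS d : s d.+1 = 1 + x * s d.
Proof.
rewrite /s big_nat_recl // expr0 mulr_sumr; congr (_ + _).
by apply: eq_bigr => i _; rewrite exprS.
Qed.

Let sSr d : s d.+1 = s d + x ^+ d.
Proof. by rewrite /s big_nat_recr. Qed.

Let s_geom d : s d * (1 - x) = 1 - x ^+ d.
Proof.
elim: d => [|d IH]; first by rewrite /s big_geq // mul0r expr0 subrr.
by rewrite sSr mulrDl IH exprS; ring.
Qed.

(* AM-GM for the geometric sum, proved by pairing its two extreme terms. *)
Let s_ge d : d.+1%:R * y ^+ d <= s d.+1.
Proof.
elim/ltn_ind: d => -[|[|d]] IH.
- by rewrite sS /s big_geq // mulr0 addr0 expr0 mulr1.
- rewrite sS sS /s big_geq // mulr0 addr0 mulr1 expr1 /x.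
  have := sqr_ge0 (1 - y); rewrite sqrrB; lra.
have h2 := IH d ltac:(lia).
have h3 : d.+1%:R * y ^+ d * x <= s d.+1 * x by rewrite ler_wpM2r // ltW.
rewrite sSr sS.
have -> : x ^+ d.+2 = (y ^+ d.+2) ^+ 2 by rewrite /x -!exprM mulnC.
have := sqr_ge0 (1 - y ^+ d.+2); rewrite sqrrB.
have -> : y ^+ d.+2 = y ^+ d * x by rewrite /x -exprD addn2.
have -> : d.+3%:R = d.+1%:R + 2 :> R by rewrite -addn2 natrD.
move: h3; move: (d.+1%:R) => D; lra.
Qed.

Let s_gt0 d : 0 < s d.+1.
Proof. by rewrite (lt_le_trans _ (s_ge d)) // mulr_gt0 ?exprn_gt0 // ltr0n. Qed.

(** The gap between the weight [1 / d] of [h d] in [T] and its Lambert weight [(1 - x) x ^ d / (1 -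
    x ^ d) = x ^ d / s d]. It decreases from [b 1 = 1 - x], so the bounded sums of [h] make the
    total gap at most [q (1 - x)]. *)
Let b d := d%:R^-1 - x ^+ d / s d.

(** The decrements of [x ^ d / s d] are [x ^ d / (s d * s (d + 1))], those of [1 / d] are
    [1 / (d (d + 1))]. The claim is thus [d (d + 1) x ^ d <= s d * s (d + 1)], a product of two
    instances of [s_ge]. *)
Let b_decr d : (0 < d)%N -> b d.+1 <= b d.
Proof.
case: d => // d _; have D0 : 0 < d.+1%:R :> R by rewrite ltr0n.
have D1 : 0 < d.+2%:R :> R by rewrite ltr0n.
have S0 := s_gt0 d; have S1 := s_gt0 d.+1.
have e1 : x ^+ d.+1 / s d.+1 - x ^+ d.+2 / s d.+2 = x ^+ d.+1 / (s d.+1 * s d.+2).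
  have e2 := sS d.+1; rewrite [x ^+ d.+2]exprS.
  have -> : x ^+ d.+1 / s d.+1 - x * x ^+ d.+1 / s d.+2 =
    x ^+ d.+1 * (s d.+2 - x * s d.+1) / (s d.+1 * s d.+2) by field; rewrite !gt_eqF.
  by rewrite e2 addrK mulr1.
have e3 : d.+1%:R^-1 - d.+2%:R^-1 = (d.+1%:R * d.+2%:R)^-1 :> R.
  have -> : d.+2%:R = d.+1%:R + 1 :> R by rewrite natr1.
  by field; rewrite !gt_eqF // addr_gt0.
rewrite /b -subr_ge0.
rewrite (_ : _ - _ = (d.+1%:R^-1 - d.+2%:R^-1) -
   (x ^+ d.+1 / s d.+1 - x ^+ d.+2 / s d.+2)); last by ring.
rewrite e1 e3 subr_ge0 -[X in _ <= X]div1r ler_pdivlMr ?mulr_gt0 //.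
rewrite mulrAC ler_pdivrMr ?mulr_gt0 // mul1r.
apply: (@le_trans _ _ ((d.+1%:R * y ^+ d) * (d.+2%:R * y ^+ d.+1))); last first.
  by rewrite ler_pM ?s_ge // mulr_ge0 // exprn_ge0 // ltW.
rewrite (_ : x ^+ d.+1 = y ^+ d * y ^+ d.+1 * y); last first.
  by rewrite /x -exprM -!exprD -exprSr; congr (_ ^+ _); lia.
have -> : d.+1%:R * y ^+ d * (d.+2%:R * y ^+ d.+1) =
    y ^+ d * y ^+ d.+1 * (d.+1%:R * d.+2%:R) by ring.
have P0 : 0 <= y ^+ d * y ^+ d.+1 * (d.+1%:R * d.+2%:R).
  by rewrite ltW // !mulr_gt0 ?exprn_gt0.
by rewrite mulrAC ler_piMr // ltW.
Qed.

Let b_ge0 d : (0 < d)%N -> 0 <= b d.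
Proof.
case: d => // d _; rewrite /b subr_ge0 ler_pdivrMr ?s_gt0 // mulrC.
rewrite ler_pdivlMr ?ltr0n // mulrC.
apply: (@le_trans _ _ (\sum_(0 <= i < d.+1) x ^+ d.+1)).
  by rewrite sumr_const_nat subn0 mulr_natl.
by apply: ler_sum_nat => i /andP[_ id]; exact: expr_antitone x01 (ltnW id).
Qed.

Let T Z := \sum_(1 <= n < Z.+1) h n / n%:R.

(* Lambert series identity: the geometric series turns [sum r n x^n] into
   [sum h d x^d / (1 - x^d)], compared here with [sum h d / (d (1 - x))]. *)
Lemma lambert_bound Z : (0 < Z)%N ->
  (1 - x) * \sum_(1 <= n < Z.+1) r n * x ^+ n <=
  `|T Z| + q%:R * (1 - x) + Z%:R * x ^+ Z.
Proof.
move=> Z0.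
have e : \sum_(1 <= n < Z.+1) r n * x ^+ n =
    \sum_(1 <= d < Z.+1) h d * \sum_(1 <= m < (Z %/ d).+1) x ^+ (d * m).
  transitivity (\sum_(1 <= n < Z.+1) \sum_(1 <= d < n.+1 | (d %| n)%N) h d * x ^+ n).
    by apply: eq_bigr => n _; rewrite /r mulr_suml.
  rewrite (sum_divisor_pairs Z (fun d n => h d * x ^+ n)).
  by apply: eq_bigr => d _; rewrite mulr_sumr.
have inner d M : (0 < d)%N -> (1 - x) * \sum_(1 <= m < M.+1) x ^+ (d * m) =
    x ^+ d / s d - x ^+ (d * M.+1) / s d.
  case: d => // d _; have S0 := s_gt0 d.
  apply: (mulfI (lt0r_neq0 S0)); rewrite mulrBr !mulrA.
  rewrite ![s d.+1 * _ / _]mulrAC !divff ?gt_eqF // !mul1r s_geom.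
  elim: M => [|M IH]; first by rewrite big_geq // mulr0 muln1 subrr.
  rewrite big_nat_recr //= mulrDr IH ![(d.+1 * _.+1)%N]mulnS !exprD; ring.
rewrite e mulr_sumr.
have -> : \sum_(1 <= d < Z.+1) (1 - x) * (h d * \sum_(1 <= m < (Z %/ d).+1) x ^+ (d * m))
   = T Z - \sum_(1 <= d < Z.+1) h d * b d
     - \sum_(1 <= d < Z.+1) h d * (x ^+ (d * (Z %/ d).+1) / s d).
  rewrite /T -!sumrB; apply: eq_big_nat => d /andP[d0 _].
  by rewrite mulrCA inner // /b; ring.
have B1 : `|\sum_(1 <= d < Z.+1) h d * b d| <= q%:R * (1 - x).
  have := @abel_decr_real R h b 1 Z.+1 q%:R isT (fun n _ => hsum n) b_ge0 b_decr.
  have s1 : s 1 = 1 by rewrite sS /s big_geq // mulr0 addr0.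
  by rewrite /b s1 invr1 expr1 mulr1.
(* The inner geometric sums stop at [m = Z %/ d]; each truncation leaves a power of [x] whose
   exponent exceeds [Z]. *)
have B2 : `|\sum_(1 <= d < Z.+1) h d * (x ^+ (d * (Z %/ d).+1) / s d)| <= Z%:R * x ^+ Z.
  rewrite (le_trans (ler_norm_sum _ _ _)) //.
  rewrite (le_trans (_ : _ <= \sum_(1 <= d < Z.+1) x ^+ Z)) //; last first.
    by rewrite sumr_const_nat subSS subn0 mulr_natl.
  apply: ler_sum_nat => -[|d] // _; have S0 := s_gt0 d.
  rewrite normrM.
  have -> : `|x ^+ (d.+1 * (Z %/ d.+1).+1) / s d.+1| = x ^+ (d.+1 * (Z %/ d.+1).+1) / s d.+1.
    by rewrite ger0_norm // divr_ge0 ?exprn_ge0 ?ltW.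
  have hn : `|h d.+1| <= 1.
    have [->|/eqP] := h01 d.+1; first by rewrite normr0.
    by rewrite sqrf_eq1 => /orP[] /eqP ->; rewrite ?normrN normr1.
  rewrite (le_trans (ler_piMl _ hn)) ?divr_ge0 ?exprn_ge0 ?(ltW x0) ?(ltW S0) ?(ltW y0) //.
  have S1 : 1 <= s d.+1.
    by rewrite sS lerDl mulr_ge0 ?(ltW x0) // /s sumr_ge0 // => i _; rewrite exprn_ge0 // ltW.
  rewrite ler_pdivrMr //; apply: (@le_trans _ _ (x ^+ Z)).
    by apply: expr_antitone x01 _; rewrite mulnC ltnW // ltn_ceil.
  by rewrite ler_peMr // exprn_ge0 // ltW.
have := ler_norm (T Z).
move: B1 B2; rewrite !ler_norml => /andP[? ?] /andP[? ?]; lra.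
Qed.

(** Only the squares [k ^ 2] with [k <= k0] are kept, each with coefficient at least 1. *)
Lemma lambert_lower k0 Z : (k0 ^ 2 <= Z)%N ->
  k0%:R * x ^+ (k0 ^ 2) <= \sum_(1 <= n < Z.+1) r n * x ^+ n.
Proof.
move=> kZ.
apply: (@le_trans _ _ (\sum_(1 <= n < Z.+1) \sum_(1 <= k < k0.+1)
    (if (k ^ 2)%N == n then x ^+ n else 0))).
  rewrite (@exchange_big_nat _ _ _ _ _ _ _ xpredT xpredT) /=.
  apply: (@le_trans _ _ (\sum_(1 <= k < k0.+1) x ^+ (k0 ^ 2))).
    by rewrite sumr_const_nat subSS subn0 mulr_natl.
  apply: ler_sum_nat => k /andP[k1 kk].
  rewrite (bigD1_seq (k ^ 2)%N) ?iota_uniq //=; last first.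
    rewrite mem_index_iota expn_gt0 k1 /= ltnS (leq_trans _ kZ) //.
    by rewrite leq_exp2r.
  rewrite eqxx; apply: (@le_trans _ _ (x ^+ (k ^ 2))).
    by apply: expr_antitone x01 _; rewrite leq_exp2r.
  rewrite lerDl sumr_ge0 // => i _; case: ifP => // _; by rewrite exprn_ge0 // ltW.
apply: ler_sum_nat => n /andP[n1 _].
have xn : 0 <= x ^+ n by rewrite exprn_ge0 // ltW.
case: (boolP (has (fun k => (k ^ 2)%N == n) (index_iota 1 k0.+1))) => [|/hasPn no]; last first.
  rewrite big_seq big1 ?mulr_ge0 ?r_ge0 // => k /no.
  by case: ifP.
move=> /hasP[k kin /eqP kn]; rewrite (bigD1_seq k) ?iota_uniq //= kn eqxx big1.
  rewrite addr0 ler_peMl // -kn r_sqr_ge1 //; move: kin; rewrite mem_index_iota.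
  by case/andP.
move=> j jk; case: eqP => // e; move: jk.
by rewrite -(eqn_sqr j k) e kn eqxx.
Qed.

End NonVanishingReal.

(** * L(1, chi) for nontrivial characters, and the bounded sum over prime powers *)

Section NonVanishing.
Context {R : realType}.

Lemma bernoulli_lower (y : R) n : 0 <= y <= 1 -> 1 - n%:R * (1 - y) <= y ^+ n.
Proof.
move=> /andP[y0 y1]; elim: n => [|n IH]; first by rewrite mul0r subr0 expr0.
rewrite exprS; have := ler_wpM2l y0 IH; rewrite -natr1.
have : 0 <= n%:R * (1 - y) * (1 - y) by rewrite !mulr_ge0 ?subr_ge0.
move: (n%:R) (y ^+ n) => u v; lra.
Qed.

Lemma nat_exp_le (y : R) N : 0 < y < 1 -> N%:R * y ^+ N <= (1 - y)^-1.
Proof.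
move=> y01; have /andP[y0 y1] := y01.
rewrite -[X in _ <= X]div1r ler_pdivlMr ?subr_gt0 //.
apply: (@le_trans _ _ ((\sum_(0 <= i < N) y ^+ i) * (1 - y))).
  rewrite ler_wpM2r ?subr_ge0 ?(ltW y1) //.
  apply: (@le_trans _ _ (\sum_(0 <= i < N) y ^+ N)).
    by rewrite sumr_const_nat subn0 mulr_natl.
  by apply: ler_sum_nat => i /andP[_ id]; exact: expr_antitone y01 (ltnW id).
have -> : (\sum_(0 <= i < N) y ^+ i) * (1 - y) = 1 - y ^+ N.
  elim: N => [|N IH]; first by rewrite big_geq // mul0r expr0 subrr.
  by rewrite big_nat_recr //= mulrDl IH exprS; ring.
by rewrite gerBl exprn_ge0 // ltW.
Qed.

Lemma L1_neq0_real (q : nat) (h : nat -> R) : h 1%N = 1 ->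
  (forall m n, h (m * n)%N = h m * h n) ->
  (forall n, h n = 0 \/ h n ^+ 2 = 1) ->
  (forall Z, `|\sum_(1 <= n < Z) h n| <= q%:R) ->
  (forall Z, `|\sum_(1 <= n < Z.+1) h n / n%:R| <= 2 * q%:R / Z.+1%:R) -> False.
Proof.
move=> h1 hM h01 hsum hT.
(* With [u = 1 / (2 k0 ^ 3)] one has [x ^ (k0 ^ 2) = (1 - u) ^ (2 k0 ^ 2) >= 1 - 1 / k0], so the
   squares alone contribute [k0 - 1 = q + 3], more than the [q] that [lambert_bound] allows for
   large [Z]. *)
pose k0 := (q.+4)%N; have k00 : 0 < k0%:R :> R by rewrite ltr0n.
pose u : R := (2 * k0%:R ^+ 3)^-1.
have u0 : 0 < u by rewrite invr_gt0 mulr_gt0 ?exprn_gt0.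
have k1 : 1 <= k0%:R :> R by rewrite ler1n.
have u1 : u <= 1 / 2.
  rewrite /u invfM div1r ler_piMr // invf_le1 ?exprn_gt0 //.
  by rewrite exprn_ege1.
pose y := 1 - u; have y01 : 0 < y < 1 by rewrite /y; apply/andP; split; lra.
have [y0 y1] := andP y01.
pose x := y ^+ 2.
have x1 : x < 1 by rewrite exprn_ilt1 // ltW.
have ux : u <= 1 - x.
  have : u ^+ 2 <= u by rewrite expr2 ler_piMl ?ltW //; move: u1; lra.
  rewrite /x /y; lra.
have yk : 1 - k0%:R^-1 <= x ^+ (k0 ^ 2).
  have := @bernoulli_lower y (2 * k0 ^ 2) ltac:(by rewrite !ltW).
  rewrite exprM; apply: le_trans; rewrite lerD2l lerN2.
  rewrite /y opprB addrC subrK /u natrM natrX le_eqVlt; apply/orP; left; apply/eqP.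
  by field; rewrite gt_eqF.
(* Any [Z] above [B] makes the two remaining terms of [lambert_bound] together smaller than
   [3 u <= 3 (1 - x)]. *)
pose B := (2 * q%:R + u ^- 2) / (3 * u).
have B0 : 0 <= B.
  by rewrite divr_ge0 ?addr_ge0 ?mulr_ge0 ?invr_ge0 ?exprn_ge0 ?(ltW u0).
pose Z := maxn (k0 ^ 2) (Num.bound B).
have kZ : (k0 ^ 2 <= Z)%N by rewrite leq_maxl.
have Z0 : (0 < Z)%N by rewrite (leq_trans _ kZ).
have Z0' : 0 < Z%:R :> R by rewrite ltr0n.
have BZ : B < Z%:R by rewrite (lt_le_trans (archi_boundP B0)) // ler_nat leq_maxr.
have l1 := @lambert_lower R h h1 hM h01 y y01 k0 Z kZ.
have l2 := @lambert_bound R q h h01 hsum y y01 Z Z0.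
rewrite -/x in l1 l2.
have l3 : q%:R + 3 <= k0%:R * x ^+ (k0 ^ 2).
  have := ler_wpM2l (ltW k00) yk; rewrite mulrBr mulr1 divff ?gt_eqF //.
  apply: le_trans; rewrite /k0 -addn4 natrD; lra.
have l4 : (1 - x) * (q%:R + 3) <=
    2 * q%:R / Z.+1%:R + q%:R * (1 - x) + Z%:R * x ^+ Z.
  apply: le_trans (le_trans _ l2) _.
    by rewrite ler_wpM2l ?(le_trans l3) // subr_ge0 ltW.
  by rewrite !lerD2r.
have l5 : Z%:R * x ^+ Z <= u ^- 2 / Z%:R.
  rewrite ler_pdivlMr // /x -exprM [(2 * Z)%N]mulnC exprM -exprVn.
  have -> : Z%:R * y ^+ Z ^+ 2 * Z%:R = (Z%:R * y ^+ Z) ^+ 2 by ring.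
  have := nat_exp_le Z y01; rewrite {2}/y opprB addrC subrK => hy.
  by rewrite lerXn2r ?nnegrE ?mulr_ge0 ?exprn_ge0 ?invr_ge0 ?(ltW y0) ?(ltW u0).
have l6 : 2 * q%:R / Z.+1%:R <= 2 * q%:R / Z%:R :> R.
  by rewrite ler_wpM2l ?mulr_ge0 // lef_pV2 ?posrE ?ltr0n // ler_nat.
have l7 : 3 * u <= (2 * q%:R + u ^- 2) / Z%:R.
  rewrite [X in _ <= X]mulrDl; move: l4 l5 l6 ux; move: (2 * q%:R / Z.+1%:R) (2 * q%:R / Z%:R) => v w.
  lra.
move: BZ; rewrite /B ltr_pdivrMr ?mulr_gt0 // ltNge => /negP; apply.
by rewrite mulrC -ler_pdivlMr.
Qed.

Variables (q : nat) (chi : int -> R[i]).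
Hypothesis q1 : (1 < q)%N.
Hypothesis chiP : dirichlet_character q chi.
Hypothesis nontrivial : exists2 b, coprime b q & chi (Posz b) != 1.

Lemma L1_neq0 l :
  tends (fun Z => \sum_(1 <= n < Z.+1) chi n%:Z * (n%:R^-1)%:C) l -> l != 0.
Proof.
have [b bq fb] := nontrivial; move=> hl.
have [[c cq fc]|real] := pselect (exists2 c, coprime c q & chi (Posz c) ^+ 2 != 1).
  exact: (@L1_neq0_complex R q chi q1 chiP c l cq fc hl).
have fE n : chi (Posz n) = (ReC (chi (Posz n)))%:C /\
    (ReC (chi (Posz n)) = 0 \/ ReC (chi (Posz n)) ^+ 2 = 1).
  case: (boolP (coprime n q)) => [nq|/(chi_nat_eq0 chiP) ->]; last by split; [|left].
  have : chi (Posz n) ^+ 2 == 1 by apply/negPn/negP => h; apply: real; exists n.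
  rewrite sqrf_eq1 => /orP[] /eqP ->; split=> //; try by right; rewrite /= ?sqrrN expr1n.
  by rewrite rmorphN.
pose h n := ReC (chi (Posz n)).
have fh n : chi (Posz n) = (h n)%:C by have [] := fE n.
apply/eqP => l0; rewrite {}l0 in hl.
have fsum Z := chi_partial_sum q1 chiP Z bq fb.
apply: (@L1_neq0_real q h).
- by rewrite /h (chi_nat1 chiP).
- move=> m n; rewrite {1}/h (chi_natM chiP) !fh -rmorphM //.
- by move=> n; have [] := fE n.
- move=> Z; rewrite -normc_real real_sum; have := fsum Z.
  by under eq_bigr do rewrite fh.
- move=> Z; have := L1_tail fsum Z hl; rewrite subr0.
  under eq_bigr do rewrite fh -rmorphM /=.
  by rewrite -real_sum normc_real.
Qed.

Lemma chi_vonM_bounded : exists2 C : R, 0 <= C &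
  forall Z, normc (\sum_(1 <= n < Z) chi n%:Z * (vonM n / n%:R)%:C) <= C.
Proof.
have [b bq fb] := nontrivial.
have fsum Z := chi_partial_sum q1 chiP Z bq fb.
have [l hl] := L1_cvg fsum.
apply: (@sum_chi_vonM_bounded R q (fun n => chi n%:Z) _ _ fsum l hl (L1_neq0 hl)).
- by move=> m n; exact: chi_natM chiP m n.
- by move=> n; exact: chi_nat_norm_le1 q1 chiP n.
Qed.

End NonVanishing.

(** A character equal to 1 on all units is induced from modulus 1, where the constant 1 is a
    Dirichlet character; primitivity excludes this for [q > 1]. *)
Lemma primitive_nontrivial {R : realType} (q : nat) (chi : int -> R[i]) :
  (1 < q)%N -> primitive_character q chi ->
  exists2 b, coprime b q & chi (Posz b) != 1.
Proof.
move=> q1 [chiP prim]; have [cM cD cN] := chiP.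
apply: contrapT => triv; apply: (prim 1%N (fun=> 1)) => //.
  by split=> [m n|n|n]; rewrite ?mulr1 // coprimezE /= coprimen1 oner_neq0.
move=> n nq.
have cDk k : chi (n + (k * q)%N%:Z) = chi n.
  elim: k => [|k IH]; first by rewrite mul0n addr0.
  by rewrite mulSn PoszD addrCA addrC cD IH.
(* Induction of characters is stated on all integers, triviality on naturals: adding a multiple of
   [q] yields a natural representative. *)
have [m mE] : exists m, n + (`|n| * q)%N%:Z = Posz m.
  case: n {nq cDk} => n /=; first by exists (n + n * q)%N.
  by exists (n.+1 * q - n.+1)%N; rewrite NegzE addrC subzn // leq_pmulr //; lia.
rewrite -(cDk `|n|%N) mE; apply/eqP/negPn/negP => cm; apply: triv; exists m => //.
by rewrite -(chi_nat_neq0 chiP) -mE cDk cN.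
Qed.

(** * Mertens' product *)

Section MertensProduct.
Context {R : realType}.

Lemma is_derive_log_poly (b : nat) (x : R) :
  is_derive x 1 (fun x => \sum_(1 <= n < b.+1) x ^+ n / n%:R)
    (\sum_(0 <= n < b) x ^+ n).
Proof.
elim: b => [|b IH].
  rewrite big_geq // (_ : (fun _ => _) = cst 0); first exact: is_derive_cst.
  by apply/funext => y; rewrite big_geq.
have h : is_derive x 1 (fun y : R => y ^+ b.+1) (b.+1%:R * x ^+ b).
  split; first exact: exprn_derivable.
  by rewrite exp_derive [LHS]mulr1.
rewrite (_ : (fun _ => _) = (fun x => \sum_(1 <= n < b.+1) x ^+ n / n%:R) +
   (b.+1%:R^-1 \*: (fun y : R => y ^+ b.+1))); last first.
  by apply/funext => y; rewrite big_nat_recr //= mulrC.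
rewrite big_nat_recr //=; apply: is_deriveD.
have := is_deriveZ (b.+1%:R^-1) h.
by rewrite (_ : _ *: _ = x ^+ b) // -[LHS]/(_ * _) mulKf // pnatr_eq0.
Qed.

(** The difference of the two sides vanishes at 0 and has derivative
    [1 / (1 - y) - sum_(n < b) y ^ n >= 0]. *)
Lemma log_poly_le (b : nat) (x : R) : 0 <= x < 1 ->
  \sum_(1 <= n < b) x ^+ n / n%:R <= - ln (1 - x).
Proof.
move=> /andP[x0 x1]; case: b => [|b].
  by rewrite big_geq // oppr_ge0 ln_le0 // gerBl.
pose F (y : R) := - ln (1 - y) - \sum_(1 <= n < b.+1) y ^+ n / n%:R.
pose dF (y : R) := (1 - y)^-1 - \sum_(0 <= n < b) y ^+ n.
have dFP (y : R) : y < 1 -> is_derive y 1 F (dF y).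
  move=> y1; have y1' : 0 < 1 - y by rewrite subr_gt0.
  have h1 : is_derive (1 - y) 1 (@ln R) (1 - y)^-1 by exact: is_derive1_ln.
  have h2 : is_derive y 1 (cst 1 - id : R -> R) (0 - 1).
    by apply: is_deriveB.
  have h3 := @is_derive1_comp R (@ln R) (cst 1 - id) y _ _ h1 h2.
  have := is_deriveB (is_deriveN h3) (is_derive_log_poly b y).
  by rewrite sub0r mulrN1 opprK.
have [y yx||c] := @MVT_segment R F dF 0 x x0.
- move: yx; rewrite in_itv /= => /andP[_ yx]; apply: dFP; exact: lt_trans yx x1.
- apply: derivable_within_continuous => y; rewrite in_itv /= => /andP[_ yx].
  by have [] := dFP y (le_lt_trans yx x1).
rewrite in_itv /= => /andP[c0 cx] e.
have F0 : F 0 = 0.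
  rewrite /F subr0 ln1 oppr0 sub0r sum0_nat ?oppr0 // => n /andP[n0 _] _.
  by rewrite expr0n gtn_eqF // mul0r.
have c1 : c < 1 := le_lt_trans cx x1.
have dF0 : 0 <= dF c.
  rewrite /dF subr_ge0 -[X in _ <= X]div1r ler_pdivlMr ?subr_gt0 //.
  have -> : (\sum_(0 <= i < b) c ^+ i) * (1 - c) = 1 - c ^+ b.
    elim: b {F dF dFP e F0} => [|b IH]; first by rewrite big_geq // mul0r expr0 subrr.
    by rewrite big_nat_recr //= mulrDl IH exprS; ring.
  by rewrite gerBl exprn_ge0.
have : 0 <= F x - F 0 by rewrite e subr0 mulr_ge0.
by rewrite F0 subr0 /F subr_ge0.
Qed.

(** The differences [H_n - ln n] decrease to Euler's constant. The sequence is shifted by one to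
    stay away from [ln 0]. *)
Lemma euler_constant_le (n : nat) : (0 < n)%N ->
  ln n%:R + euler_constant R <= \sum_(1 <= k < n.+1) k%:R^-1.
Proof.
move=> n0; pose u n : R := \sum_(1 <= k < n.+2) k%:R^-1 - ln n.+1%:R.
have u_dec : nonincreasing_seq u.
  apply/nonincreasing_seqP => m; rewrite /u big_nat_recr //=.
  have := @ln_le_harmonic_step R m.+1 isT; move: (m.+2%:R^-1) => t; lra.
have u_lb m : 0 <= u m.
  rewrite /u subr_ge0 (le_trans (ln_le_ln_next _)) //; exact: harmonic_ge.
have cu : cvgn u by apply: nonincreasing_is_cvgn => //; exists 0 => _ [m _ <-].
have -> : euler_constant R = limn u.
  by apply: cvg_lim => //; rewrite -cvg_shiftS.
have := nonincreasing_cvgn_ge u_dec cu n.-1.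
by rewrite /u prednK //; lra.
Qed.

Lemma sum_dyadic (V : nmodType) (F : nat -> V) a b : (a <= b)%N ->
  \sum_(2 ^ a <= k < 2 ^ b) F k = \sum_(a <= n < b) \sum_(2 ^ n <= k < 2 ^ n.+1) F k.
Proof.
elim: b => [|b IH]; first by rewrite leqn0 => /eqP ->; rewrite !big_geq.
rewrite leq_eqVlt => /predU1P[->|]; first by rewrite !big_geq.
rewrite ltnS => ab; rewrite big_nat_recr //= -IH // (@big_cat_nat _ _ _ (2 ^ b)) //=.
  by rewrite leq_exp2l.
by rewrite leq_exp2l.
Qed.

Lemma ln2_ge_half : 1 / 2 <= ln 2 :> R.
Proof. by have := @ln_le_harmonic_step R 1 isT; rewrite ln1; lra. Qed.

(** On average a block [[2 ^ n, 2 ^ (n + 1))] has mass [ln 2] for [vonM k / k]. Summation by parts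
    over the blocks, with weights [G n], turns the error 11 of [sum_vonM_window] into
    [11 * G a <= 22 / a]. *)
Lemma sum_primes_dyadic_le a b d : (0 < a <= b)%N -> 0 < d ->
  \sum_(2 ^ a <= p < 2 ^ b | prime p) pw p (1 + d) <=
    \sum_(a <= n < b) pw 2 d ^+ n / n%:R + 22 / a%:R :> R.
Proof.
move=> /andP[a0 ab] d0; have l2 := ln2_ge_half.
have l20 : 0 < ln 2 :> R by lra.
pose G n : R := pw 2 d ^+ n / (n%:R * ln 2).
have pw2X n : pw (2 ^ n) d = pw 2 d ^+ n.
  by rewrite /pw lnX_nat // -expRM_natl; congr expR; ring.
have G0 n : 0 <= G n.
  by rewrite divr_ge0 ?exprn_ge0 ?pw_ge0 // mulr_ge0 // ltW.
pose A n : R := \sum_(2 ^ n <= k < 2 ^ n.+1) vonM k / k%:R.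
have block n : (a <= n)%N ->
    \sum_(2 ^ n <= p < 2 ^ n.+1) (if prime p then pw p (1 + d) else 0) <= A n * G n.
  move=> an; rewrite /A mulr_suml; apply: ler_sum_nat => p /andP[np _].
  have n0 : (0 < n)%N by lia.
  have p0 : (0 < p)%N by rewrite (leq_trans _ np) // expn_gt0.
  case: ifP => [pp|_]; last by rewrite mulr_ge0 // divr_ge0 ?vonM_ge0.
  rewrite vonM_prime // pw_1D //.
  have lp : n%:R * ln 2 <= ln p%:R :> R by rewrite -lnX_nat // ler_ln_nat // expn_gt0.
  have nl : 0 < n%:R * ln 2 :> R by rewrite mulr_gt0 // ltr0n.
  have h1 : pw p d <= pw 2 d ^+ n by rewrite -pw2X pw_mono ?(ltW d0) // expn_gt0 np.
  have h2 : pw p d <= ln p%:R * G n.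
    rewrite (le_trans h1) // /G mulrCA ler_peMr ?exprn_ge0 ?pw_ge0 //.
    by rewrite ler_pdivlMr // mul1r.
  by rewrite mulrAC [X in X <= _]mulrC ler_wpM2r ?invr_ge0.
rewrite big_mkcond sum_dyadic //.
rewrite (le_trans (ler_sum_nat (fun n h => block n (proj1 (andP h))))) //.
have Adiff m : (a <= m <= b)%N -> `|\sum_(a <= n < m) (A n - ln 2)| <= 11.
  move=> /andP[am _].
  rewrite sumrB -sum_dyadic // sumr_const_nat.
  have := @sum_vonM_window R (2 ^ a) (2 ^ m).
  rewrite expn_gt0 /= leq_exp2l // am !lnX_nat // => /(_ isT).
  by rewrite -mulrBl -natrB // mulr_natl.
have := @abel_decr_real R (fun n => A n - ln 2) G a b 11 ab Adiff (fun n _ => G0 n).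
have G_decr n : (a <= n)%N -> G n.+1 <= G n.
  move=> an; have n0 : (0 < n)%N by lia.
  rewrite /G ler_pM ?invr_ge0 ?exprn_ge0 ?pw_ge0 ?mulr_ge0 ?(ltW l20) //.
    by rewrite exprS ler_piMl ?exprn_ge0 ?pw_ge0 ?pw_le1 ?(ltW d0).
  by rewrite lef_pV2 ?posrE ?mulr_gt0 ?ltr0n // ler_pM2r // ler_nat.
move=> /(_ G_decr); rewrite ler_norml => /andP[_ h].
have e : \sum_(a <= n < b) A n * G n = \sum_(a <= n < b) (A n - ln 2) * G n +
    \sum_(a <= n < b) pw 2 d ^+ n / n%:R.
  rewrite -big_split /=; apply: eq_big_nat => n /andP[an _].
  have n0 : (0 < n)%N by lia.
  rewrite mulrBl -addrA -[LHS]addr0; congr (_ + _).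
  apply/eqP; rewrite eq_sym addrC subr_eq0 /G; apply/eqP; field.
  by rewrite gt_eqF //= pnatr_eq0 -lt0n.
rewrite e addrC lerD2l (le_trans h) // /G.
have a0' : 0 < a%:R :> R by rewrite ltr0n.
rewrite mulrA ler_pdivrMr ?mulr_gt0 // mulrA divfK ?gt_eqF //.
have h1 : pw 2 d ^+ a <= 1 by rewrite exprn_ile1 ?pw_ge0 ?pw_le1 ?(ltW d0).
lra.
Qed.

Lemma exp2_pred_ge (a : nat) : (a <= (2 ^ a).-1)%N.
Proof. by rewrite -ltnS prednK ?expn_gt0 // ltn_expl. Qed.

(** For large [b] the product up to [2 ^ b] is about [1 / zeta (1 + d)], hence at most about [d].
    Removing the primes from [2 ^ a] on costs the exponential of [sum_(a <= n < b) x ^ n / n] with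
    [x = 2 ^ (- d) = expR (- k / a)], that is, of [- ln (1 - x)], about [ln (a / k)], minus a head
    which is almost the harmonic sum [ln a + euler_constant]. *)
Lemma mertens_product (a : nat) (k : R) : (1 < a)%N -> 0 < k <= 1 ->
  \prod_(0 <= p < 2 ^ a | prime p) (1 - pw p (1 + k / ln (2 ^ a)%:R)) <=
  expR (k + 27 / a%:R - euler_constant R) / ln (2 ^ a)%:R.
Proof.
move=> a1 /andP[k0 k1]; have l2 := ln2_ge_half.
have l20 : 0 < ln 2 :> R by lra.
have a0' : 0 < a%:R :> R by rewrite ltr0n; lia.
set N := ln (2 ^ a)%:R; have NE : N = a%:R * ln 2 by rewrite /N lnX_nat.
have N0 : 0 < N by rewrite NE mulr_gt0.
pose d := k / N; have d0 : 0 < d by rewrite divr_gt0.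
rewrite -/d.
pose f n : R[i] := (pw n (1 + d))%:C.
have fle n : (0 < n)%N -> normc (f n) <= pw n (1 + d).
  by move=> _; rewrite normc_real ger0_norm // pw_ge0.
have fM m n : (0 < m)%N -> (0 < n)%N -> f (m * n)%N = f m * f n.
  by move=> m0 n0; rewrite /f pwM // rmorphM.
have f1 : f 1%N = 1 by rewrite /f pw_1.
have [Z hZ] := abs_series_cvg d0 fle.
have Zge : d^-1 <= normc Z.
  apply/ler_addgt0Pr => e e0; have [M HM] := hZ _ (divr_gt0 e0 (ltr0n _ 2)).
  have ed0 : 0 < e * d / 2 by rewrite divr_gt0 // mulr_gt0.
  have [M' HM'] := pw_small d0 ed0.
  pose n := maxn M M'.
  have h1 := HM n (leq_maxl _ _); have h2 := HM' n.+1 (leqW (leq_maxr _ _)).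
  have h3 := @sum_pw_ge R n.+1 d d0 isT.
  have h4 : (1 - e * d / 2) / d <= (1 - pw n.+1 d) / d.
    by rewrite ler_pM2r ?invr_gt0 // lerD2l lerN2 ltW.
  have h5 : (1 - e * d / 2) / d = d^-1 - e / 2 by field; rewrite gt_eqF.
  have h6 := normc_triB (\sum_(1 <= n < n.+1) f n) Z.
  have h7 : normc (\sum_(1 <= n < n.+1) f n) = \sum_(1 <= n < n.+1) pw n (1 + d).
    by rewrite -real_sum normc_real ger0_norm // sumr_ge0 // => i _; exact: pw_ge0.
  move: h1 h3 h4 h6; rewrite h5 h7; lra.
have Pn0 P Q : 0 <= \prod_(Q <= p < P | prime p) (1 - pw p (1 + d)).
  by apply: prodr_ge0 => p _; rewrite subr_ge0 pw_le1 //; lra.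
have [b ab hb] : exists2 b, (a <= b)%N &
    \prod_(0 <= p < 2 ^ b | prime p) (1 - pw p (1 + d)) <= d * (1 + a%:R^-1).
  have ed0 : 0 < d / a%:R by rewrite divr_gt0.
  have [M HM] := pw_small d0 ed0.
  pose b := maxn a M.+1; exists b; first exact: leq_maxl.
  have bM : (M.+1 < 2 ^ b)%N by rewrite (leq_ltn_trans (leq_maxr a _)) // ltn_expl.
  have b1 : (1 < 2 ^ b)%N by rewrite (leq_ltn_trans _ bM).
  have := euler_product_tail f1 fM d0 fle b1 hZ.
  have -> : \prod_(0 <= p < 2 ^ b | prime p) (1 - f p) =
      (\prod_(0 <= p < 2 ^ b | prime p) (1 - pw p (1 + d)))%:C.
    by rewrite rmorph_prod; apply: eq_bigr => p _; rewrite rmorphB.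
  set P := \prod_(_ <= _ < _ | _) _ => h.
  have h1 := normc_triB (P%:C * Z) 1.
  have P0 : 0 <= P := Pn0 _ _.
  rewrite normcM normc_real (ger0_norm P0) normc1E in h1.
  have h2 : pw (2 ^ b).-1 d / d <= a%:R^-1.
    rewrite ler_pdivrMr // mulrC ltW // HM //.
    by rewrite (leq_trans _ (exp2_pred_ge b)) // (leq_trans (leqnSn M)) // leq_maxr.
  have h3 : P * d^-1 <= P * normc Z by rewrite ler_wpM2l.
  rewrite mulrC -ler_pdivrMr //; move: h h1 h2 h3; lra.
(* For [v <= 1 / 2] one has [(1 - v) (1 + v + 2 v ^ 2) = 1 + v ^ 2 (1 - 2 v) >= 1]. *)
have step p : (2 ^ a <= p)%N -> 1 <= (1 - pw p (1 + d)) * expR (pw p (1 + d) + 2 * pw p 2).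
  move=> ap; set v := pw p (1 + d).
  have p0 : (0 < p)%N by rewrite (leq_trans _ ap) // expn_gt0.
  have v0 : 0 <= v := pw_ge0 _ _.
  have v1 : v <= 1 / 2.
    rewrite (le_trans (_ : _ <= pw p 1)) ?pw_le //; first by lra.
    rewrite pw_inv // div1r lef_pV2 ?posrE ?ltr0n // (ler_nat _ 2).
    by rewrite (leq_trans _ ap) // (leq_exp2l 1) // ltnW.
  have v2 : v ^+ 2 <= pw p 2.
    rewrite (_ : 2 = 1 + 1) // pwD -expr2 lerXn2r ?nnegrE ?pw_ge0 ?pw_le //; lra.
  have h1 : 1 + (v + 2 * v ^+ 2) <= expR (v + 2 * pw p 2).
    by rewrite (le_trans (expR_ge1Dx _)) // ler_expR lerD2l ler_pM2l.
  have h2 : 0 <= 1 - v by lra.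
  apply: le_trans (ler_wpM2l h2 h1).
  have : 0 <= v ^+ 2 * (1 - 2 * v) by rewrite mulr_ge0 ?exprn_ge0 //; lra.
  rewrite expr2; lra.
have h1 : \prod_(0 <= p < 2 ^ a | prime p) (1 - pw p (1 + d)) <=
    d * (1 + a%:R^-1) *
    expR (\sum_(2 ^ a <= p < 2 ^ b | prime p) (pw p (1 + d) + 2 * pw p 2)).
  apply: (@le_trans _ _ (\prod_(0 <= p < 2 ^ b | prime p) (1 - pw p (1 + d)) *
    expR (\sum_(2 ^ a <= p < 2 ^ b | prime p) (pw p (1 + d) + 2 * pw p 2)))); last first.
    by rewrite ler_wpM2r ?expR_ge0.
  rewrite [in X in _ <= X](@big_cat_nat _ _ _ (2 ^ a)) ?leq_exp2l //= -mulrA.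
  rewrite ler_peMr ?Pn0 // expR_sum -big_split /= big_nat_cond.
  elim/big_ind: _ => // [x y x1 y1|p /andP[/andP[ap _] _]]; last exact: step.
  by rewrite mulr_ege1.
have h2 : \sum_(2 ^ a <= p < 2 ^ b | prime p) (pw p (1 + d) + 2 * pw p 2) <=
    \sum_(a <= n < b) pw 2 d ^+ n / n%:R + 22 / a%:R + 2 / a%:R.
  rewrite big_split /= lerD //; first by apply: sum_primes_dyadic_le => //; rewrite ab ltnW.
  rewrite -mulr_sumr ler_wpM2l //.
  apply: (@le_trans _ _ (\sum_(2 ^ a <= p < 2 ^ b) pw p (1 + 1))).
    by rewrite big_mkcond; apply: ler_sum_nat => p _; case: ifP; rewrite ?pw_ge0.
  have a2 : (1 < 2 ^ a)%N by rewrite (leq_exp2l 1) // ltnW.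
  rewrite (le_trans (sum_pw_tail _ _ _)) // divr1 pw_inv; last by rewrite (leq_trans _ (exp2_pred_ge a)) // ltnW.
  by rewrite lef_pV2 ?posrE ?ltr0n ?ler_nat ?(leq_trans _ (exp2_pred_ge a)) ?(ltnW a1) //.
have xE : pw 2 d = expR (- (k / a%:R)).
  by rewrite /pw /d NE; congr (expR (- _)); field; rewrite !gt_eqF.
have x01 : 0 <= pw 2 d < 1.
  by rewrite pw_ge0 /= xE expR_lt1 oppr_lt0 divr_gt0.
have h3 : \sum_(a <= n < b) pw 2 d ^+ n / n%:R <=
    - ln (1 - pw 2 d) - \sum_(1 <= n < a) pw 2 d ^+ n / n%:R.
  have := log_poly_le b x01; rewrite [X in X <= _](@big_cat_nat _ _ _ a) //=; first by lra.
  by rewrite ltnW.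
(* [x ^ n >= 1 - k n / a], so the head of the logarithmic series is a harmonic sum up to [k]; this
   is where Euler's constant comes from. *)
have h4 : \sum_(1 <= n < a.+1) n%:R^-1 - a%:R^-1 - k <= \sum_(1 <= n < a) pw 2 d ^+ n / n%:R.
  rewrite big_nat_recr /=; last by rewrite ltnW.
  rewrite addrK.
  have : k >= \sum_(1 <= n < a) k / a%:R.
    rewrite sumr_const_nat -[X in X <= _]mulr_natr -mulrA ler_piMr ?(ltW k0) //.
    by rewrite mulrC ler_pdivrMr // mul1r ler_nat leq_subr.
  suff : \sum_(1 <= n < a) n%:R^-1 - \sum_(1 <= n < a) k / a%:R <=
    \sum_(1 <= n < a) pw 2 d ^+ n / n%:R by lra.
  rewrite -sumrB; apply: ler_sum_nat => n /andP[n0 _].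
  have n0' : 0 < n%:R :> R by rewrite ltr0n.
  rewrite ler_pdivlMr // mulrBl mulVf ?gt_eqF //.
  rewrite xE -expRM_natl (le_trans _ (expR_ge1Dx _)) //; lra.
have h5 : - ln (1 - pw 2 d) <= ln a%:R - ln k + k / a%:R.
  have u0 : 0 < k / a%:R by rewrite divr_gt0.
  have h : k / a%:R * expR (- (k / a%:R)) <= 1 - pw 2 d.
    rewrite xE; have := expR_ge1Dx (k / a%:R); rewrite -(ler_pM2r (expR_gt0 (- (k / a%:R)))).
    by rewrite -expRD subrr expR0; lra.
  have : ln (k / a%:R * expR (- (k / a%:R))) <= ln (1 - pw 2 d).
    have p1 : 0 < k / a%:R * expR (- (k / a%:R)) by rewrite mulr_gt0 ?expR_gt0.
    by rewrite ler_ln ?posrE // (lt_le_trans p1 h).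
  rewrite lnM ?posrE ?expR_gt0 // expRK ln_div ?posrE //; lra.
have h6 := @euler_constant_le a (ltnW a1).
have ia : k / a%:R <= a%:R^-1 by rewrite ler_piMl ?invr_ge0 ?(ltW a0').
have h7 : 1 + a%:R^-1 <= expR (a%:R^-1) :> R by exact: expR_ge1Dx.
apply: (le_trans h1).
(* [26 = 22 + 2 + 1 + 1]: the dyadic estimate, the squares of primes, [k / a], and the last harmonic
   term. The factor [1 + 1 / a] then makes 27. *)
apply: (@le_trans _ _ (d * expR (a%:R^-1) * expR (- ln k + k + 26 / a%:R - euler_constant R))).
  have p1 : 0 <= d * (1 + a%:R^-1).
    by rewrite mulr_ge0 ?(ltW d0) // addr_ge0 // invr_ge0 ltW.
  apply: (ler_pM p1 (expR_ge0 _)); first by rewrite ler_pM2l.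
  rewrite ler_expR (le_trans h2) //; move: h3 h4 h5 h6 ia; move: (a%:R^-1) => t; lra.
rewrite le_eqVlt; apply/orP; left; apply/eqP.
have -> : expR (k + 27 / a%:R - euler_constant R) =
    k * (expR (a%:R^-1) * expR (- ln k + k + 26 / a%:R - euler_constant R)).
  transitivity (expR (ln k) * (expR (a%:R^-1) *
    expR (- ln k + k + 26 / a%:R - euler_constant R))); last by rewrite lnK.
  by rewrite -!expRD; congr expR; move: (a%:R^-1) => t; ring.
by rewrite /d; move: (expR _) (expR _) => u v; ring.
Qed.

End MertensProduct.

Lemma uniq_map_inj (T1 T2 : eqType) (g : T1 -> T2) (s : seq T1) :
  uniq [seq g x | x <- s] -> {in s &, injective g}.
Proof.
elim: s => // z s IH /= /andP[zs us] x y; rewrite !inE.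
case/predU1P=> [->|xs]; case/predU1P=> [->|ys] // e.
- by case/negP: zs; rewrite e map_f.
- by case/negP: zs; rewrite -e map_f.
- exact: IH.
Qed.

Lemma sumr_const_seq {R : realType} (T : Type) (s : seq T) (c : R) :
  \sum_(x <- s) c = (size s)%:R * c.
Proof.
elim: s => [|x s IH]; first by rewrite big_nil mul0r.
by rewrite big_cons IH /= -natr1; ring.
Qed.

(** * Resonance *)

Section DirichletPolynomials.
Context {R : realType}.
Implicit Types (L : seq (R[i] * nat)) (t : R).

Definition ch t (n : nat) : R[i] := natpowc n (- (0 +i* t)).

Lemma chE t n : ch t n = cexp (0 +i* (- (t * ln n%:R))).
Proof.
by rewrite /ch /natpowc; congr cexp; apply: complex_eqP; rewrite ?(ReM, ImM) /=; ring.
Qed.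

Lemma normc_ch t n : normc (ch t n) = 1.
Proof. by rewrite chE normc_cexp expR0. Qed.

Lemma chM t m n : (0 < m)%N -> (0 < n)%N -> ch t (m * n) = ch t m * ch t n.
Proof. exact: natpowcM. Qed.

Lemma ch1 t : ch t 1 = 1.
Proof. exact: natpowc1. Qed.

Lemma chX t m k : (0 < m)%N -> ch t (m ^ k) = ch t m ^+ k.
Proof.
move=> m0; elim: k => [|k IH]; first by rewrite expn0 ch1 expr0.
by rewrite expnS chM ?expn_gt0 ?m0 // IH exprS.
Qed.

Lemma ch_conj t n : (ch t n)^*%C = ch (- t) n.
Proof.
rewrite !chE /cexp; apply: complex_eqP => /=; rewrite ?mulNr ?opprK ?cosN ?sinN;
  rewrite ?expR0 /=; ring.
Qed.

Lemma ch_natmul (k : nat) t n : ch (k%:R * t) n = ch t n ^+ k.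
Proof.
rewrite !chE -cexpM_nat; congr cexp; elim: k => [|k IH].
  by rewrite mulr0n mul0r mul0r oppr0.
by rewrite [in RHS]mulrS -IH -natr1; apply: complex_eqP; rewrite /= ?addr0 //; ring.
Qed.

Lemma cexp_i_lower (x : R) : `|x| <= 1 / 10 -> `|x| / 2 <= normc (1 - cexp (0 +i* x)).
Proof.
move=> x1; have n1 : normc (0 +i* x) = `|x| by rewrite /= expr0n add0r sqrtr_sqr.
have := @cexpB1Bz_le R (0 +i* x); rewrite n1 => h.
have e1 : expR `|x| <= 10 / 9.
  have := expR_ge1Dx (- `|x|); rewrite expRN => h1.
  have h2 : 9 / 10 <= (expR `|x|)^-1 by lra.
  by rewrite -[expR _]invrK -[X in _ <= X]invrK lef_pV2 ?posrE ?invr_gt0 ?expR_gt0 //; lra.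
have h3 : 4 * `|x| ^+ 2 * expR `|x| <= `|x| / 2.
  have : `|x| ^+ 2 * expR `|x| <= `|x| * (1 / 10) * (10 / 9).
    by rewrite ler_pM ?expR_ge0 ?exprn_ge0 // expr2 ler_wpM2l.
  have := normr_ge0 x; lra.
have := normc_triB (0 +i* x) (0 +i* x - (cexp (0 +i* x) - 1)).
rewrite n1 (_ : _ - (_ - (cexp _ - 1)) = cexp (0 +i* x) - 1); last by ring.
rewrite [X in _ - X]normcBC [X in _ <= X -> _]normcBC; move: h h3; lra.
Qed.

Lemma ln_nat_dist (a b B : nat) : (0 < a <= B)%N -> (0 < b <= B)%N -> a != b ->
  B%:R^-1 <= `|ln a%:R - ln b%:R| :> R.
Proof.
wlog ab : a b / (b < a)%N => [H aB bB ne|].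
  have [ab|ab] := ltnP b a; first exact: H.
  rewrite distrC; apply: H => //; last by rewrite eq_sym.
  by rewrite ltn_neqAle ne.
move=> /andP[a0 aB] /andP[b0 bB] _.
have h1 : ln b.+1%:R <= ln a%:R :> R by rewrite ler_ln_nat.
have h2 := @ln_le_harmonic_step R b b0.
have h3 : B%:R^-1 <= b.+1%:R^-1 :> R by rewrite lef_pV2 ?posrE ?ltr0n ?ler_nat; lia.
by rewrite (le_trans _ (ler_norm _)) //; move: h3 h2 h1; move: (b.+1%:R^-1) (B%:R^-1) => u v; lra.
Qed.

(** Spacing of the sampling points [j * step B]. It keeps the phases [step B * (ln a - ln b)], for
    [a] and [b] up to [B], below [1 / 10], so that distinct frequencies are not aliased. *)
Definition step (B : nat) : R := (10 * B%:R)^-1.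

(** A geometric sum of ratio [w] is at most [2 / |1 - w|]. Distinct integers up to [B] have
    logarithms at least [1 / B] apart, so the phase of [w] is at least [1 / (10 B ^ 2)], and
    [|1 - w|] at least half of that. *)
Lemma sum_ch_le (a b B J : nat) : (0 < a <= B)%N -> (0 < b <= B)%N -> a != b ->
  normc (\sum_(J <= j < J + J) ch (j%:R * step B) a * (ch (j%:R * step B) b)^*%C)
    <= 40 * B%:R ^+ 2.
Proof.
move=> aB bB ne; have B0 : 0 < B%:R :> R by rewrite ltr0n; lia.
pose x := - (step B * (ln a%:R - ln b%:R)).
pose w : R[i] := cexp (0 +i* x).
have wE : w = ch (step B) a * (ch (step B) b)^*%C.
  rewrite ch_conj !chE -cexpD /w /x; congr cexp.
  by apply: complex_eqP; rewrite /= ?addr0 //; ring.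
rewrite (eq_bigr (fun j => w ^+ j)); last first.
  move=> j _; rewrite ch_conj -mulrN !ch_natmul -exprMn wE.
  by rewrite ch_conj.
have st0 : 0 < step B by rewrite invr_gt0 mulr_gt0.
have lnB n : (0 < n <= B)%N -> 0 <= (ln n%:R : R) <= B%:R.
  move=> /andP[n0 nB]; rewrite ln_nat_ge0 (le_trans (ltW (ln_sublinear _))) ?ltr0n //.
  by rewrite ler_nat.
have [/andP[la0 laB] /andP[lb0 lbB]] := (lnB a aB, lnB b bB).
have x1 : `|x| <= 1 / 10.
  rewrite normrN normrM (gtr0_norm st0) /step invfM mulrAC -mulrA.
  have : `|ln a%:R - ln b%:R| <= B%:R :> R by rewrite ler_norml; apply/andP; split; lra.
  by move=> h; rewrite div1r ler_piMr ?invr_ge0 // ler_pdivrMr // mul1r.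
have x2 : 1 / (10 * B%:R ^+ 2) <= `|x|.
  rewrite normrN normrM (gtr0_norm st0).
  have h := ln_nat_dist aB bB ne; rewrite (le_trans _ (ler_wpM2l (ltW st0) h)) //.
  by rewrite /step -invfM -mulrA -expr2 div1r.
have w1 := cexp_i_lower x1; rewrite -/w in w1.
have w0 : 0 < normc (1 - w).
  apply: lt_le_trans w1; rewrite divr_gt0 // (lt_le_trans _ x2) //.
  by rewrite divr_gt0 // mulr_gt0 // exprn_gt0.
rewrite -(ler_pM2l w0) -normcM.
have -> : (1 - w) * \sum_(J <= j < J + J) w ^+ j = w ^+ J - w ^+ (J + J).
  rewrite mulr_sumr (eq_bigr (fun j => - (w ^+ j.+1) - - (w ^+ j))).
    by rewrite (telescope_sumr (fun j => - w ^+ j)) ?leq_addr // opprK addrC.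
  by move=> j _; rewrite exprS; ring.
apply: (@le_trans _ _ 2).
  rewrite (le_trans (normcB _ _)) // !normcXE wE normcM normcJE !normc_ch.
  by rewrite mulr1 !expr1n; lra.
have h : 1 / (20 * B%:R ^+ 2) <= normc (1 - w).
  apply: le_trans w1; rewrite (_ : 1 / (20 * B%:R ^+ 2) = (1 / (10 * B%:R ^+ 2)) / 2); first by lra.
  by field; rewrite gt_eqF.
have B2 : 0 < 40 * B%:R ^+ 2 :> R by rewrite mulr_gt0 // exprn_gt0.
have := h; rewrite -(ler_pM2r B2); apply: le_trans.
by rewrite le_eqVlt; apply/orP; left; apply/eqP; field; rewrite gt_eqF.
Qed.

(** Dirichlet polynomials are lists of coefficients paired with integers, so that products are
    formed without collecting terms; [admissible] records that no integer is repeated, which is what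
    orthogonality needs. *)
Definition ev L t := \sum_(x <- L) x.1 * ch t x.2.
Definition ns L := [seq x.2 | x <- L].
Definition ssq L : R := \sum_(x <- L) normc x.1 ^+ 2.

Definition admissible (B : nat) L :=
  [/\ uniq (ns L), forall n, n \in ns L -> (0 < n <= B)%N &
      forall x, x \in L -> normc x.1 <= 1].

Lemma size_admissible B L : admissible B L -> (size L <= B)%N.
Proof.
move=> [u nB _]; rewrite -(size_map snd L) -/(ns L) -(size_iota 1 B).
apply: uniq_leq_size => // n /nB; rewrite mem_iota; lia.
Qed.

(** The diagonal gives [J * ssq L]; each of the at most [B ^ 2] other terms is bounded by
    [sum_ch_le]. *)
Lemma mean_square B J L : admissible B L ->
  `|\sum_(J <= j < J + J) normc (ev L (j%:R * step B)) ^+ 2 - J%:R * ssq L|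
    <= 40 * B%:R ^+ 4.
Proof.
move=> adm; have [u nB c1] := adm; have sB := size_admissible adm.
have uL : uniq L by exact: map_uniq u.
rewrite -normc_real.
have -> : (\sum_(J <= j < J + J) normc (ev L (j%:R * step B)) ^+ 2 - J%:R * ssq L)%:C =
    \sum_(x <- L) \sum_(y <- L | y != x) x.1 * (y.1)^*%C *
     \sum_(J <= j < J + J) ch (j%:R * step B) x.2 * (ch (j%:R * step B) y.2)^*%C.
  pose S x y := x.1 * (y.1)^*%C *
     \sum_(J <= j < J + J) ch (j%:R * step B) x.2 * (ch (j%:R * step B) y.2)^*%C.
  have e1 : (\sum_(J <= j < J + J) normc (ev L (j%:R * step B)) ^+ 2)%:C =
      \sum_(x <- L) \sum_(y <- L) S x y.
    rewrite real_sum (eq_bigr (fun j => \sum_(x <- L) \sum_(y <- L)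
       x.1 * (y.1)^*%C * (ch (j%:R * step B) x.2 * (ch (j%:R * step B) y.2)^*%C))).
      rewrite exchange_big /=; apply: eq_bigr => x _.
      by rewrite exchange_big /=; apply: eq_bigr => y _; rewrite /S mulr_sumr.
    move=> j _; rewrite -sqrt_normc_conj {1}/ev mulr_suml; apply: eq_bigr => x _.
    rewrite /ev rmorph_sum mulr_sumr; apply: eq_bigr => y _.
    by rewrite rmorphM mulrACA.
  rewrite rmorphB /= e1 /ssq rmorphM /= real_sum mulr_sumr -sumrB.
  rewrite big_seq [RHS]big_seq; apply: eq_bigr => x xL.
  rewrite (bigD1_seq x) //= addrC.
  have e2 : \sum_(J <= j < J + J) ch (j%:R * step B) x.2 * (ch (j%:R * step B) x.2)^*%C
      = J%:R.
    rewrite (eq_bigr (fun=> 1)); first by rewrite sumr_const_nat addnK.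
    by move=> j _; rewrite sqrt_normc_conj normc_ch expr1n.
  rewrite {2}/S e2 sqrt_normc_conj -addrA rmorph_nat [_ * J%:R]mulrC subrr addr0.
  by [].
have S0 : 0 <= 40 * B%:R ^+ 2 :> R by rewrite mulr_ge0 ?exprn_ge0.
rewrite (le_trans (normc_sum _ _ _)) //.
apply: (@le_trans _ _ (\sum_(x <- L) \sum_(y <- L) 40 * B%:R ^+ 2)).
  rewrite big_seq [X in _ <= X]big_seq; apply: ler_sum => x xL.
  rewrite (le_trans (normc_sum _ _ _)) // big_mkcond /=.
  rewrite big_seq [X in _ <= X]big_seq; apply: ler_sum => y yL.
  case: ifP => // yx; rewrite !normcM normcJE.
  have ne : x.2 != y.2.
    apply: contra yx => /eqP e; apply/eqP.
    exact: (uniq_map_inj u yL xL (esym e)).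
  rewrite -[X in _ <= X]mul1r ler_pM ?mulr_ge0 ?normc_ge0 //.
    by rewrite mulr_ile1 ?normc_ge0 ?c1.
  by apply: sum_ch_le => //; apply: nB; apply: map_f.
rewrite !sumr_const_seq.
have h : (size L)%:R <= B%:R :> R by rewrite ler_nat.
rewrite (_ : 40 * B%:R ^+ 4 = B%:R * (B%:R * (40 * B%:R ^+ 2))); last by ring.
by rewrite !ler_pM ?mulr_ge0 ?exprn_ge0.
Qed.


Definition mulL L1 L2 := [seq (x.1 * y.1, (x.2 * y.2)%N) | x <- L1, y <- L2].

Definition pos_ns L := forall n, n \in ns L -> (0 < n)%N.

Lemma ev_mulL L1 L2 t : pos_ns L1 -> pos_ns L2 ->
  ev (mulL L1 L2) t = ev L1 t * ev L2 t.
Proof.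
move=> p1 p2; rewrite /ev /mulL big_allpairs_dep /= mulr_suml.
rewrite big_seq [RHS]big_seq; apply: eq_bigr => x x1; rewrite mulr_sumr.
rewrite big_seq [RHS]big_seq; apply: eq_bigr => y y2.
rewrite chM; [ring|exact: p1 (map_f _ x1)|exact: p2 (map_f _ y2)].
Qed.

Lemma ssq_mulL L1 L2 : ssq (mulL L1 L2) = ssq L1 * ssq L2.
Proof.
rewrite /ssq /mulL big_allpairs_dep /= mulr_suml; apply: eq_bigr => x _.
by rewrite mulr_sumr; apply: eq_bigr => y _; rewrite normcM exprMn.
Qed.

Lemma ns_mulL L1 L2 : ns (mulL L1 L2) = [seq (m * n)%N | m <- ns L1, n <- ns L2].
Proof.
rewrite /ns /mulL; elim: L1 => //= x L1 IH; rewrite map_cat IH; congr (_ ++ _).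
by rewrite -!map_comp.
Qed.

Lemma mem_mulL L1 L2 x : x \in mulL L1 L2 -> exists y z,
  [/\ y \in L1, z \in L2, x.1 = y.1 * z.1 & x.2 = (y.2 * z.2)%N].
Proof. by case/allpairsP => -[y z] /= [? ? ->]; exists y, z. Qed.

Lemma mem_ns_mulL L1 L2 n : n \in ns (mulL L1 L2) -> exists a b,
  [/\ a \in ns L1, b \in ns L2 & n = (a * b)%N].
Proof. by rewrite ns_mulL => /allpairsP[[a b] /= [? ? ->]]; exists a, b. Qed.

Lemma uniq_ns_mulL L1 L2 : uniq (ns L1) -> uniq (ns L2) ->
  (forall a a' b b', a \in ns L1 -> a' \in ns L1 -> b \in ns L2 -> b' \in ns L2 ->
     (a * b = a' * b')%N -> a = a') ->
  pos_ns L1 -> uniq (ns (mulL L1 L2)).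
Proof.
move=> u1 u2 inj pos; rewrite ns_mulL; apply: allpairs_uniq => // -[a b] [a' b'].
case/allpairsP => -[a1 b1] /= [a1L b1L [-> ->]].
case/allpairsP => -[a2 b2] /= [a2L b2L [-> ->]] e.
have e1 := inj _ _ _ _ a1L a2L b1L b2L e; rewrite {}e1 in e *.
by congr (_, _); apply/eqP; rewrite -(eqn_pmul2l (pos _ a2L)) e.
Qed.

Definition geomL (w : R[i]) (p m : nat) := [seq (w ^+ e, (p ^ e)%N) | e <- iota 0 m.+1].

Lemma ev_geomL w p m t : (0 < p)%N ->
  ev (geomL w p m) t = \sum_(0 <= e < m.+1) (w * ch t p) ^+ e.
Proof.
move=> p0; rewrite /ev /geomL big_map /index_iota subn0; apply: eq_bigr => e _ /=.
by rewrite [RHS]exprMn chX.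
Qed.

Lemma ns_geomL w p m : ns (geomL w p m) = [seq (p ^ e)%N | e <- iota 0 m.+1].
Proof. by rewrite /ns /geomL -map_comp. Qed.

Definition smooth (ps : seq nat) n := forall r, prime r -> (r %| n)%N -> r \in ps.

Variables (w : nat -> R[i]) (m : nat).

(** The resonator. By unique factorization its integers are distinct, and its coefficients have
    modulus 1 when the [w p] do, so its mean square is its number of terms. *)
Definition resL (ps : seq nat) : seq (R[i] * nat) :=
  foldr (fun p L => mulL (geomL (w p) p m) L) [:: (1, 1%N)] ps.

Let pow_inj p a a' b b' : prime p -> ~~ (p %| b)%N -> ~~ (p %| b')%N ->
  (p ^ a * b = p ^ a' * b')%N -> a = a'.
Proof.
move=> pp pb pb' e; have b0 : (0 < b)%N by case: b pb {e}; rewrite ?dvdn0.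
have b0' : (0 < b')%N by case: b' pb' {e}; rewrite ?dvdn0.
have := congr1 (logn p) e; rewrite !lognM ?expn_gt0 ?(prime_gt0 pp) //.
have [cb cb'] : coprime p b /\ coprime p b' by split; rewrite prime_coprime.
by rewrite !pfactorK // !logn_coprime // !addn0.
Qed.

Lemma resL_facts ps : uniq ps -> (forall p, p \in ps -> prime p) ->
  (forall p, p \in ps -> normc (w p) = 1) ->
  [/\ forall t, ev (resL ps) t = \prod_(p <- ps) \sum_(0 <= e < m.+1) (w p * ch t p) ^+ e,
      uniq (ns (resL ps)),
      forall n, n \in ns (resL ps) -> (0 < n <= \prod_(p <- ps) p ^ m)%N /\ smooth ps n,
      forall x, x \in resL ps -> normc x.1 = 1 &
      ssq (resL ps) = m.+1%:R ^+ size ps].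
Proof.
elim: ps => [|p ps IH] /=.
  move=> _ _ _; split => //.
  - by move=> t; rewrite /ev big_seq1 ch1 mulr1 big_nil.
  - move=> n; rewrite inE => /eqP ->; rewrite big_nil; split=> // r /prime_gt1 r1.
    by rewrite dvdn1 => /eqP r1'; rewrite r1' in r1.
  - by move=> x; rewrite inE => /eqP ->; exact: normc1E.
  - by rewrite /ssq big_seq1 expr0 (_ : normc _ = 1) ?expr1n //; exact: normc1E.
move=> /andP[pps ups] pr w1.
have pp : prime p by apply: pr; rewrite inE eqxx.
have p0 := prime_gt0 pp.
have [|q qps|q qps|IH1 IH2 IH3 IH4 IH5] := IH _ _ _ => //.
- by apply: pr; rewrite inE qps orbT.
- by apply: w1; rewrite inE qps orbT.
have g_pos : pos_ns (geomL (w p) p m).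
  by move=> n; rewrite ns_geomL => /mapP[e _ ->]; rewrite expn_gt0 p0.
have r_pos : pos_ns (resL ps) by move=> n /IH3[/andP[]].
have np n : n \in ns (resL ps) -> ~~ (p %| n)%N.
  by move=> /IH3[_ sm]; apply/negP => /(sm _ pp); rewrite (negPf pps).
split.
- by move=> t; rewrite ev_mulL // IH1 ev_geomL // big_cons.
- apply: uniq_ns_mulL => //.
    rewrite ns_geomL map_inj_in_uniq ?iota_uniq // => e e' _ _.
    by move/eqP; rewrite eqn_exp2l ?prime_gt1 // => /eqP.
  move=> a a' b b'; rewrite !ns_geomL => /mapP[e _ ->] /mapP[e' _ ->] bL b'L.
  by move/(pow_inj pp (np _ bL) (np _ b'L)) ->.
- move=> n /mem_ns_mulL[a [b [aL bL ->]]]; have [/andP[b0 bP] sm] := IH3 _ bL.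
  move: aL; rewrite ns_geomL => /mapP[e]; rewrite mem_iota add0n ltnS => em ->.
  split.
    rewrite muln_gt0 expn_gt0 p0 b0 /= big_cons leq_mul //.
    by rewrite leq_pexp2l.
  move=> r rp; rewrite Euclid_dvdM // inE => /orP[|/(sm _ rp) ->]; last by rewrite orbT.
  by rewrite Euclid_dvdX // dvdn_prime2 // => /andP[->].
- move=> x /mem_mulL[y [z [yL /IH4 z1 -> _]]]; rewrite normcM z1 mulr1.
  case/mapP: yL => e _ -> /=; rewrite normcXE w1 ?expr1n // inE eqxx //.
- rewrite ssq_mulL IH5 exprS; congr (_ * _).
  rewrite /ssq /geomL big_map (eq_bigr (fun=> 1)).
    by rewrite sumr_const_seq size_iota mulr1.
  by move=> e _ /=; rewrite normcXE w1 ?expr1n // inE eqxx.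
Qed.

Lemma geom_telescope (z : R[i]) :
  (z - 1) * \sum_(0 <= e < m.+1) z ^+ e = z ^+ m.+1 - 1.
Proof.
rewrite mulr_sumr (eq_bigr (fun e => z ^+ e.+1 - z ^+ e)).
  by rewrite (telescope_sumr (fun e => z ^+ e)).
by move=> e _; rewrite exprS; ring.
Qed.

Section Resonator.
Variable ps : seq nat.
Hypothesis ups : uniq ps.
Hypothesis pr : forall p, p \in ps -> prime p.
Hypothesis w1 : forall p, p \in ps -> normc (w p) = 1.
Variable B : nat.

(** By [geom_telescope], multiplying the resonator by [w p * ch t p - 1] replaces its factor at [p]
    by two terms. The mean square of that factor drops from [m + 1] to 2: under the resonator's
    density, [p ^ (- it)] is close to the inverse of [w p] on average. *)
Let defectL p := mulL [:: (- 1, 1%N); (w p ^+ m.+1, (p ^ m.+1)%N)] (resL (rem p ps)).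

Lemma defect_test p : p \in ps -> (p ^ m.+1 * \prod_(q <- ps) q ^ m <= B)%N ->
  [/\ admissible B (defectL p),
      forall t, normc (ev (defectL p) t) =
         normc (w p * ch t p - 1) * normc (ev (resL ps) t) &
      m.+1%:R * ssq (defectL p) = 2 * m.+1%:R ^+ size ps].
Proof.
move=> pps PB; have pp := pr pps; have p0 := prime_gt0 pp.
have sub q : q \in rem p ps -> q \in ps by exact: mem_rem.
have [r1 r2 r3 r4 r5] := @resL_facts (rem p ps) (rem_uniq _ ups)
  (fun q h => pr (sub q h)) (fun q h => w1 (sub q h)).
have [s1 _ _ _ _] := resL_facts ups pr w1.
have prem : p \notin rem p ps by rewrite mem_rem_uniq // inE eqxx.
have np n : n \in ns (resL (rem p ps)) -> ~~ (p %| n)%N.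
  by move=> /r3[_ sm]; apply/negP => /(sm _ pp); rewrite (negPf prem).
pose L1 := [:: (- 1 : R[i], 1%N); (w p ^+ m.+1, (p ^ m.+1)%N)].
rewrite /defectL -/L1.
have nsL1 n : n \in ns L1 -> n = 1%N \/ n = (p ^ m.+1)%N.
  by rewrite !inE => /orP[] /eqP; [left|right].
have pos1 : pos_ns L1 by move=> n /nsL1[] -> //; rewrite expn_gt0 p0.
have pos2 : pos_ns (resL (rem p ps)) by move=> n /r3[/andP[]].
have pm1 : (1 < p ^ m.+1)%N by rewrite -{1}(expn0 p) ltn_exp2l ?prime_gt1.
split.
- split.
  + apply: uniq_ns_mulL => //; first by rewrite /= inE andbT ltn_eqF.
    move=> a a' b b' /nsL1 ha /nsL1 ha' /np nb /np nb' e.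
    have := @pow_inj p (if a == 1 then 0 else m.+1)%N (if a' == 1 then 0 else m.+1)%N _ _ pp nb nb'.
    case: ha ha' e => [->|->] [->|->] //; rewrite ?eqxx ?expn0 ?(gtn_eqF pm1) => e /(_ e) //.
  + move=> n /mem_ns_mulL[a [b [aL bL ->]]]; have [/andP[b0 bP] _] := r3 _ bL.
    rewrite muln_gt0 pos1 // b0 /= (leq_trans _ PB) // leq_mul //.
      by case: (nsL1 _ aL) => -> //; exact: ltnW.
    apply: leq_trans bP _; rewrite (perm_big _ (perm_to_rem pps)) big_cons /=.
    by rewrite leq_pmull // expn_gt0 p0.
  + move=> x /mem_mulL[y [z [yL /r4 z1 -> _]]]; rewrite normcM z1 mulr1.
    move: yL; rewrite !inE => /orP[] /eqP ->; last first.
      by rewrite -[(w p ^+ _, _).1]/(w p ^+ m.+1) normcXE w1 // expr1n.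
    by rewrite -[(-1, _).1]/(-1) normcNE normc1E.
- move=> t; rewrite ev_mulL // r1 s1 (perm_big _ (perm_to_rem pps)) big_cons /=.
  rewrite [in RHS]normcM mulrA -normcM geom_telescope normcM; congr (normc _ * _).
  have -> : ev L1 t = - 1 * ch t 1 + w p ^+ m.+1 * ch t (p ^ m.+1)%N.
    by rewrite /ev big_cons big_seq1.
  by rewrite ch1 mulr1 chX // [in RHS]exprMn addrC.
- rewrite ssq_mulL r5 (_ : ssq L1 = 2); last first.
    rewrite /ssq big_cons big_seq1 -[(-1, _).1]/(-1) -[(w p ^+ _, _).1]/(w p ^+ m.+1).
    by rewrite normcNE normc1E normcXE w1 // !expr1n.
  by rewrite size_rem // mulrCA -exprS prednK //; case: (ps) pps.
Qed.

Let testL (c : nat -> R[i]) (qs : seq nat) := mulL [seq (c r, r) | r <- qs] (resL ps).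

(** A prime outside [ps] divides no integer of the resonator, so the products [r * n] are distinct
    and the mean square factors: the large primes behave as if the resonator were absent. *)
Lemma tail_test c qs X : uniq qs -> (forall r, r \in qs -> prime r) ->
  (forall r, r \in qs -> r \notin ps) -> (forall r, r \in qs -> (r <= X)%N) ->
  (forall r, normc (c r) <= 1) -> (X * \prod_(q <- ps) q ^ m <= B)%N ->
  [/\ admissible B (testL c qs),
      forall t, normc (ev (testL c qs) t) =
         normc (\sum_(r <- qs) c r * ch t r) * normc (ev (resL ps) t) &
      ssq (testL c qs) = (\sum_(r <- qs) normc (c r) ^+ 2) * m.+1%:R ^+ size ps].
Proof.
move=> uqs prq dis qX c1 XB.
have [r1 r2 r3 r4 r5] := resL_facts ups pr w1.
have nsq : ns [seq (c r, r) | r <- qs] = qs by rewrite /ns -map_comp map_id.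
have pos1 : pos_ns [seq (c r, r) | r <- qs].
  by move=> n; rewrite nsq => /prq /prime_gt0.
have pos2 : pos_ns (resL ps) by move=> n /r3[/andP[]].
split.
- split.
  + apply: uniq_ns_mulL => //; rewrite nsq // => a a' b b' aq a'q bL b'L e.
    have [pa pa'] := (prq _ aq, prq _ a'q).
    have [_ sm] := r3 _ b'L.
    have : (a %| a' * b')%N by rewrite -e dvdn_mulr.
    rewrite Euclid_dvdM // => /orP[|/(sm _ pa) aps].
      by rewrite dvdn_prime2 // => /eqP.
    by have := dis _ aq; rewrite aps.
  + move=> n /mem_ns_mulL[a [b [aL bL ->]]]; have [/andP[b0 bP] _] := r3 _ bL.
    rewrite muln_gt0 pos1 // b0 /= (leq_trans _ XB) // leq_mul //.
    by apply: qX; rewrite -nsq.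
  + move=> x /mem_mulL[y [z [yL /r4 z1 -> _]]]; rewrite normcM z1 mulr1.
    by case/mapP: yL => r _ ->; exact: c1.
- by move=> t; rewrite ev_mulL // normcM {1}/ev big_map.
- by rewrite ssq_mulL r5 /ssq big_map.
Qed.

End Resonator.

End DirichletPolynomials.

Section Resonance.
Context {R : realType}.

(* The resonator [prod_p sum_(e <= m) (psi p ^* p^(-it))^e] concentrates its
   mass where [p^(-it)] is close to [psi p], while the primes at least [Y] stay
   independent of it. *)
Lemma resonance (I : finType) (Y X m B : nat) (psi : nat -> R[i])
    (c : I -> nat -> R[i]) :
  (1 < Y <= X)%N -> (forall p, (p < Y)%N -> prime p -> normc (psi p) = 1) ->
  (forall i r, normc (c i r) <= 1) ->
  (X * Y ^ m.+1 * \prod_(0 <= q < Y | prime q) q ^ m <= B)%N -> (#|I| <= 3)%N ->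
  exists t : R, [/\ 8 * B%:R ^+ 5 <= t, t <= 16 * B%:R ^+ 5 &
    \sum_(0 <= p < Y | prime p) p%:R^-1 * normc (ch t p - psi p) ^+ 2 +
      \sum_i normc (\sum_(Y <= r < X | prime r) c i r * ch t r) ^+ 2 <=
    4 * (\sum_(0 <= p < Y | prime p) p%:R^-1) / m.+1%:R +
      2 * (\sum_i \sum_(Y <= r < X | prime r) normc (c i r) ^+ 2) + 2 / B%:R].
Proof.
move=> /andP[Y1 YX] psi1 c1 hB I3.
pose ps := [seq p <- iota 0 Y | prime p]; pose qs := [seq r <- index_iota Y X | prime r].
pose w p := (psi p)^*%C.
have sumps (F : nat -> R) : \sum_(0 <= p < Y | prime p) F p = \sum_(p <- ps) F p.
  by rewrite big_filter /index_iota subn0.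
have sumqs (V : nmodType) (F : nat -> V) :
    \sum_(Y <= r < X | prime r) F r = \sum_(r <- qs) F r.
  by rewrite big_filter.
have psP p : p \in ps -> prime p /\ (p < Y)%N.
  by rewrite mem_filter mem_iota add0n => /andP[-> /andP[]].
have qsP r : r \in qs -> prime r /\ (Y <= r < X)%N.
  by rewrite mem_filter mem_index_iota => /andP[-> ->].
have ups : uniq ps by rewrite filter_uniq // iota_uniq.
have uqs : uniq qs by rewrite filter_uniq // iota_uniq.
have pr p : p \in ps -> prime p by case/psP.
have w1 p : p \in ps -> normc (w p) = 1 by case/psP=> pp pY; rewrite normcJE psi1.
have prodps : (\prod_(q <- ps) q ^ m = \prod_(0 <= q < Y | prime q) q ^ m)%N.
  by rewrite big_filter /index_iota subn0.
rewrite -prodps in hB.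
set P := (\prod_(q <- ps) q ^ m)%N in hB.
have P0 : (0 < P)%N.
  by rewrite /P big_seq prodn_cond_gt0 // => q /pr /prime_gt0 q0; rewrite expn_gt0 q0.
have X0 : (0 < X)%N by rewrite (leq_trans _ YX) // ltnW.
have Ym0 : (0 < Y ^ m.+1)%N by rewrite expn_gt0 (ltnW Y1).
have YB : (Y <= B)%N.
  rewrite (leq_trans _ hB) // -mulnA (leq_trans YX) // leq_pmulr // muln_gt0 Ym0 P0 //.
have B0 : 0 < B%:R :> R by rewrite ltr0n (leq_trans _ YB) // ltnW.
pose Wp t := normc (ev (resL w m ps) t) ^+ 2.
(* [J] is [2 B ^ 2] times the error [E] of [mean_square], and [J * step B = 8 B ^ 5]. *)
pose J := (80 * B ^ 6)%N; pose D : R := m.+1%:R ^+ size ps.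
have m0 : 0 < m.+1%:R :> R by rewrite ltr0n.
have D1 : 1 <= D by rewrite exprn_ege1 // ler1n.
pose E : R := 40 * B%:R ^+ 4.
have JE : J%:R = 2 * B%:R ^+ 2 * E :> R by rewrite /J /E natrM natrX; ring.
have E0 : 0 < E by rewrite mulr_gt0 // exprn_gt0.
pose tj j : R := j%:R * step B.
pose S (F : R -> R) : R := \sum_(J <= j < J + J) F (tj j).
have dt p : p \in ps -> S (fun t => normc (ch t p - psi p) ^+ 2 * Wp t) <=
    J%:R * (2 * D / m.+1%:R) + E.
  move=> pps; have [_ pY] := psP _ pps.
  have [|adm evE ssE] := @defect_test R w m ps ups pr w1 B p pps.
    rewrite (leq_trans _ hB) // leq_mul2r; apply/orP; right.
    rewrite (leq_trans _ (leq_pmull _ X0)) // leq_exp2r // ltnW //.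
  have := mean_square J adm; rewrite ler_norml => /andP[_].
  rewrite (_ : \sum_(J <= j < J + J) _ = S (fun t => normc (ch t p - psi p) ^+ 2 * Wp t)).
    rewrite (_ : ssq _ = 2 * D / m.+1%:R); first by rewrite -/E; move: (2 * D / m.+1%:R) => z; lra.
    by rewrite /D -ssE; field; rewrite gt_eqF.
  apply: eq_bigr => j _; rewrite evE exprMn; congr (_ ^+ 2 * _).
  have e : w p * psi p = 1 by rewrite mulrC sqrt_normc_conj psi1 ?pr // expr1n.
  rewrite (_ : w p * _ - 1 = w p * (ch (tj j) p - psi p)); last by rewrite mulrBr e.
  by rewrite normcM w1 // mul1r.
have tt i : S (fun t => normc (\sum_(r <- qs) c i r * ch t r) ^+ 2 * Wp t) <=
    J%:R * ((\sum_(r <- qs) normc (c i r) ^+ 2) * D) + E.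
  have [| | | |adm evE ssE] := @tail_test R w m ps ups pr w1 B (c i) qs X uqs _ _ _ (c1 i).
  - by move=> r /qsP[].
  - move=> r /qsP[_ /andP[Yr _]]; apply/negP => /psP[_]; by rewrite ltnNge Yr.
  - by move=> r /qsP[_ /andP[_ /ltnW]].
  - by rewrite (leq_trans _ hB) // leq_mul2r leq_pmulr ?orbT.
  have := mean_square J adm; rewrite ler_norml => /andP[_].
  rewrite ssE -/D -/E (_ : \sum_(J <= j < J + J) _ =
     S (fun t => normc (\sum_(r <- qs) c i r * ch t r) ^+ 2 * Wp t)).
    by move: (_ * D) => z; lra.
  by apply: eq_bigr => j _; rewrite evE exprMn.
have Wlow : J%:R * D - E <= S Wp.
  have [_ r2 r3 r4 r5] := @resL_facts R w m ps ups pr w1.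
  have adm : admissible B (resL w m ps).
    split=> [//|n /r3[/andP[n0 nP] _]|x /r4 -> //].
    rewrite n0 (leq_trans nP) // (leq_trans _ hB) // leq_pmull // muln_gt0 X0 //.
  have := mean_square J adm; rewrite r5 ler_norml => /andP[+ _].
  by rewrite /E /S /Wp /D; lra.
(* [V] is averaged against the density [Wp]. Its mean is about [2 H / (m + 1) + C] at most; the
   value [v] below is twice that, plus [2 / B] to absorb the errors, so some sampling point does not
   exceed it. *)
pose V t := \sum_(p <- ps) p%:R^-1 * normc (ch t p - psi p) ^+ 2 +
   \sum_i normc (\sum_(r <- qs) c i r * ch t r) ^+ 2.
pose H : R := \sum_(p <- ps) p%:R^-1.
pose C : R := \sum_i \sum_(r <- qs) normc (c i r) ^+ 2.
have Wp0 t : 0 <= Wp t by rewrite exprn_ge0 // normc_ge0.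
have HY : H <= Y%:R.
  rewrite /H -sumps; apply: (@le_trans _ _ (\sum_(0 <= p < Y) 1)).
    rewrite big_mkcond; apply: ler_sum => p _; case: ifP => // pp.
    by rewrite invf_le1 ?ltr0n ?prime_gt0 // ler1n prime_gt0.
  by rewrite sumr_const_nat subn0.
have SV : S (fun t => V t * Wp t) <=
    J%:R * D * (2 * H / m.+1%:R + C) + (Y%:R + 3) * E.
  have -> : S (fun t => V t * Wp t) =
      \sum_(p <- ps) p%:R^-1 * S (fun t => normc (ch t p - psi p) ^+ 2 * Wp t) +
      \sum_i S (fun t => normc (\sum_(r <- qs) c i r * ch t r) ^+ 2 * Wp t).
    rewrite /S /V (eq_bigr (fun j => \sum_(p <- ps) p%:R^-1 *
        (normc (ch (tj j) p - psi p) ^+ 2 * Wp (tj j)) +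
       \sum_i normc (\sum_(r <- qs) c i r * ch (tj j) r) ^+ 2 * Wp (tj j))); last first.
      move=> j _; rewrite mulrDl !mulr_suml; congr (_ + _).
      by apply: eq_bigr => p _; exact/esym/mulrA.
    rewrite big_split /=; congr (_ + _); rewrite exchange_big //=.
    by apply: eq_bigr => p _; rewrite mulr_sumr.
  have h1 : \sum_(p <- ps) p%:R^-1 * S (fun t => normc (ch t p - psi p) ^+ 2 * Wp t) <=
      H * (J%:R * (2 * D / m.+1%:R) + E).
    rewrite /H mulr_suml big_seq [X in _ <= X]big_seq; apply: ler_sum => p pps.
    by rewrite ler_wpM2l ?invr_ge0 // dt.
  have h2 : \sum_i S (fun t => normc (\sum_(r <- qs) c i r * ch t r) ^+ 2 * Wp t) <=
      J%:R * (C * D) + 3 * E.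
    rewrite (le_trans (ler_sum _ (fun i _ => tt i))) // big_split /= -mulr_sumr -mulr_suml.
    rewrite lerD2l sumr_const -[leLHS]mulr_natl.
    have I3' : #|I|%:R <= 3 :> R by rewrite (ler_nat R _ 3).
    exact: (ler_wpM2r (ltW E0) I3').
  have h3 : H * E <= Y%:R * E by rewrite ler_wpM2r // mulr_ge0 // exprn_ge0 // ltW.
  move: h1 h2 h3; rewrite mulrDr; move: (m.+1%:R^-1) => im; lra.
pose v : R := 4 * H / m.+1%:R + 2 * C + 2 / B%:R.
have [j jJ Vj] : exists2 j, (J <= j < J + J)%N & V (tj j) <= v.
  apply: contrapT => no.
  have : v * S Wp <= S (fun t => V t * Wp t).
    rewrite /S mulr_sumr; apply: ler_sum_nat => j jJ.
    rewrite ler_wpM2r //; have [//|/ltW Vv] := leP v (V (tj j)).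
    by case: no; exists j.
  have H0 : 0 <= H by rewrite sumr_ge0 // => p _; rewrite invr_ge0.
  have C0 : 0 <= C by rewrite sumr_ge0 // => i _; rewrite sumr_ge0 // => r _; rewrite exprn_ge0 ?normc_ge0.
  pose g : R := 2 * H / m.+1%:R + C.
  have g0 : 0 <= g by rewrite addr_ge0 // divr_ge0 ?mulr_ge0 // ltW.
  have vE : v = 2 * g + 2 / B%:R by rewrite /v /g; move: (m.+1%:R^-1) => im; lra.
  have iB : 0 < 2 / B%:R :> R by rewrite divr_gt0.
  have v0 : 0 < v by rewrite vE; lra.
  have JD : J%:R * D >= 2 * B%:R ^+ 2 * E * D by rewrite JE.
  have l1 : J%:R * D / 2 <= S Wp.
    apply: le_trans Wlow; rewrite JE.
    have B2 : 1 <= B%:R ^+ 2 :> R by rewrite exprn_ege1 // ler1n -(@ltr0n R).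
    have : 1 <= B%:R ^+ 2 * D by rewrite mulr_ege1.
    have := E0; rewrite -[1 <= _](ler_pM2r E0); lra.
  move=> h; have {h} := le_trans h SV; rewrite -/g.
  have l2 : v * (J%:R * D / 2) <= v * S Wp by rewrite ler_pM2l.
  move=> l3; have {l2 l3} := le_trans l2 l3.
  have -> : v * (J%:R * D / 2) = J%:R * D * g + J%:R * D / B%:R.
    by rewrite vE; field; rewrite gt_eqF.
  rewrite lerD2l JE => l4.
  have : 2 * B%:R * E * D <= (Y%:R + 3) * E.
    apply: le_trans l4; rewrite le_eqVlt; apply/orP; left; apply/eqP; field.
    by rewrite gt_eqF.
  have l5 : 2 * B%:R * E <= 2 * B%:R * E * D.
    by rewrite ler_peMr // mulr_ge0 ?mulr_ge0 // ltW.
  move=> l6; have {l5 l6} := le_trans l5 l6; rewrite ler_pM2r // leNgt => /negP; apply.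
  have : (Y + 3 < 2 * B)%N.
    have : (X * Y ^ m.+1 * P >= Y * Y)%N.
      rewrite -[(Y * Y)%N]muln1 !leq_mul // -{1}(expn1 Y) leq_pexp2l //; exact: ltnW.
    move=> /leq_trans /(_ hB) /(leq_trans (leq_mul (leqnn Y) Y1)).
    by clear -Y1; lia.
  by rewrite -(ltr_nat R) natrM natrD.
exists (tj j).
have st : step B * (10 * B%:R) = 1 :> R.
  by rewrite mulVf // gt_eqF // mulr_gt0.
have st0 : 0 < step B :> R by rewrite invr_gt0 mulr_gt0.
have Jst : J%:R * step B = 8 * B%:R ^+ 5 :> R.
  rewrite JE /E (_ : _ * step B = 8 * B%:R ^+ 5 * (step B * (10 * B%:R))); last by ring.
  by rewrite st mulr1.
case/andP: jJ => j1 j2; split.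
- by rewrite -Jst ler_wpM2r ?(ltW st0) // ler_nat.
- have : tj j <= (J + J)%:R * step B by rewrite ler_wpM2r ?(ltW st0) // ler_nat ltnW.
  rewrite natrD mulrDl Jst; lra.
- rewrite !sumps (eq_bigr (fun i => normc (\sum_(r <- qs) c i r * ch (tj j) r) ^+ 2)).
    rewrite [X in _ <= _ + 2 * X + _](_ : _ = C) //.
    by apply: eq_bigr => i _; rewrite sumqs.
  by move=> i _; rewrite sumqs.
Qed.

End Resonance.

(** * Critical points as zeros of the logarithmic derivative *)

Section DirichletSeries.
Context {R : realType}.
Implicit Types (s z h d : R[i]) (c : nat -> R[i]) (b : nat -> R) (B e : R).

Lemma dseries_cvg c b B : (forall n, (0 < n)%N -> normc (c n) <= b n) ->
  (forall Z, \sum_(1 <= n < Z) b n <= B) ->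
  exists l, tends (fun Z => \sum_(1 <= n < Z.+1) c n) l.
Proof.
move=> cb bB; have [|n|l ul] := @tends_series R (fun k => c k.+1) (fun k => b k.+1) B.
- by move=> n; exact: cb.
- by have := bB n.+1; rewrite big_add1.
- exists l; apply: tends_eq ul; exists 0%N => n _.
  by rewrite [RHS]big_add1.
Qed.

Lemma dirichlet_series_tends c b B s :
  (forall n, (0 < n)%N -> normc (c n) * pw n (ReC s) <= b n) ->
  (forall Z, \sum_(1 <= n < Z) b n <= B) ->
  tends (fun Z => \sum_(1 <= n < Z.+1) c n * natpowc n (- s)) (dirichlet_series c s).
Proof.
move=> cb bB; have [|l ul] := @dseries_cvg (fun n => c n * natpowc n (- s)) b B _ bB.
  by move=> n n0; rewrite normcM normc_natpowc cb.
by rewrite /dirichlet_series (tends_limn ul).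
Qed.

(** Newton's iteration with the slope frozen at [d]. By the Lipschitz hypothesis each step halves
    the bound on [|f|], so the steps are dominated by [r / 2], [r / 4], ... and the iterates stay in
    the ball of radius [r]. *)
Lemma newton_zero (f : R[i] -> R[i]) s0 d (r : R) : d != 0 -> 0 < r ->
  (forall s s', normc (s - s0) <= r -> normc (s' - s0) <= r ->
     normc (f s - f s' - d * (s - s')) <= normc d / 2 * normc (s - s')) ->
  normc (f s0) <= normc d * r / 2 ->
  exists2 s, normc (s - s0) <= r & f s = 0.
Proof.
move=> d0 r0 lip f0; have nd : 0 < normc d by rewrite normc_gt0.
pose S := fix S k := if k is k'.+1 then S k' - f (S k') / d else s0.
pose g k : R := (1 / 2) ^+ k.
have g0 k : 0 < g k by rewrite exprn_gt0 // divr_gt0.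
have gS k : g k.+1 = g k / 2 by rewrite /g exprS; lra.
have step k : normc (S k.+1 - S k) = normc (f (S k)) / normc d.
  by rewrite /= addrC addKr normcNE normcM normcVE.
have inv k : normc (S k - s0) <= r * (1 - g k) /\ normc (f (S k)) <= normc d * r / 2 * g k.
  elim: k => [|k [IH1 IH2]].
    by rewrite /= subrr normc0E /g expr0 subrr mulr0 mulr1.
  have sk : normc (S k.+1 - S k) <= r / 2 * g k.
    by rewrite step ler_pdivrMr //; move: IH2; rewrite -!mulrA (mulrC (normc d)) !mulrA.
  have h1 : normc (S k.+1 - s0) <= r * (1 - g k.+1).
    rewrite (_ : S k.+1 - s0 = (S k.+1 - S k) + (S k - s0)); last by ring.
    rewrite (le_trans (normcD _ _)) // gS; move: sk IH1; nra.
  split=> //.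
  have rle x : 0 < x -> r * (1 - x) <= r by move=> x0; nra.
  have := lip _ _ (le_trans h1 (rle _ (g0 _))) (le_trans IH1 (rle _ (g0 _))).
  have -> : f (S k.+1) - f (S k) - d * (S k.+1 - S k) = f (S k.+1).
    rewrite /= [S k - _ - S k]addrC addKr mulrN mulrCA divff // mulr1; ring.
  move=> /le_trans; apply; rewrite gS.
  have := ler_wpM2l (ltW nd) sk; lra.
have gsum n : \sum_(0 <= k < n) r / 2 * g k <= r.
  rewrite -mulr_sumr; suff -> : \sum_(0 <= k < n) g k = 2 * (1 - g n).
    by have := g0 n; nra.
  elim: n => [|n IH]; first by rewrite big_nil /g expr0; lra.
  by rewrite big_nat_recr // IH gS /=; lra.
have [|l ul] := @tends_series R (fun k => S k.+1 - S k) (fun k => r / 2 * g k) r _ gsum.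
  move=> k; rewrite step ler_pdivrMr //; have [_] := inv k; lra.
pose s := s0 + l.
have us : tends S s.
  apply: tends_eq (tendsD (tends_cst s0) ul); exists 0%N => n _.
  by rewrite telescope_sumr // addrCA subrr addr0.
have sr : normc (s - s0) <= r.
  apply: (tends_dist_le us); exists 0%N => n _; have [h _] := inv n.
  by apply: le_trans h _; have := g0 n; nra.
exists s => //; apply/eqP; rewrite -normc_eq0 eq_le normc_ge0 andbT.
apply/ler_addgt0Pr => e e0; rewrite add0r.
have e1 : 0 < e / (4 * normc d) by rewrite divr_gt0 // mulr_gt0.
have [N hN] := us _ e1.
have := hN N (leqnn _); have := hN N.+1 (leqnSn _).
move=> a1 a2; have [b1 b2] := inv N.
have snr : normc (S N - s0) <= r by apply: le_trans b1 _; have := g0 N; nra.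
have := lip _ _ sr snr.
have h3 : normc (f (S N)) = normc d * normc (S N.+1 - S N).
  by rewrite step mulrCA divff ?mulr1 // gt_eqF.
have h4 : normc (S N.+1 - S N) <= normc (S N.+1 - s) + normc (S N - s).
  by rewrite (_ : _ - _ = (S N.+1 - s) - (S N - s)) ?normcB //; ring.
have h5 : normc (f s) <= normc (f s - f (S N) - d * (s - S N)) + normc (f (S N)) +
    normc d * normc (s - S N).
  rewrite -normcM {1}(_ : f s = (f s - f (S N) - d * (s - S N)) + f (S N) + d * (s - S N)).
    by rewrite (le_trans (normcD _ _)) // lerD2r normcD.
  by ring.
rewrite h3 [normc (s - _)]normcBC in h5 *; move=> h6.
have q1 : normc d * normc (S N.+1 - s) < e / 4.
  by move: a1; rewrite ltr_pdivlMr ?mulr_gt0 //; lra.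
have q2 : normc d * normc (S N - s) < e / 4.
  by move: a2; rewrite ltr_pdivlMr ?mulr_gt0 //; lra.
have := ler_wpM2l (ltW nd) h4; lra.
Qed.

Lemma is_derive_quadratic (f : R[i]^o -> R[i]^o) s d (C r : R) : 0 < r -> 0 <= C ->
  (forall h, normc h <= r -> normc (f (s + h) - f s - h * d) <= C * normc h ^+ 2) ->
  is_derive (s : R[i]^o) (1 : R[i]^o) f d.
Proof.
move=> r0 C0 fq.
have cv : h^-1 *: ((f \o shift (s : R[i]^o)) (h *: (1 : R[i]^o)) - f s)
    @[h --> (0 : R[i]^o)^'] --> (d : R[i]^o).
  apply/cvgrPdist_lt => e e0.
  have eR : e = (ReC e)%:C.
    by apply: complex_eqP => //=; move: e0; rewrite ltcE => /andP[/eqP ->].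
  have e1 : 0 < ReC e by move: e0; rewrite ltcE => /andP[].
  pose m := Num.min r (ReC e / (C + 1)).
  have m0 : 0 < m by rewrite lt_min r0 divr_gt0 //; lra.
  have mC : 0 < (m%:C : R[i]) by rewrite ltc_real.
  have F1 := @nbhs_dnbhs_neq (R[i]^o) 0.
  have F2 := @dnbhs0_lt _ (R[i]^o) _ mC.
  move: F1 F2; apply: filterS2 => h h0; rewrite normcE_norm ltc_real => hm.
  rewrite normcE_norm eR ltc_real.
  have nh : 0 < normc h by rewrite normc_gt0.
  rewrite normcBC -(ltr_pM2l nh) -normcM.
  have -> : h * (h^-1 *: ((f \o shift (s : R[i]^o)) (h *: (1 : R[i]^o)) - f s) - d) =
      f (s + h) - f s - h * d.
    rewrite /= mulrBr /shift /= [h *: 1]mulr1 [h + s]addrC.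
    by rewrite [_ *: _]/(_ * _) mulrA divff // mul1r.
  apply: le_lt_trans (fq h _) _; first by rewrite ltW // (lt_le_trans hm) // ge_min lexx.
  rewrite expr2 mulrCA ltr_pM2l //.
  have : normc h < ReC e / (C + 1) by rewrite (lt_le_trans hm) // ge_min lexx orbT.
  rewrite ltr_pdivlMr; nra.
have dv : derivable f (s : R[i]^o) 1 by apply/cvg_ex; exists d.
apply: DeriveDef; first exact: dv.
exact: (cvg_lim (@norm_hausdorff _ (R[i]^o)) cv).
Qed.

End DirichletSeries.

(** * The derivative of zeta as a Dirichlet series *)

Section ZetaDerivative.
Context {R : realType}.
Implicit Types (s h : R[i]) (d : R).

Lemma natpowc_neg n h : natpowc n (- h) = cexp (- h * (ln (n%:R : R))%:C).
Proof. by []. Qed.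

Lemma normc_hln n h : normc (- h * (ln (n%:R : R))%:C) = normc h * ln n%:R.
Proof. by rewrite normcM normcNE normc_real ger0_norm // ln_nat_ge0. Qed.

Lemma expR_hln n h x : pw n x * expR (normc h * ln n%:R) = pw n (x - normc h).
Proof. by rewrite /pw -expRD; congr expR; ring. Qed.

(** The factor [expR (|h| ln n)] of the remainder is absorbed by moving the abscissa from [Re s] to
    [Re s - |h|]; likewise in [natpowc_diff2]. *)
Lemma natpowc_diff1 n s h :
  normc (natpowc n (- (s + h)) - natpowc n (- s)) <=
    3 * normc h * ln n%:R * pw n (ReC s - normc h).
Proof.
rewrite opprD natpowcD -{2}[natpowc n (- s)]mulr1 -mulrBr normcM normc_natpowc.
rewrite -expR_hln natpowc_neg -normc_hln mulrCA ler_wpM2l ?pw_ge0 //.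
by rewrite -[X in _ <= X * _]mulrA -normc_hln cexpB1_le.
Qed.

Lemma natpowc_diff2 n s h :
  normc (natpowc n (- (s + h)) - natpowc n (- s) + (ln n%:R)%:C * h * natpowc n (- s)) <=
    4 * ln n%:R ^+ 2 * normc h ^+ 2 * pw n (ReC s - normc h).
Proof.
rewrite opprD natpowcD.
rewrite (_ : _ + _ = natpowc n (- s) * (natpowc n (- h) - 1 - - h * (ln n%:R)%:C)); last by ring.
rewrite normcM normc_natpowc -expR_hln natpowc_neg -normc_hln mulrCA ler_wpM2l ?pw_ge0 //.
rewrite (le_trans (cexpB1Bz_le _)) // ler_wpM2r ?expR_ge0 // normc_hln.
by rewrite le_eqVlt; apply/orP; left; apply/eqP; ring.
Qed.

Lemma sum_ln2_pw d Z : 0 < d ->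
  \sum_(1 <= n < Z) ln n%:R ^+ 2 * pw n (1 + d) <= (4 / d) ^+ 2 * (1 + 2 / d).
Proof.
move=> d0; have d2 : 0 < d / 2 by lra.
have := @sum_pw_le R Z _ d2; rewrite invfM invrK (mulrC _ 2) => h.
have c0 : 0 <= (4 / d) ^+ 2 by rewrite exprn_ge0 // divr_ge0 // ltW.
apply: le_trans (ler_wpM2l c0 h); rewrite mulr_sumr; apply: ler_sum => n _.
rewrite (_ : 1 + d = 2%:R * (d / 4) + (1 + d / 2)); last by lra.
rewrite pwD mulrA ler_wpM2r ?pw_ge0 //.
have d4 : 0 < d / 4 by lra.
by apply: le_trans (ln_pw_le_exp n 2 d4) _; rewrite invf_div.
Qed.

Lemma zeta_tends s : 1 < ReC s ->
  tends (fun Z => \sum_(1 <= n < Z.+1) natpowc n (- s)) (zeta s).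
Proof.
move=> s1; have d0 : 0 < ReC s - 1 by lra.
have t := @dirichlet_series_tends R (fun=> 1) (fun n => pw n (ReC s)) (1 + (ReC s - 1)^-1) s.
apply: tends_eq (t _ _).
- by exists 0%N => Z _; apply: eq_bigr => n _; rewrite mul1r.
- by move=> n _; rewrite (_ : normc 1 = 1) ?mul1r //; exact: normc1E.
- by move=> Z; have := @sum_pw_le R Z _ d0; rewrite subrKC.
Qed.

Lemma zeta1_tends s : 1 < ReC s ->
  tends (fun Z => \sum_(1 <= n < Z.+1) (ln n%:R)%:C * natpowc n (- s))
    (dirichlet_series (fun n => (ln (n%:R : R))%:C) s).
Proof.
move=> s1; have d0 : 0 < ReC s - 1 by lra.
apply: (@dirichlet_series_tends R _ (fun n => pw n (ReC s) + ln n%:R ^+ 2 * pw n (ReC s))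
  ((1 + (ReC s - 1)^-1) + (4 / (ReC s - 1)) ^+ 2 * (1 + 2 / (ReC s - 1)))).
- move=> n _; rewrite normc_real ger0_norm ?ln_nat_ge0 //.
  rewrite -[X in X + _]mul1r -mulrDl ler_wpM2r ?pw_ge0 //.
  have := sqr_ge0 (ln n%:R - 1 / 2 : R); lra.
- move=> Z; have := @sum_pw_le R Z _ d0; have := @sum_ln2_pw _ Z d0.
  by rewrite subrKC big_split /=; lra.
Qed.

Lemma is_derive_zeta s : 1 < ReC s ->
  is_derive (s : R[i]^o) (1 : R[i]^o) (@zeta R)
    (- dirichlet_series (fun n => (ln (n%:R : R))%:C) s).
Proof.
move=> s1; pose d := ReC s - 1; have d0 : 0 < d by rewrite /d; lra.
have d2 : 0 < d / 2 by lra.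
pose C := 4 * ((4 / (d / 2)) ^+ 2 * (1 + 2 / (d / 2))).
have C0 : 0 <= C.
  rewrite /C; have : 0 <= 2 / (d / 2) by rewrite divr_ge0 // ltW.
  move=> i0; apply: mulr_ge0 => //; apply: mulr_ge0; first exact: sqr_ge0.
  by rewrite addr_ge0.
apply: (is_derive_quadratic d2 C0) => h hd.
have s1' : 1 < ReC (s + h).
  by have := normc_re h; rewrite ler_norml ReD => /andP[]; rewrite /d in hd *; lra.
have t := tendsD (tendsD (zeta_tends s1') (tendsMl (-1) (zeta_tends s1)))
   (tendsMl h (zeta1_tends s1)).
rewrite (_ : _ - _ - _ = zeta (s + h) + -1 * zeta s +
   h * dirichlet_series (fun n => (ln n%:R)%:C) s); last by ring.
apply: (tends_le t); exists 0%N => Z _.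
rewrite !mulr_sumr -!big_split /= (le_trans (normc_sum _ _ _)) //.
have hh := @sum_ln2_pw _ Z.+1 d2.
have h2 : 0 <= 4 * normc h ^+ 2 by rewrite mulr_ge0 // exprn_ge0 // normc_ge0.
have := ler_wpM2l h2 hh; rewrite /C -[4 * _ * _]mulrA [_ * normc h ^+ 2 in X in _ -> X]mulrC.
rewrite [4 * (_ * _)]mulrA [normc h ^+ 2 * _]mulrA [normc h ^+ 2 * 4]mulrC.
apply: le_trans; rewrite mulr_sumr; apply: ler_sum_nat => n _.
rewrite (_ : _ + _ + _ = natpowc n (- (s + h)) - natpowc n (- s) +
   (ln n%:R)%:C * h * natpowc n (- s)); last by ring.
apply: le_trans (natpowc_diff2 n s h) _.
rewrite (_ : 4 * normc h ^+ 2 * (_ * _) = 4 * ln n%:R ^+ 2 * normc h ^+ 2 * pw n (1 + d / 2)); last by ring.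
rewrite ler_wpM2l ?mulr_ge0 ?exprn_ge0 ?normc_ge0 ?ln_nat_ge0 // pw_le //.
by rewrite /d in hd *; lra.
Qed.

Definition vonM_series s := dirichlet_series (fun n => (vonM n : R)%:C) s.

Lemma vonM_series_tends s : 1 < ReC s <= 2 ->
  tends (fun Z => \sum_(1 <= n < Z.+1) (vonM n)%:C * natpowc n (- s)) (vonM_series s).
Proof.
move=> /andP[s1 s2]; have d0 : 0 < ReC s - 1 <= 1 by lra.
apply: (@dirichlet_series_tends R _ (fun n => vonM n * pw n (ReC s)) (7 / (ReC s - 1))).
- by move=> n _; rewrite normc_real ger0_norm // vonM_ge0.
- by move=> Z; have := @sum_vonM_pw R Z _ d0; rewrite subrKC.
Qed.

Lemma zeta_tail s m : 1 < ReC s -> (0 < m)%N ->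
  normc (\sum_(1 <= n < m.+1) natpowc n (- s) - zeta s) <=
    pw m (ReC s - 1) / (ReC s - 1).
Proof.
move=> s1 m0; rewrite normcBC; apply: (tends_dist_le (zeta_tends s1)); exists m => Z mZ.
rewrite (@big_cat_nat _ _ _ m.+1) //= [_ + _ - _]addrC addKr (le_trans (normc_sum _ _ _)) //.
have d0 : 0 < ReC s - 1 by lra.
have := @sum_pw_tail R m.+1 Z.+1 _ d0; rewrite ltnS m0 subrKC => /(_ isT).
by apply: le_trans; apply: ler_sum => n _; rewrite normc_natpowc.
Qed.

(** The partial sums of [ln n * n ^ (- s)] are [sum_n vonM n * n ^ (- s) * S (Z %/ n)]; replacing
    [S (Z %/ n)] by [zeta s] leaves [zeta s] times the partial sums of [vonM_series], which tend to
    0. The error is controlled by [zeta_tail]: half of the exponent [d] keeps the sum over [n]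
    convergent, the other half gives the decay [Z ^ (- d / 2)]. *)
Lemma vonM_series_zero s : 1 < ReC s <= 2 -> vonM_series s = 0 ->
  is_derive (s : R[i]^o) (1 : R[i]^o) (@zeta R) 0.
Proof.
move=> s12 F0; have /andP[s1 s2] := s12.
suff z1 : dirichlet_series (fun n => (ln (n%:R : R))%:C) s = 0.
  by have := is_derive_zeta s1; rewrite z1 oppr0.
pose d := ReC s - 1; have d0 : 0 < d by rewrite /d; lra.
have d2 : 0 < d / 2 <= 1 by rewrite /d; lra.
have d2' : 0 < d / 2 by case/andP: d2.
pose f n := natpowc n (- s).
pose S m := \sum_(1 <= n < m.+1) f n.
have fM m n : (0 < m)%N -> (0 < n)%N -> f (m * n)%N = f m * f n by exact: natpowcM.
apply: tends_unique (zeta1_tends s1) _.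
have := tendsMl (zeta s) (vonM_series_tends s12); rewrite F0 mulr0.
pose C : R := (d * pw 2 (d / 2))^-1 * (7 / (d / 2)).
have C0 : 0 <= C.
  rewrite /C mulr_ge0 // ?invr_ge0 ?mulr_ge0 ?pw_ge0 ?(ltW d0) //.
  by rewrite invr_ge0 ltW.
apply: (@tends_close R _ _ _ (fun Z => C * pw Z (d / 2))); last first.
  move=> e e0; have C1 : 0 < C + 1 by lra.
  have [N hN] := pw_small d2' (divr_gt0 e0 C1); exists N => n /hN.
  rewrite ltr_pdivlMr // => h; have := pw_gt0 n (d / 2); nra.
move=> Z; rewrite mulr_sumr.
under [X in _ - X]eq_bigr do rewrite mulrC.
rewrite (@sum_ln_convol R _ (@real_complex R) f Z fM).
rewrite -sumrB (le_trans (normc_sum _ _ _)) //.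
apply: (@le_trans _ _ (\sum_(1 <= n < Z.+1)
   (vonM n * pw n (1 + d / 2)) * ((d * pw 2 (d / 2))^-1 * pw Z (d / 2)))); last first.
  rewrite -mulr_suml /C [X in _ <= X]mulrAC [X in X <= _]mulrC ler_wpM2l //.
    by rewrite mulr_ge0 ?pw_ge0 // invr_ge0 mulr_ge0 ?pw_ge0 // ltW.
  exact: sum_vonM_pw.
apply: ler_sum_nat => n /andP[n0 nZ].
rewrite -/(f n) (_ : _ - _ = - (f n * (vonM n)%:C * (S (Z %/ n)%N - zeta s))); last by rewrite /S; ring.
rewrite normcNE normcM [normc (f n * _)]normcM normc_natpowc normc_real ger0_norm ?vonM_ge0 //.
have m0 : (0 < Z %/ n)%N by rewrite divn_gt0.
have := zeta_tail s1 m0; rewrite -/f -/(S _) -/d => h.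
apply: le_trans (ler_wpM2l _ h) _; first by rewrite mulr_ge0 ?pw_ge0 ?vonM_ge0.
rewrite (_ : ReC s = (1 + d / 2) + d / 2); last by rewrite /d; lra.
have h1 : pw (Z %/ n) d <= pw (Z %/ n) (d / 2) by apply: pw_le; lra.
(* [Z <= 2 n (Z %/ n)] because [n <= Z]; this is the origin of the factor [pw 2 (d / 2)] in [C]. *)
have h2 : pw (Z %/ n) (d / 2) * (pw 2 (d / 2) * pw n (d / 2)) <= pw Z (d / 2).
  rewrite -!pwM ?muln_gt0 // ?m0 //; apply: pw_mono; first exact: ltW.
  rewrite (leq_trans n0 nZ) /=.
  have := divn_eq Z n; have := ltn_pmod Z n0.
  move: m0; set m := (Z %/ n)%N; set r := (Z %% n)%N => m0 rn ->.
  rewrite (leq_trans (n := (m * n + m * n)%N)) //.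
    by rewrite leq_add2l (leq_trans (ltnW rn)) // leq_pmull.
  by rewrite mulnCA mul2n -addnn.
have p2 := pw_gt0 2 (d / 2); rewrite pwD.
rewrite [X in X <= _](_ : _ = vonM n * pw n (1 + d / 2) * (pw n (d / 2) * (pw (Z %/ n) d / d))); last by ring.
rewrite ler_wpM2l ?mulr_ge0 ?pw_ge0 ?vonM_ge0 //.
rewrite mulrC ler_pdivlMl ?mulr_gt0 //.
rewrite [X in X <= _](_ : _ = pw 2 (d / 2) * pw n (d / 2) * pw (Z %/ n) d); last by field; rewrite gt_eqF.
by apply: le_trans h2; rewrite mulrC ler_wpM2r // mulr_ge0 ?pw_ge0.
Qed.

End ZetaDerivative.

(** * Linearization of the logarithmic derivative and its zeros *)

Section LogDerivativeZero.
Context {R : realType}.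
Implicit Types (s h : R[i]) (d r : R).

Definition vonM_ln_series s := dirichlet_series (fun n => (vonM n * ln n%:R : R)%:C) s.

Lemma vonM_ln_series_tends s : 1 < ReC s <= 2 ->
  tends (fun Z => \sum_(1 <= n < Z.+1) (vonM n * ln n%:R)%:C * natpowc n (- s))
    (vonM_ln_series s).
Proof.
move=> /andP[s1 s2]; have d0 : 0 < ReC s - 1 <= 1 by lra.
apply: (@dirichlet_series_tends R _ (fun n => vonM n * ln n%:R ^+ 1 * pw n (ReC s))
  (14 / (ReC s - 1) * (2 * 1%:R / (ReC s - 1)) ^+ 1)).
- by move=> n _; rewrite normc_real ger0_norm ?expr1 // mulr_ge0 ?vonM_ge0 ?ln_nat_ge0.
- by move=> Z; have := @sum_vonM_lnk_pw R Z 1 _ d0 isT; rewrite subrKC.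
Qed.

(** As [s] and [s'] are at most [2 r] apart and [s'] at most [r] from [s0], [3 r <= d / 2] keeps all
    abscissas above [1 + d / 2]. [11 = 8 + 3]: the second order error at [s'], and the transfer of
    the slope from [s'] to [s0]. *)
Lemma natpowc_lin n s0 s s' d r : ReC s0 = 1 + d -> 3 * r <= d / 2 ->
  normc (s - s0) <= r -> normc (s' - s0) <= r ->
  normc (natpowc n (- s) - natpowc n (- s') + (ln n%:R)%:C * (s - s') * natpowc n (- s0)) <=
    11 * r * normc (s - s') * (ln n%:R ^+ 2 * pw n (1 + d / 2)).
Proof.
move=> s0d rd sr s'r; pose h := s - s'; pose k := s' - s0.
have r0 : 0 <= r by apply: le_trans sr; exact: normc_ge0.
have hr : normc h <= 2 * r.
  by rewrite /h (_ : _ - _ = (s - s0) - (s' - s0)) ?(le_trans (normcB _ _)) //; [lra|ring].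
have sE : s = s' + h by rewrite /h; ring.
have s'E : s' = s0 + k by rewrite /k; ring.
have a1 := natpowc_diff2 n s' h; have a2 := natpowc_diff1 n s0 k.
rewrite -sE in a1; rewrite -s'E in a2.
have L0 := @ln_nat_ge0 R n; have h0 := normc_ge0 h; have p0 := pw_ge0 n (1 + d / 2).
have b1 : pw n (ReC s' - normc h) <= pw n (1 + d / 2).
  have e : ReC s' = 1 + d + ReC k by rewrite s'E ReD s0d.
  apply: pw_le; rewrite e; have := normc_re k; rewrite ler_norml => /andP[+ _].
  by move: s'r hr; rewrite -/k; lra.
have b2 : pw n (ReC s0 - normc k) <= pw n (1 + d / 2).
  by apply: pw_le; rewrite s0d /k; lra.
rewrite (_ : _ + _ = (natpowc n (- s) - natpowc n (- s') +
   (ln n%:R)%:C * h * natpowc n (- s')) -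
   (ln n%:R)%:C * h * (natpowc n (- s') - natpowc n (- s0))); last by rewrite /h; ring.
rewrite (le_trans (normcB _ _)) //.
have c1 : 4 * ln n%:R ^+ 2 * normc h ^+ 2 * pw n (ReC s' - normc h) <=
    8 * r * normc h * (ln n%:R ^+ 2 * pw n (1 + d / 2)).
  rewrite (_ : 8 * r * _ * _ = 4 * ln n%:R ^+ 2 * (normc h * (2 * r)) * pw n (1 + d / 2)); last by ring.
  rewrite ler_pM ?mulr_ge0 ?exprn_ge0 ?pw_ge0 // ler_wpM2l ?mulr_ge0 ?exprn_ge0 //.
  by rewrite expr2 ler_wpM2l.
have c2 : normc ((ln n%:R)%:C * h * (natpowc n (- s') - natpowc n (- s0))) <=
    3 * r * normc h * (ln n%:R ^+ 2 * pw n (1 + d / 2)).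
  rewrite 2!normcM normc_real ger0_norm //.
  apply: le_trans (ler_wpM2l _ a2) _; first by rewrite mulr_ge0.
  rewrite [X in X <= _](_ : _ = 3 * normc k * normc h * (ln n%:R ^+ 2 * pw n (ReC s0 - normc k))); last by ring.
  rewrite ler_pM ?mulr_ge0 ?exprn_ge0 ?pw_ge0 ?normc_ge0 //.
    by rewrite ler_wpM2r // ler_wpM2l.
  by rewrite ler_wpM2l ?exprn_ge0.
move: a1 c1 c2; rewrite -/h; lra.
Qed.

Lemma vonM_series_lin s0 s s' d r : ReC s0 = 1 + d -> 0 < d <= 1 / 2 -> 3 * r <= d / 2 ->
  normc (s - s0) <= r -> normc (s' - s0) <= r ->
  normc (vonM_series s - vonM_series s' + vonM_ln_series s0 * (s - s')) <=
    11 * r * normc (s - s') * (1792 / d ^+ 3).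
Proof.
move=> s0d /andP[d0 d1] rd sr s'r.
have r0 : 0 <= r by apply: le_trans sr; exact: normc_ge0.
have re z : normc (z - s0) <= r -> 1 < ReC z <= 2.
  move=> zr; have := le_trans (normc_re _) zr.
  by rewrite ReD ReN s0d ler_norml => /andP[]; lra.
have re0 : 1 < ReC s0 <= 2 by lra.
have t := tendsD (tendsD (vonM_series_tends (re _ sr))
   (tendsMl (-1) (vonM_series_tends (re _ s'r)))) (tendsMl (s - s') (vonM_ln_series_tends re0)).
rewrite (_ : _ + _ = vonM_series s + -1 * vonM_series s' + (s - s') * vonM_ln_series s0); last by ring.
apply: (tends_le t); exists 0%N => Z _.
rewrite !mulr_sumr -!big_split /= (le_trans (normc_sum _ _ _)) //.
have d2 : 0 < d / 2 <= 1 by lra.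
have hh := @sum_vonM_lnk_pw R Z.+1 2 _ d2 isT.
have k0 : 0 <= 11 * r * normc (s - s') by rewrite !mulr_ge0 ?normc_ge0.
rewrite (_ : 1792 / d ^+ 3 = 14 / (d / 2) * (2 * 2%:R / (d / 2)) ^+ 2); last by field; rewrite gt_eqF.
apply: le_trans (ler_wpM2l k0 hh); rewrite mulr_sumr; apply: ler_sum_nat => n _.
rewrite (_ : _ + _ + _ = (vonM n)%:C * (natpowc n (- s) - natpowc n (- s') +
  (ln n%:R)%:C * (s - s') * natpowc n (- s0))); last by rewrite rmorphM /=; ring.
rewrite normcM normc_real ger0_norm ?vonM_ge0 //.
apply: le_trans (ler_wpM2l (vonM_ge0 n) (natpowc_lin n s0d rd sr s'r)) _.
by rewrite le_eqVlt; apply/orP; left; apply/eqP; ring.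
Qed.

(** [200 * 200] exceeds [2 * 11 * 1792], from [vonM_series_lin]: the condition on [r] makes the
    nonlinear part at most half of the slope, and [2 * A <= B * r] makes the initial value small
    enough for [newton_zero]. *)
Lemma zeta_critical_near s0 d r (A B : R) : ReC s0 = 1 + d -> 0 < d <= 1 / 2 ->
  0 < r -> 3 * r <= d / 2 -> 0 < B ->
  normc (vonM_series s0) <= A -> B <= normc (vonM_ln_series s0) ->
  200 * 200 * r <= B * d ^+ 3 -> 2 * A <= B * r ->
  exists2 s, normc (s - s0) <= r & zeta_critical_points s.
Proof.
move=> s0d d12 r0 rd B0 FA FB rB AB.
have /andP[d0 d1] := d12.
have dn : 0 < normc (- vonM_ln_series s0) by rewrite normcNE (lt_le_trans B0).
have V0 : - vonM_ln_series s0 != 0 by rewrite -normc_gt0.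
have [||s sr Fs] := @newton_zero R (@vonM_series R) s0 (- vonM_ln_series s0) r V0 r0.
- move=> s s' sr s'r; rewrite mulNr opprK.
  apply: le_trans (vonM_series_lin s0d d12 rd sr s'r) _.
  rewrite mulrAC ler_wpM2r ?normc_ge0 // normcNE mulrA ler_pdivrMr ?exprn_gt0 //.
  have := ler_wpM2r (ltW (exprn_gt0 3 d0)) FB; lra.
- by rewrite normcNE; have := ler_wpM2r (ltW r0) FB; lra.
exists s => //; have := le_trans (normc_re _) sr.
rewrite ReD ReN s0d ler_norml => /andP[] u1 u2.
split; first by lra.
apply: vonM_series_zero => //; lra.
Qed.

End LogDerivativeZero.

Lemma sum_nat_prime01 (V : nmodType) (b : nat) (F : nat -> V) :
  \sum_(0 <= p < b | prime p) F p = \sum_(1 <= p < b | prime p) F p.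
Proof.
by case: b => [|b]; [rewrite !big_geq|rewrite big_ltn_cond].
Qed.

(** Discrete intermediate values: at the least [c] where the difference is nonnegative, it is at
    most 2, since one step changes it by twice a value of [e]. This [c] will be the point of the
    window where the imposed sign changes. *)
Lemma exists_median {R : realType} (e : nat -> R) (a b : nat) : (a <= b)%N ->
  (forall n, 0 <= e n <= 1) ->
  exists2 c, (a <= c <= b)%N &
    0 <= \sum_(a <= n < c) e n - \sum_(c <= n < b) e n <= 2.
Proof.
move=> ab e01; pose f c := \sum_(a <= n < c) e n - \sum_(c <= n < b) e n.
pose P c := (a <= c <= b)%N && (0 <= f c).
have Pb : exists c, P c.
  exists b; rewrite /P ab leqnn /= /f [X in _ - X]big_geq // subr0.
  by rewrite sumr_ge0 // => n _; case/andP: (e01 n).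
case: (ex_minnP Pb) => c /andP[/andP[ac cb] fc] cmin; exists c; first by rewrite ac.
rewrite -/(f c) fc /=; case: (ltngtP a c) ac => // [alc _|ac _]; last first.
  by rewrite /f ac big_geq // sub0r (le_trans _ (ler0n _ 2)) // oppr_le0
     sumr_ge0 // => n _; case/andP: (e01 n).
have c0 : (0 < c)%N by apply: leq_trans alc.
have fpred : f c.-1 < 0.
  rewrite ltNge; apply/negP => f0; have := cmin c.-1; rewrite /P f0 andbT.
  by rewrite -ltnS prednK // alc (leq_trans (leq_pred _)) //= => /(_ isT); rewrite -ltnS prednK // ltnn.
have -> : f c = f c.-1 + 2 * e c.-1.
  rewrite /f -{1}(prednK c0) big_nat_recr /=; last by rewrite -ltnS prednK.
  by rewrite [\sum_(c.-1 <= n < b) _]big_ltn ?prednK //; lra.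
have := e01 c.-1; lra.
Qed.

(** * The logarithmic derivative at a resonant point *)

Section ResonantPoint.
Context {R : realType}.
Variables (q : nat) (chi : int -> R[i]) (C : R).
Hypothesis q1 : (1 < q)%N.
Hypothesis chiP : dirichlet_character q chi.
Hypothesis chiC : forall Z, normc (\sum_(1 <= n < Z) chi n%:Z * (vonM n / n%:R)%:C) <= C.
Variables (y c Y X : nat) (t d : R).
Hypothesis y0 : (0 < y)%N.
Hypothesis yc : (y <= c)%N.
Hypothesis cY : (c <= Y)%N.
Hypothesis YX : (Y <= X)%N.
Hypothesis d0 : 0 < d.

(* The values imposed on [p ^ (- i t)]. The signs on [y, c) and [c, Y) make the
   logarithmic derivative of zeta small, and its derivative large. *)
Definition target p : R[i] :=
  if (p < y)%N then (if coprime p q then (chi p%:Z)^*%C else 1)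
  else if (p < c)%N then 1 else - 1.

Let s0 : R[i] := (1 + d) +i* t.

Lemma normc_target p : normc (target p) = 1.
Proof.
rewrite /target; case: ifP => _; first case: ifP => cp.
- by rewrite normcJE (chi_nat_norm1 q1 chiP).
- exact: normc1E.
- by case: ifP => _; rewrite ?normcNE; exact: normc1E.
Qed.

Lemma natpowc_line n : natpowc n (- s0) = (pw n (1 + d))%:C * ch t n.
Proof.
rewrite -natpowc_real /ch -natpowcD; congr natpowc; apply: complex_eqP => /=; ring.
Qed.

(** First powers, whereas [resonance] bounds squares; [resonant_ordinate] passes from one to the
    other. *)
Definition defect : R := \sum_(0 <= p < Y | prime p) p%:R^-1 * normc (ch t p - target p).

Lemma pw_le_inv n : (0 < n)%N -> pw n (1 + d) <= n%:R^-1.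
Proof. by move=> n0; rewrite -pw_inv // pw_le //; move: d0; lra. Qed.

Section Weight.
Variables (g : nat -> R) (G Kg : R).
Hypothesis g0 : forall n, 0 <= g n.
Hypothesis gG : forall n, (n < Y)%N -> g n <= G.
Hypothesis gnp : forall Z, \sum_(1 <= n < Z | ~~ prime n) vonM n * (g n / n%:R) <= 192.
Hypothesis g4 : forall n, (0 < n)%N -> ln n%:R * g n / n%:R <= 4.
Hypothesis gK :
  normc (\sum_(1 <= n < y) chi n%:Z * (vonM n / n%:R * pw n d * g n)%:C) <= Kg.

(** Used with [g = 1] for [vonM_series] and with [g = ln] for [vonM_ln_series], the opposite of its
    derivative. *)
Let a p : R := ln p%:R * g p * pw p (1 + d).

Lemma weight_ge0 p : 0 <= a p.
Proof. by rewrite !mulr_ge0 ?ln_nat_ge0 ?pw_ge0. Qed.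

(** Nonprimes cost 192, primes below [Y] are compared with their targets, primes in [[Y, X)] are
    kept as a sum with cancellation, and from [X] on absolute values are taken. *)
Lemma weighted_sum_approx Z : (X <= Z)%N ->
  normc (\sum_(1 <= n < Z) (vonM n * g n)%:C * natpowc n (- s0) -
         \sum_(0 <= p < Y | prime p) (a p)%:C * target p) <=
  192 + ln Y%:R * G * defect +
  normc (\sum_(Y <= r < X | prime r) (a r)%:C * ch t r) +
  \sum_(X <= n < Z) vonM n * g n * pw n (1 + d).
Proof.
move=> XZ; have Y0 : (0 < Y)%N by rewrite (leq_trans y0) // (leq_trans yc).
have X0 : (0 < X)%N by rewrite (leq_trans Y0).
pose T n := (vonM n * g n)%:C * natpowc n (- s0).
have nT n : normc (T n) = vonM n * g n * pw n (1 + d).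
  by rewrite normcM normc_natpowc normc_real ger0_norm // mulr_ge0 // vonM_ge0.
have primeT p : prime p -> T p = (a p)%:C * ch t p.
  by move=> pp; rewrite /T natpowc_line vonM_prime // /a !rmorphM /=; ring.
have -> : \sum_(1 <= n < Z) T n - \sum_(0 <= p < Y | prime p) (a p)%:C * target p =
    \sum_(1 <= n < X | ~~ prime n) T n +
    \sum_(0 <= p < Y | prime p) (a p)%:C * (ch t p - target p) +
    \sum_(Y <= r < X | prime r) (a r)%:C * ch t r + \sum_(X <= n < Z) T n.
  rewrite (@big_cat_nat _ _ _ X) //= (bigID prime) /=.
  rewrite -(sum_nat_prime01 X T) (@big_cat_nat _ _ _ Y 0 X prime) //=.
  have eT m n : \sum_(m <= i < n | prime i) T i = \sum_(m <= i < n | prime i) (a i)%:C * ch t i.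
    exact: eq_bigr.
  rewrite !eT.
  under [X in _ = _ + X + _ + _]eq_bigr do rewrite mulrBr.
  by rewrite sumrB; ring.
have split2 u v (x w : R) : normc u <= x -> normc v <= w -> normc (u + v) <= x + w.
  by move=> ux vw; rewrite (le_trans (normcD _ _)) // lerD.
apply: (split2); first apply: (split2) => //; first apply: (split2).
- rewrite (le_trans (normc_sum _ _ _)) // (le_trans _ (gnp X)) //.
  rewrite big_nat_cond [X in _ <= X]big_nat_cond; apply: ler_sum => n /andP[/andP[n0 _] _].
  by rewrite nT -mulrA ler_wpM2l ?vonM_ge0 // ler_wpM2l // pw_le_inv.
- rewrite (le_trans (normc_sum _ _ _)) // /defect mulr_sumr.
  rewrite big_nat_cond [X in _ <= X]big_nat_cond; apply: ler_sum => p /andP[/andP[_ pY] pp].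
  have p0 := prime_gt0 pp.
  rewrite normcM normc_real (ger0_norm (weight_ge0 _)) mulrA ler_wpM2r ?normc_ge0 //.
  rewrite ler_pM ?mulr_ge0 ?ln_nat_ge0 ?pw_ge0 ?pw_le_inv //.
  by rewrite ler_pM ?ln_nat_ge0 ?gG // ler_ln_nat // ltnW.
- by rewrite (le_trans (normc_sum _ _ _)) //; apply: ler_sum => n _; rewrite nT.
Qed.

(** Below [y] the target turns the sum into the conjugate of the bounded sum of [chi n * vonM n], up
    to nonprimes and up to the primes dividing [q]: at most [q] terms of size at most 4. *)
Lemma weighted_target_small :
  normc (\sum_(0 <= p < y | prime p) (a p)%:C * target p) <= Kg + 192 + 4 * q%:R.
Proof.
pose T n := chi n%:Z * (vonM n / n%:R * pw n d * g n)%:C.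
have aE p : prime p -> (a p)%:C * (chi p%:Z)^*%C = (T p)^*%C.
  move=> pp; rewrite /T vonM_prime // [RHS]rmorphM /= mulrC; congr (_ * _).
  rewrite /a pw_1D ?prime_gt0 //; apply: complex_eqP => /=; [ring|by rewrite oppr0].
have -> : \sum_(0 <= p < y | prime p) (a p)%:C * target p =
   (\sum_(1 <= n < y) T n)^*%C - (\sum_(1 <= n < y | ~~ prime n) T n)^*%C +
   \sum_(0 <= p < y | prime p && ~~ coprime p q) (a p)%:C.
  have -> : (\sum_(1 <= n < y) T n)^*%C - (\sum_(1 <= n < y | ~~ prime n) T n)^*%C =
      \sum_(0 <= p < y | prime p) (T p)^*%C.
    by rewrite (bigID prime) /= rmorphD addrK rmorph_sum /= sum_nat_prime01.
  rewrite [RHS]addrC [X in X + _](_ : _ = \sum_(0 <= p < y | prime p)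
    (if coprime p q then 0 else (a p)%:C)); last first.
    by rewrite [RHS]big_mkcond [LHS]big_mkcond /=; apply: eq_bigr => p _;
       case: (prime p); case: coprime.
  rewrite -big_split /= big_nat_cond [RHS]big_nat_cond.
  apply: eq_bigr => p /andP[/andP[_ py] pp]; rewrite /target py -aE //.
  case: ifP => cp; first by rewrite add0r.
  by rewrite (chi_nat_eq0 chiP) ?cp // conjc0 mulr0 addr0 mulr1.
rewrite (le_trans (normcD _ _)) // lerD //.
  rewrite (le_trans (normcB _ _)) // lerD // !normcJE //.
  rewrite (le_trans (normc_sum _ _ _)) // (le_trans _ (gnp y)) //.
  rewrite big_nat_cond [X in _ <= X]big_nat_cond; apply: ler_sum => n /andP[/andP[n0 _] _].
  have v0 : 0 <= vonM n / n%:R * pw n d * g n :> R.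
    by rewrite !mulr_ge0 ?vonM_ge0 ?pw_ge0 // invr_ge0.
  rewrite normcM normc_real (ger0_norm v0) -[X in _ <= X]mul1r.
  rewrite ler_pM ?normc_ge0 ?(chi_nat_norm_le1 q1 chiP) //.
  rewrite (_ : vonM n * (g n / n%:R) = vonM n / n%:R * 1 * g n); last by ring.
  rewrite ler_wpM2r // ler_wpM2l ?pw_le1 ?(ltW d0) //.
  by rewrite mulr_ge0 ?vonM_ge0 ?invr_ge0.
rewrite (le_trans (normc_sum _ _ _)) //.
apply: (@le_trans _ _ (\sum_(0 <= p < maxn y q.+1) (if (0 < p < q.+1)%N then 4 else 0))).
  rewrite (eq_bigr a); last by move=> p _; rewrite normc_real (ger0_norm (weight_ge0 _)).
  rewrite (@big_cat_nat _ _ _ y 0 (maxn y q.+1)) ?leq_maxl //=.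
  rewrite -[X in X <= _]addr0 lerD //; last by rewrite sumr_ge0 // => p _; case: ifP.
  rewrite big_mkcond; apply: ler_sum => p _.
  case: ifP => [/andP[pp cp]|_]; last by case: ifP.
  have p0 := prime_gt0 pp.
  have pq : (p <= q)%N.
    by rewrite dvdn_leq ?(ltnW q1) //; move: cp; rewrite prime_coprime // negbK.
  rewrite p0 ltnS pq /=.
  apply: le_trans (g4 p0); rewrite ler_wpM2l ?mulr_ge0 ?ln_nat_ge0 //.
  exact: pw_le_inv.
rewrite (@big_cat_nat _ _ _ q.+1 0 (maxn y q.+1)) ?leq_maxr //=.
rewrite [X in _ + X]sum0_nat ?addr0; last by move=> i /andP[qi _] _; rewrite [(i < q.+1)%N]ltnNge qi andbF.
rewrite big_ltn //= add0r.
apply: (@le_trans _ _ (\sum_(1 <= i < q.+1) 4)).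
  by apply: ler_sum => i _; case: ifP.
by rewrite sumr_const_nat subn1 /= -[leLHS]mulr_natr.
Qed.

Lemma weighted_target_split :
  \sum_(0 <= p < Y | prime p) (a p)%:C * target p =
  \sum_(0 <= p < y | prime p) (a p)%:C * target p +
  (\sum_(y <= p < c | prime p) a p - \sum_(c <= p < Y | prime p) a p)%:C.
Proof.
rewrite (@big_cat_nat _ _ _ y 0 Y) ?(leq_trans yc) //=; congr (_ + _).
rewrite (@big_cat_nat _ _ _ c y Y) //= rmorphB /= !real_sum -sumrN; congr (_ + _).
- rewrite big_nat_cond [RHS]big_nat_cond; apply: eq_bigr => p /andP[/andP[yp pc] _].
  by rewrite /target ltnNge yp /= pc mulr1.
- rewrite big_nat_cond [RHS]big_nat_cond; apply: eq_bigr => p /andP[/andP[cp _] _].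
  by rewrite /target ltnNge (leq_trans yc cp) /= ltnNge cp /= mulrN1.
Qed.

End Weight.

Hypothesis d1 : d <= 1.

Let line_re : 1 < ReC s0 <= 2.
Proof. by rewrite /s0 /=; move: d0 d1; lra. Qed.

Let C_ge0 : 0 <= C. Proof. exact: le_trans (normc_ge0 _) (chiC 0). Qed.

Let cut (g : nat -> R) : R := \sum_(y <= p < c | prime p) ln p%:R * g p * pw p (1 + d) -
  \sum_(c <= p < Y | prime p) ln p%:R * g p * pw p (1 + d).

Let Y0 : (0 < Y)%N. Proof. by rewrite (leq_trans y0) // (leq_trans yc). Qed.

Let lny_le : ln y%:R <= ln Y%:R :> R.
Proof. by rewrite ler_ln_nat // (leq_trans yc). Qed.

Lemma chi_vonM_pw_bounded Z :
  normc (\sum_(1 <= n < Z) chi n%:Z * (vonM n / n%:R * pw n d)%:C) <= C.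
Proof.
have [Z1|Z1] := leqP 1 Z; last first.
  by rewrite big_geq ?(ltnW Z1) // normc0E.
under eq_bigr do rewrite rmorphM mulrA /=.
have := @abel_decr R (fun n => chi n%:Z * (vonM n / n%:R)%:C) (fun n => pw n d) 1 Z C Z1.
rewrite pw_1 mulr1; apply.
- by move=> n _; exact: chiC.
- by move=> n _; exact: pw_ge0.
- by move=> n n1; apply: pw_decr => //; exact: ltW.
Qed.

(** [389 = 192 + 195 + 2]: nonprimes below [y], the approximation error [192 + 1 + 1 + 1], and the
    imbalance of the window. *)
Lemma vonM_series_small : ln Y%:R * defect <= 1 ->
  normc (\sum_(Y <= r < X | prime r) (ln r%:R * pw r (1 + d))%:C * ch t r) <= 1 ->
  (forall Z, \sum_(X <= n < Z) vonM n * pw n (1 + d) <= 1) ->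
  0 <= \sum_(y <= p < c | prime p) ln p%:R * pw p (1 + d) -
    \sum_(c <= p < Y | prime p) ln p%:R * pw p (1 + d) <= 2 ->
  normc (vonM_series s0) <= C + 4 * q%:R + 389.
Proof.
move=> hd hT ht hc; pose g := fun _ : nat => 1 : R.
have e1 F m n : \sum_(m <= p < n | prime p) F (ln p%:R * g p * pw p (1 + d)) =
    \sum_(m <= p < n | prime p) F (ln p%:R * pw p (1 + d)) :> R.
  by apply: eq_bigr => p _; rewrite mulr1.
have gnp Z : \sum_(1 <= n < Z | ~~ prime n) vonM n * (g n / n%:R) <= 192.
  apply: le_trans (sum_vonM_nonprime Z); apply: ler_sum => n _.
  by rewrite mul1r.
have g4 n : (0 < n)%N -> ln n%:R * g n / n%:R <= 4.
  move=> n0; rewrite mulr1 -(pw_inv n0); have := @ln_pw_le R n 1 ltr01.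
  by rewrite invr1; lra.
have gK : normc (\sum_(1 <= n < y) chi n%:Z * (vonM n / n%:R * pw n d * g n)%:C) <= C.
  by under eq_bigr do rewrite mulr1; exact: chi_vonM_pw_bounded.
have small := weighted_target_small (fun _ => ler01) gnp g4 gK.
have split := weighted_target_split g.
have b : normc (vonM_series s0 - \sum_(0 <= p < Y | prime p)
    (ln p%:R * g p * pw p (1 + d))%:C * target p) <= 195.
  apply: (tends_dist_le (vonM_series_tends line_re)); exists X => Z XZ.
  have h := weighted_sum_approx (fun _ => ler01) (fun _ _ => lexx 1) gnp (leqW XZ).
  have e2 : \sum_(1 <= n < Z.+1) (vonM n)%:C * natpowc n (- s0) =
     \sum_(1 <= n < Z.+1) (vonM n * g n)%:C * natpowc n (- s0).
    by apply: eq_bigr => n _; rewrite mulr1.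
  rewrite e2; apply: le_trans h _.
  have := ht Z.+1; have := hT.
  under eq_bigr do rewrite -[ln _]mulr1.
  under [X in _ -> X <= _ -> _]eq_bigr do rewrite -[vonM _]mulr1.
  rewrite mulr1 -/g; move: hd; rewrite /g; lra.
have h3 : normc (cut g)%:C <= 2.
  by rewrite normc_real ger0_norm /cut !(e1 id); move: hc; lra.
rewrite split in b.
rewrite -(subrK (\sum_(0 <= p < y | prime p) (ln p%:R * g p * pw p (1 + d))%:C * target p
  + (cut g)%:C) (vonM_series s0)).
rewrite (le_trans (normcD _ _)) //.
have := normcD (\sum_(0 <= p < y | prime p) (ln p%:R * g p * pw p (1 + d))%:C * target p) (cut g)%:C.
move: b h3 small; rewrite -/(cut g); lra.
Qed.

(** The primes below [y] cost [2 C ln Y] by [abel_incr], linear in [ln Y], against the window term,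
    for which [cut_lower] gives a quadratic lower bound. [390 = 192 + 198] with
    [198 = 192 + 1 + 4 + 1]. *)
Lemma vonM_ln_series_large : ln Y%:R * ln Y%:R * defect <= 1 ->
  normc (\sum_(Y <= r < X | prime r) (ln r%:R * ln r%:R * pw r (1 + d))%:C * ch t r) <= 4 ->
  (forall Z, \sum_(X <= n < Z) vonM n * ln n%:R * pw n (1 + d) <= 1) ->
  \sum_(c <= p < Y | prime p) ln p%:R * ln p%:R * pw p (1 + d) -
    \sum_(y <= p < c | prime p) ln p%:R * ln p%:R * pw p (1 + d) -
    (2 * C * ln Y%:R + 4 * q%:R + 390) <= normc (vonM_ln_series s0).
Proof.
move=> hd hT ht; pose g := fun n : nat => ln n%:R : R.
have g0 n : 0 <= g n by exact: ln_nat_ge0.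
have gnp Z : \sum_(1 <= n < Z | ~~ prime n) vonM n * (g n / n%:R) <= 192.
  exact: sum_vonM_nonprime_ln.
have g4 n : (0 < n)%N -> ln n%:R * g n / n%:R <= 4.
  move=> n0; have h2 : 0 < 1 / 2 :> R by lra.
  have := @ln_pw_le_exp R n 2 _ h2; rewrite (_ : 2%:R * (1 / 2) = 1 :> R); last by lra.
  rewrite pw_inv // expr2 (_ : (1 / 2)^-1 ^+ 2 = 4 :> R) //.
  by rewrite expr2 invf_div divr1; lra.
have gK : normc (\sum_(1 <= n < y) chi n%:Z * (vonM n / n%:R * pw n d * g n)%:C) <=
    2 * C * ln Y%:R.
  apply: (@le_trans _ _ (2 * C * ln y%:R)); last by rewrite ler_wpM2l // mulr_ge0 // C_ge0.
  under eq_bigr do rewrite rmorphM mulrA /=.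
  apply: (@abel_incr R (fun n => chi n%:Z * (vonM n / n%:R * pw n d)%:C) g 1 y C y0) => //.
  - by move=> n _; exact: chi_vonM_pw_bounded.
  - by move=> n _; exact: ln_le_ln_next.
have gG n : (n < Y)%N -> g n <= ln Y%:R.
  rewrite /g; case: n => [|n] nY; last by rewrite ler_ln_nat // ltnW.
  by rewrite ln0 // ln_nat_ge0.
have small := weighted_target_small g0 gnp g4 gK.
have split := weighted_target_split g.
have b : normc (vonM_ln_series s0 - \sum_(0 <= p < Y | prime p)
    (ln p%:R * g p * pw p (1 + d))%:C * target p) <= 198.
  apply: (tends_dist_le (vonM_ln_series_tends line_re)); exists X => Z XZ.
  have h := weighted_sum_approx g0 gG gnp (leqW XZ).
  apply: le_trans h _; have := ht Z.+1; move: hT hd; rewrite /g; lra.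
rewrite split in b.
have aux (u v : R[i]) (k a b' : R) : normc (u - (v + k%:C)) <= a -> normc v <= b' ->
    - k - (b' + a) <= normc u.
  move=> ua vb; have h1 := normcB u (u - (v + k%:C) + v).
  have h2 := normcD (u - (v + k%:C)) v.
  have h3 : `|k| <= normc (u - (u - (v + k%:C) + v)).
    by rewrite (_ : _ - _ = k%:C) ?normc_real //; ring.
  by have := ler_norm (- k); rewrite normrN; lra.
apply: le_trans (aux _ _ _ _ _ b small); rewrite opprB /g; lra.
Qed.

End ResonantPoint.

(** * The contribution of the window to the derivative *)

Section CutLower.
Context {R : realType}.

(** Balance of the two halves allows [ln c] to be subtracted from every [ln p], at a cost of
    [2 ln Y]; all terms become nonnegative. Wherever [c] falls, one outer block lies at logarithmic
    distance at least [G] from it: [[y, z1)] if [z2 <= c], and [[z3, Y)] otherwise. *)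
Lemma cut_lower (e : nat -> R) (y c Y z1 z2 z3 : nat) (G W : R) :
  (0 < y)%N -> (y <= c)%N -> (c <= Y)%N -> (y <= z1)%N -> (z1 <= z2)%N -> (z2 <= z3)%N ->
  (z3 <= Y)%N -> (forall n, 0 <= e n) -> 0 <= G ->
  G <= ln z2%:R - ln z1%:R -> G <= ln z3%:R - ln z2%:R ->
  W <= \sum_(y <= p < z1) e p -> W <= \sum_(z3 <= p < Y) e p ->
  \sum_(y <= p < c) e p - \sum_(c <= p < Y) e p <= 2 ->
  G * W - 2 * ln Y%:R <= \sum_(c <= p < Y) ln p%:R * e p - \sum_(y <= p < c) ln p%:R * e p.
Proof.
move=> y0 yc cY yz1 z12 z23 z3Y e0 G0 G12 G23 W1 W2 hc.
have c0 : (0 < c)%N by apply: leq_trans yc.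
have lc : ln c%:R <= ln Y%:R :> R by rewrite ler_ln_nat.
have lc0 := @ln_nat_ge0 R c.
suff : G * W <= \sum_(c <= p < Y) (ln p%:R - ln c%:R) * e p +
    \sum_(y <= p < c) (ln c%:R - ln p%:R) * e p.
  under [X in _ <= X + _]eq_bigr do rewrite mulrBl.
  under [X in _ <= _ + X]eq_bigr do rewrite mulrBl.
  rewrite !sumrB -!mulr_sumr; nra.
have t1 p : (c <= p)%N -> 0 <= (ln p%:R - ln c%:R) * e p.
  by move=> cp; rewrite mulr_ge0 // subr_ge0 ler_ln_nat.
have t2 p : (y <= p < c)%N -> 0 <= (ln c%:R - ln p%:R) * e p.
  move=> /andP[yp pc]; rewrite mulr_ge0 // subr_ge0 ler_ln_nat //; last exact: ltnW.
  exact: leq_trans yp.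
have s1 a b : (c <= a)%N -> 0 <= \sum_(a <= p < b) (ln p%:R - ln c%:R) * e p.
  move=> ca; rewrite big_nat_cond sumr_ge0 // => p /andP[/andP[ap _] _].
  exact/t1/(leq_trans ca).
have s2 a b : (y <= a)%N -> (b <= c)%N -> 0 <= \sum_(a <= p < b) (ln c%:R - ln p%:R) * e p.
  move=> ya bc; rewrite big_nat_cond sumr_ge0 // => p /andP[/andP[ap pb] _].
  by apply: t2; rewrite (leq_trans ya ap) (leq_trans pb).
have [z2c|/ltnW cz2] := leqP z2 c.
  rewrite -[leLHS]add0r lerD ?s1 //.
  rewrite (@big_cat_nat _ _ _ z1) ?(leq_trans z12) //= -[leLHS]addr0 lerD //; last exact: s2.
  apply: le_trans (ler_wpM2l G0 W1) _; rewrite mulr_sumr.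
  apply: ler_sum_nat => p /andP[yp pz]; rewrite ler_wpM2r //.
  have p0 : (0 < p)%N by apply: leq_trans yp.
  have l1 : ln p%:R <= ln z1%:R :> R by rewrite ler_ln_nat // ltnW.
  have l2 : ln z2%:R <= ln c%:R :> R.
    by rewrite ler_ln_nat // (leq_trans y0) // (leq_trans yz1).
  by move: G12 l1 l2; lra.
rewrite -[leLHS]addr0 lerD ?s2 //.
rewrite (@big_cat_nat _ _ _ z3) ?(leq_trans cz2) //= -[leLHS]add0r lerD //; first exact: s1.
apply: le_trans (ler_wpM2l G0 W2) _; rewrite mulr_sumr.
apply: ler_sum_nat => p /andP[zp _]; rewrite ler_wpM2r //.
have l1 : ln z3%:R <= ln p%:R :> R.
  by rewrite ler_ln_nat // (leq_trans y0) // (leq_trans yz1) // (leq_trans z12).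
have l2 : ln c%:R <= ln z2%:R :> R by rewrite ler_ln_nat.
by move: G23 l1 l2; lra.
Qed.

Lemma prime_window_pw (a b Y : nat) (d : R) : 0 < d -> (0 < a <= b)%N -> (b <= Y)%N ->
  pw Y d * (ln b%:R - ln a%:R - 203) <=
    \sum_(a <= p < b | prime p) ln p%:R * pw p (1 + d).
Proof.
move=> d0 ab bY; have [h _] := @prime_window R a b ab.
apply: le_trans (ler_wpM2l (pw_ge0 Y d) h) _; rewrite mulr_sumr.
rewrite big_nat_cond [X in _ <= X]big_nat_cond; apply: ler_sum => p /andP[/andP[_ pb] pp].
have p0 := prime_gt0 pp.
rewrite pw_1D // [leLHS]mulrC [leRHS]mulrA ler_wpM2l ?divr_ge0 ?ln_nat_ge0 //.
by rewrite pw_mono ?(ltW d0) // p0 ltnW // (leq_trans pb).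
Qed.

End CutLower.

Section TotientProduct.
Context {R : realType}.

Lemma totient_ratio (q y : nat) : (0 < q < y)%N ->
  \prod_(0 <= p < y | prime p && ~~ coprime p q) (1 - p%:R^-1) =
    (totient q)%:R / q%:R :> R.
Proof.
move=> /andP[q0 qy].
have -> : \prod_(0 <= p < y | prime p && ~~ coprime p q) (1 - p%:R^-1) =
    \prod_(p <- primes q) (1 - p%:R^-1) :> R.
  rewrite -big_filter; apply: perm_big; apply: uniq_perm.
  - by rewrite filter_uniq // iota_uniq.
  - exact: primes_uniq.
  - move=> p; rewrite mem_filter mem_index_iota mem_primes q0 /=.
    case pp : (prime p) => //=; rewrite prime_coprime // negbK.
    case: (boolP (p %| q)%N) => //= pq.
    by rewrite (leq_ltn_trans (dvdn_leq q0 pq)).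
have qE := prod_prime_decomp q0; rewrite prime_decompE big_map /= in qE.
rewrite totientE // [X in _ / X%:R]qE.
rewrite !natr_prod -prodf_div big_seq [RHS]big_seq; apply: eq_bigr => p.
rewrite mem_primes => /and3P[pp _ pq]; have p0 := prime_gt0 pp.
have e0 : (0 < logn p q)%N by rewrite logn_gt0 mem_primes pp q0.
rewrite -[in RHS](prednK e0) expnS !natrM -[in X in _ = X](prednK p0) /=.
have pn : p%:R != 0 :> R by rewrite pnatr_eq0 -lt0n.
rewrite prednK // -mulf_div divff ?mulr1; last by rewrite pnatr_eq0 -lt0n expn_gt0 p0.
by rewrite -subn1 natrB // mulrBl divff // div1r.
Qed.

End TotientProduct.

(** * Lower bound for L(s, chi) *)

Section LFunctionLower.
Context {R : realType}.
Variables (q : nat) (chi : int -> R[i]).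
Hypothesis q1 : (1 < q)%N.
Hypothesis chiP : dirichlet_character q chi.
Variables (y c Y X : nat) (t d r : R) (s : R[i]).
Hypothesis qy : (q < y)%N.
Hypothesis yc : (y <= c)%N.
Hypothesis cY : (c <= Y)%N.
Hypothesis YX : (Y <= X)%N.
Hypothesis d0 : 0 < d.
Hypothesis d1 : d <= 1.
Hypothesis rd : 3 * r <= d / 2.
Let s0 : R[i] := (1 + d) +i* t.
Hypothesis sr : normc (s - s0) <= r.
Local Notation v p := (chi (Posz p) * natpowc p (- s)).
Local Notation w p := (chi (Posz p) * natpowc p (- s0)).
Local Notation u p := (pw p (1 + d)).
Local Notation D p := (normc (natpowc p (- s) - natpowc p (- s0))).

Let r0 : 0 <= r. Proof. exact: le_trans (normc_ge0 _) sr. Qed.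

Let yY : (y <= Y)%N. Proof. exact: leq_trans cY. Qed.

Let re_s : 1 + d / 2 <= ReC s.
Proof.
have := le_trans (normc_re _) sr; rewrite ReD ReN ler_norml => /andP[+ _].
by rewrite /s0 /=; move: rd r0; lra.
Qed.

(** The price of moving from [s0] to the zero [s]: [3 r] times the sum of
    [ln p * p ^ (- 1 - d / 2)], that is [3 r * 14 / d]. *)
Lemma sum_diff_le P : \sum_(0 <= p < P | prime p) D p <= 42 * r / d.
Proof.
have d2 : 0 < d / 2 <= 1 by move: d0 d1; lra.
have h := @sum_vonM_pw R P _ d2.
have r3 : 0 <= 3 * r by rewrite mulr_ge0.
apply: (@le_trans _ _ (3 * r * (7 / (d / 2)))); last first.
  by rewrite le_eqVlt; apply/orP; left; apply/eqP; field; rewrite gt_eqF.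
apply: le_trans (ler_wpM2l r3 h); rewrite sum_nat_prime01 mulr_sumr.
rewrite [X in _ <= X](bigID prime) /= -[leLHS]addr0 lerD //; last first.
  by rewrite sumr_ge0 // => n _; rewrite mulr_ge0 // mulr_ge0 ?vonM_ge0 ?pw_ge0.
apply: ler_sum => p pp; rewrite vonM_prime //.
have := natpowc_diff1 p s0 (s - s0); rewrite subrKC => /le_trans; apply.
rewrite -mulrA ler_pM ?mulr_ge0 ?normc_ge0 ?ln_nat_ge0 ?pw_ge0 //.
  by rewrite ler_wpM2l.
by rewrite ler_wpM2l ?ln_nat_ge0 // pw_le // /s0 /=; move: sr rd; lra.
Qed.

Lemma u_le_half p : prime p -> 0 < u p <= 1 / 2.
Proof.
move=> pp; rewrite pw_gt0 /=; have p1 := prime_gt1 pp.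
apply: le_trans (pw_le_inv d0 (ltnW p1)) _.
by rewrite div1r lef_pV2 ?posrE ?ltr0n ?(ltnW p1) // ler_nat.
Qed.

(** If [p] does not divide [q], [chi p * p ^ (- s)] is within some [E] of [u p], and
    [1 - u p >= 1 / 2] turns [1 - u p + E] into [(1 - u p) (1 + 2 E)]. If [p] divides [q], the
    factor is 1 and is compared with [(1 - u p) / (1 - 1 / p)]; these denominators produce
    [totient q / q]. *)
Lemma small_factor p : prime p -> (p < y)%N ->
  normc (1 - v p) <= (1 - u p) * (if coprime p q then 1 else (1 - p%:R^-1)^-1) *
    expR (2 * (D p + p%:R^-1 * normc (ch t p - target q chi y c p))).
Proof.
move=> pp py; have p0 := prime_gt0 pp; have /andP[u0 u2] := u_le_half pp.
rewrite /target py; case: ifP => cp; last first.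
  rewrite (chi_nat_eq0 chiP) ?cp // mul0r subr0 (_ : normc 1 = 1); last exact: normc1E.
  have h1 : 1 <= expR (2 * (D p + p%:R^-1 * normc (ch t p - 1))) :> R.
    by rewrite -expR0 ler_expR mulr_ge0 ?addr_ge0 ?mulr_ge0 ?normc_ge0 ?invr_ge0.
  have pi : p%:R^-1 < 1 :> R by rewrite invf_lt1 ?ltr0n // ltr1n prime_gt1.
  have h2 : 1 <= (1 - u p) / (1 - p%:R^-1).
    rewrite ler_pdivlMr ?mul1r ?subr_gt0 // lerD2l lerN2.
    exact: pw_le_inv.
  by rewrite -[leLHS]mul1r ler_pM.
rewrite mulr1.
have n1 := chi_nat_norm1 q1 chiP cp.
have h1 : normc ((u p)%:C - v p) <= D p + p%:R^-1 * normc (ch t p - (chi p%:Z)^*%C).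
  rewrite (_ : _ - _ = - (chi p%:Z * (natpowc p (- s) - natpowc p (- s0))) -
     (chi p%:Z * ((u p)%:C * (ch t p - (chi p%:Z)^*%C)))); last first.
    have e : chi p%:Z * (chi p%:Z)^*%C = 1 by rewrite sqrt_normc_conj n1 expr1n.
    have nl := natpowc_line t d p; rewrite -/s0 in nl.
    by rewrite nl -[X in X - _]mulr1 -e; ring.
  rewrite (le_trans (normcB _ _)) // normcNE !normcM n1 !mul1r lerD2l.
  by rewrite normc_real ger0_norm ?(ltW u0) // ler_wpM2r ?normc_ge0 // pw_le_inv.
set E := D p + _ in h1 *.
rewrite (_ : 1 - v p = (1 - u p)%:C + ((u p)%:C - v p)); last by rewrite rmorphB /= rmorph1; ring.
rewrite (le_trans (normcD _ _)) // normc_real ger0_norm; last by lra.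
have E0 : 0 <= E by apply: le_trans h1; exact: normc_ge0.
have := expR_ge1Dx (2 * E); have : 0 <= 1 - u p - 1 / 2 by lra.
move=> a1 a2; have : (1 - u p) * (1 + 2 * E) <= (1 - u p) * expR (2 * E).
  by rewrite ler_wpM2l //; lra.
by move: h1; nra.
Qed.

(** The real part at [s0] is kept in the exponent, so that the primes in [[Y, X)] enter through a
    sum with cancellation. *)
Lemma large_factor p : prime p ->
  normc (1 - v p) <= expR (- ReC (w p) + D p + pw p 2 / 2).
Proof.
move=> pp; apply: le_trans (normc_1B_le_exp _) _; rewrite ler_expR lerD //.
  have := normc_re (v p - w p); rewrite -mulrBr ler_norml mulrBr ReD ReN => /andP[+ _].
  have : normc (chi p%:Z * (natpowc p (- s) - natpowc p (- s0))) <= D p.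
    by rewrite normcM ler_piMl ?normc_ge0 // (chi_nat_norm_le1 q1 chiP).
  by rewrite mulrBr; lra.
rewrite ler_wpM2r ?invr_ge0 // (_ : 2 = 1 + 1) // pwD -expr2 ler_sqr ?nnegrE ?normc_ge0 ?pw_ge0 //.
rewrite normcM normc_natpowc -[X in _ <= X]mul1r ler_pM ?normc_ge0 ?pw_ge0 //.
  exact: (chi_nat_norm_le1 q1 chiP).
by apply: pw_le; move: re_s d0; lra.
Qed.

(** The finite Euler products times L tend to 1, so an upper bound for [prod |1 - v p|], uniform in
    the length, is a lower bound for [|L|]. [E] collects, in order: the move from [s0] to [s], the
    defect below [y], the window, [[Y, X)], the tail, and the squares of primes. *)
Lemma dirichlet_L_lower (E T : R) :
  (forall P, \sum_(X <= p < P | prime p) u p <= T) ->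
  84 * r / d + 2 * defect q chi y c Y t + \sum_(y <= p < Y | prime p) p%:R^-1 +
    normc (\sum_(Y <= p < X | prime p) (chi p%:Z * (u p)%:C) * ch t p) + T +
    y.-1%:R^-1 <= E ->
  (totient q)%:R / q%:R <=
    normc (dirichlet_L chi s) * \prod_(0 <= p < y | prime p) (1 - u p) * expR E.
Proof.
move=> hT hE.
have q0 : (0 < q < y)%N by rewrite (ltnW q1).
have y1 : (1 < y)%N by apply: ltn_trans qy.
pose A : R := \prod_(0 <= p < y | prime p) (1 - u p).
have A0 : 0 < A.
  by apply: prodr_gt0 => p /u_le_half/andP[_]; lra.
have B0 : 0 < (totient q)%:R / q%:R :> R.
  by rewrite divr_gt0 ?ltr0n ?totient_gt0 // ltnW.
have prodle P : (X <= P)%N -> \prod_(0 <= p < P | prime p) normc (1 - v p) <=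
    A * ((totient q)%:R / q%:R)^-1 * expR E.
  move=> XP; have yP : (y <= P)%N by rewrite (leq_trans yY) // (leq_trans YX).
  have YP : (Y <= P)%N by rewrite (leq_trans YX).
  rewrite (@big_cat_nat _ _ _ y 0 P) //=.
  have b1 : \prod_(0 <= p < y | prime p) normc (1 - v p) <=
     A * ((totient q)%:R / q%:R)^-1 *
     expR (2 * \sum_(0 <= p < y | prime p) (D p + p%:R^-1 * normc (ch t p - target q chi y c p))).
    apply: (@le_trans _ _ (\prod_(0 <= p < y | prime p)
       ((1 - u p) * (if coprime p q then 1 else (1 - p%:R^-1)^-1) *
    expR (2 * (D p + p%:R^-1 * normc (ch t p - target q chi y c p)))))).
      rewrite big_nat_cond [X in _ <= X]big_nat_cond; apply: ler_prod => p /andP[/andP[_ py] pp].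
      by rewrite normc_ge0 small_factor.
    rewrite [leLHS]big_split [X in X * _ <= _]big_split /= [X in _ <= _ * expR X]mulr_sumr.
    rewrite expR_sum -(totient_ratio q0) -prodfV.
    rewrite le_eqVlt; apply/orP; left; apply/eqP; congr (_ * _ * _).
    by rewrite big_mkcond [RHS]big_mkcond; apply: eq_bigr => p _; case: prime; case: coprime.
  have b2 : \prod_(y <= p < P | prime p) normc (1 - v p) <=
      expR (\sum_(y <= p < P | prime p) (- ReC (w p) + D p + pw p 2 / 2)).
    by rewrite expR_sum; apply: ler_prod => p pp; rewrite normc_ge0 large_factor.
  have b1' : 0 <= \prod_(0 <= p < y | prime p) normc (1 - v p).
    by apply: prodr_ge0 => p _; exact: normc_ge0.
  have b2' : 0 <= \prod_(y <= p < P | prime p) normc (1 - v p).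
    by apply: prodr_ge0 => p _; exact: normc_ge0.
  apply: le_trans (ler_pM b1' b2' b1 b2) _.
  rewrite -[leLHS]mulrA -expRD.
  rewrite ler_wpM2l ?mulr_ge0 ?invr_ge0 ?(ltW A0) ?(ltW B0) // ler_expR.
  apply: le_trans hE; rewrite !big_split /=.
  have e1 : 2 * \sum_(0 <= i < y | prime i) D i + \sum_(y <= i < P | prime i) D i <= 84 * r / d.
    have := sum_diff_le P; rewrite (@big_cat_nat _ _ _ y 0 P) //=.
    have : 0 <= \sum_(y <= i < P | prime i) D i by rewrite sumr_ge0 // => i _; exact: normc_ge0.
    rewrite (_ : 84 * r / d = 2 * (42 * r / d)); last by ring.
    lra.
  have e2 : \sum_(0 <= p < y | prime p) p%:R^-1 * normc (ch t p - target q chi y c p) <=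
      defect q chi y c Y t.
    rewrite /defect (@big_cat_nat _ _ _ y 0 Y) //= lerDl sumr_ge0 // => p _.
    by rewrite mulr_ge0 ?normc_ge0 ?invr_ge0.
  have e3 : \sum_(y <= i < P | prime i) pw i 2 / 2 <= y.-1%:R^-1 :> R.
    have h := @sum_pw_tail R y P 1 ltr01 y1.
    rewrite pw_inv ?divr1 in h; last by rewrite -subn1 subn_gt0.
    apply: le_trans h; rewrite [X in _ <= X](bigID prime) /= -[leLHS]addr0 lerD //.
      apply: ler_sum => p _; rewrite -[leRHS]/(pw p 2); have := pw_ge0 p (2 : R); lra.
    by rewrite sumr_ge0 // => p _; exact: pw_ge0.
  have e4 : \sum_(y <= i < P | prime i) - ReC (w i) <=
      \sum_(y <= p < Y | prime p) p%:R^-1 +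
      normc (\sum_(Y <= p < X | prime p) (chi p%:Z * (u p)%:C) * ch t p) + T.
    rewrite (@big_cat_nat _ _ _ X y P) ?(leq_trans yY) //= lerD //; last first.
      apply: le_trans (hT P); apply: ler_sum => p _; apply: le_trans (ler_norm _) _.
      rewrite normrN (le_trans (normc_re _)) // normcM normc_natpowc.
      by rewrite ler_piMl ?pw_ge0 // (chi_nat_norm_le1 q1 chiP).
    rewrite (@big_cat_nat _ _ _ Y y X) //= lerD //.
      apply: ler_sum => p pp; apply: le_trans (ler_norm _) _.
      rewrite normrN (le_trans (normc_re _)) // normcM normc_natpowc.
      rewrite -[leRHS]mul1r ler_pM ?pw_ge0 ?normc_ge0 //; first exact: (chi_nat_norm_le1 q1 chiP).
      by apply: pw_le_inv => //; exact: prime_gt0.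
    rewrite sumrN -Re_sum (le_trans (ler_norm _)) // normrN (le_trans (normc_re _)) //.
    rewrite le_eqVlt; apply/orP; left; apply/eqP; congr normc; apply: eq_bigr => p _.
    by rewrite /s0 natpowc_line mulrA.
  by move: e1 e2 e3 e4; lra.
have Lt : tends (fun Z => \sum_(1 <= n < Z.+1) v n) (dirichlet_L chi s).
  have d2 : 0 < d / 2 by move: d0; lra.
  apply: (@dirichlet_series_tends R _ (fun n => pw n (1 + d / 2)) (1 + (d / 2)^-1)).
  - move=> n _; rewrite -[X in _ <= X]mul1r ler_pM ?normc_ge0 ?pw_ge0 //.
      exact: (chi_nat_norm_le1 q1 chiP).
    exact: pw_le.
  - by move=> Z; exact: sum_pw_le.
have d2 : 0 < d / 2 by move: d0; lra.
have f1 : v 1 = 1 by rewrite (chi_nat1 chiP) natpowc1 mulr1.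
have fM m n : (0 < m)%N -> (0 < n)%N -> v (m * n)%N = v m * v n.
  by move=> m0 n0; rewrite (chi_natM chiP) natpowcM // mulrACA.
have fd n : (0 < n)%N -> normc (v n) <= pw n (1 + d / 2).
  move=> n0; rewrite normcM normc_natpowc -[X in _ <= X]mul1r ler_pM ?normc_ge0 ?pw_ge0 //.
    exact: (chi_nat_norm_le1 q1 chiP).
  exact: pw_le.
have U0 : 0 < A * ((totient q)%:R / q%:R)^-1 * expR E.
  by rewrite !mulr_gt0 ?invr_gt0 ?expR_gt0.
rewrite -/A.
suff : 1 <= A * ((totient q)%:R / q%:R)^-1 * expR E * normc (dirichlet_L chi s).
  move=> h; have := ler_wpM2l (ltW B0) h; rewrite mulr1 => /le_trans; apply.
  rewrite le_eqVlt; apply/orP; left; apply/eqP; field.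
  by rewrite !pnatr_eq0 -!lt0n totient_gt0 (ltnW q1).
apply/ler_addgt0Pl => e e0.
have [N hN] := pw_small d2 (mulr_gt0 e0 d2).
pose P := (maxn X N.+2).
have XP : (X <= P)%N by rewrite leq_maxl.
have NP : (N.+2 <= P)%N by rewrite leq_maxr.
have := @euler_product_tail R (fun n => v n) _ f1 fM d2 fd _ P _ Lt.
move=> /(_ (leq_trans (isT : (1 < N.+2)%N) NP)) h1.
have h2 : pw P.-1 (d / 2) / (d / 2) < e.
  by rewrite ltr_pdivrMr // hN // -ltnS prednK ?(leq_trans _ NP) // ltnW.
have h3 := normc_triB 1 (1 - \prod_(0 <= p < P | prime p) (1 - v p) * dirichlet_L chi s).
rewrite (_ : 1 - (1 - _) = \prod_(0 <= p < P | prime p) (1 - v p) * dirichlet_L chi s) in h3; last by ring.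
rewrite [normc (1 - _)]normcBC normcM normc_prod (_ : normc 1 = 1) in h3; last exact: normc1E.
have h4 := ler_wpM2r (normc_ge0 (dirichlet_L chi s)) (prodle P XP).
by move: h1 h2 h3 h4; lra.
Qed.

End LFunctionLower.

(** * Choice of the ordinate *)

Section ResonanceApplied.
Context {R : realType}.
Variables (q : nat) (chi : int -> R[i]).
Hypothesis q1 : (1 < q)%N.
Hypothesis chiP : dirichlet_character q chi.
Variables (y c Y X m B : nat) (d th : R).
Hypothesis Y5 : (4 < Y)%N.
Hypothesis YX : (Y <= X)%N.
Hypothesis d0 : 0 < d.
Hypothesis th0 : 0 < th.
Hypothesis BP : (X * Y ^ m.+1 * \prod_(0 <= p < Y | prime p) p ^ m <= B)%N.
Hypothesis small : 4 * (1 + ln Y%:R) / m.+1%:R + 12 * 8 ^+ 4 * pw Y.-1 (1 / 2) + 2 / B%:R <= th ^+ 2.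

(** The three sums over [[Y, X)] to be made small at once: for F, for F' (divided by 4 to have
    coefficients of modulus at most 1), and for L(s, chi). *)
Let fam (i : 'I_3) (p : nat) : R[i] :=
  if i == 0 :> nat then (ln p%:R * pw p (1 + d))%:C
  else if i == 1 :> nat then (ln p%:R * ln p%:R * pw p (1 + d) / 4)%:C
  else chi (Posz p) * (pw p (1 + d))%:C.

Lemma ln_pw_le1 n : (0 < n)%N -> ln n%:R * pw n (1 + d) <= 1.
Proof.
move=> n0; have := @ln_pw_le R n 1 ltr01; rewrite invr1; apply: le_trans.
by rewrite ler_wpM2l ?ln_nat_ge0 // pw_le //; move: d0; lra.
Qed.

Lemma ln2_pw_le4 n : (0 < n)%N -> ln n%:R * ln n%:R * pw n (1 + d) <= 4.
Proof.
move=> n0; have h2 : 0 < 1 / 2 :> R by lra.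
have := @ln_pw_le_exp R n 2 _ h2; rewrite (_ : 2%:R * (1 / 2) = 1 :> R); last by lra.
rewrite !expr2 (_ : (1 / 2)^-1 * (1 / 2)^-1 = 4 :> R); last by rewrite invf_div divr1; lra.
by apply: le_trans; rewrite ler_wpM2l ?mulr_ge0 ?ln_nat_ge0 // pw_le //; move: d0; lra.
Qed.

Let fam_le i p : prime p -> (4 <= p)%N -> normc (fam i p) <= ln p%:R ^+ 2 * p%:R^-1.
Proof.
move=> pp p4; have p0 := prime_gt0 pp; have l1 := @ln4_ge1 R p p4.
have u1 := pw_le_inv d0 p0; have u0 := pw_ge0 p (1 + d).
rewrite /fam; case: ifP => _; last case: ifP => _.
- rewrite normc_real ger0_norm ?mulr_ge0 ?ln_nat_ge0 // ler_pM ?ln_nat_ge0 //.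
  by rewrite expr2; nra.
- rewrite normc_real ger0_norm ?mulr_ge0 ?ln_nat_ge0 ?invr_ge0 //.
  apply: (@le_trans _ _ (ln p%:R * ln p%:R * pw p (1 + d))).
    rewrite ler_pdivrMr // ler_peMr ?mulr_ge0 ?ln_nat_ge0 //; lra.
  by rewrite expr2 ler_wpM2l ?mulr_ge0 ?ln_nat_ge0.
- rewrite normcM normc_real ger0_norm // -[leLHS]mulrC -[leRHS]mulrC ler_pM ?normc_ge0 //.
  by rewrite (le_trans (chi_nat_norm_le1 q1 chiP _)) // expr_ge1 //; lra.
Qed.

Let fam_le1 i p : (0 < p)%N -> normc (fam i p) <= 1.
Proof.
move=> p0; rewrite /fam; case: ifP => _; last case: ifP => _.
- by rewrite normc_real ger0_norm ?mulr_ge0 ?ln_nat_ge0 ?pw_ge0 // ln_pw_le1.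
- rewrite normc_real ger0_norm ?mulr_ge0 ?ln_nat_ge0 ?invr_ge0 ?pw_ge0 //.
  by rewrite ler_pdivrMr // mul1r ln2_pw_le4.
- rewrite normcM normc_real ger0_norm ?pw_ge0 // mulr_ile1 ?normc_ge0 ?pw_ge0 //.
    exact: (chi_nat_norm_le1 q1 chiP).
  by apply: pw_le1; move: d0; lra.
Qed.

Lemma resonant_ordinate : exists t : R, [/\ 8 * B%:R ^+ 5 <= t, t <= 16 * B%:R ^+ 5,
  defect q chi y c Y t <= th * (1 + ln Y%:R) &
  [/\ normc (\sum_(Y <= r < X | prime r) (ln r%:R * pw r (1 + d))%:C * ch t r) <= th,
   normc (\sum_(Y <= r < X | prime r) (ln r%:R * ln r%:R * pw r (1 + d))%:C * ch t r) <= 4 * th &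
   normc (\sum_(Y <= r < X | prime r) (chi r%:Z * (pw r (1 + d))%:C) * ch t r) <= th]].
Proof.
have Y1X : (1 < Y <= X)%N by rewrite YX (leq_trans _ Y5).
(* [resonance] asks for coefficients of modulus at most 1 at every index, 0 included. *)
pose fam' i p := if (p == 0)%N then 0 else fam i p.
have f1 i p : normc (fam' i p) <= 1.
  rewrite /fam'; case: eqP => [_|/eqP]; first by rewrite normc0E.
  by rewrite -lt0n; exact: fam_le1.
have I3 : (#|'I_3| <= 3)%N by rewrite card_ord.
have [t [t1 t2 hV]] := @resonance R 'I_3 Y X m B (target q chi y c) fam' Y1X
  (fun p _ _ => normc_target q1 chiP y c p) f1 BP I3.
have fE i : \sum_(Y <= r < X | prime r) fam' i r * ch t r =
    \sum_(Y <= r < X | prime r) fam i r * ch t r.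
  by apply: eq_bigr => p /prime_gt0; rewrite lt0n /fam' => /negPf ->.
exists t; set H := \sum_(0 <= p < Y | prime p) p%:R^-1 in hV.
have H1 : H <= 1 + ln Y%:R.
  rewrite /H sum_nat_prime01; have Y0 : (0 < Y)%N by rewrite (leq_trans _ Y5).
  apply: le_trans (@harmonic_le R Y Y0).
  rewrite (@big_cat_nat _ _ _ Y 1 Y.+1) //= -[leLHS]addr0 lerD //; last first.
    by rewrite sumr_ge0.
  by rewrite [X in _ <= X](bigID prime) /= lerDl sumr_ge0.
(* The squares are at most [(ln p) ^ 4 / p ^ 2], whence the exponent 4 and the base [8 = 2 * 4]. *)
have C1 i : \sum_(Y <= r < X | prime r) normc (fam' i r) ^+ 2 <= 2 * 8 ^+ 4 * pw Y.-1 (1 / 2).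
  have h := @sum_ln_exp_sq_tail R Y X 4 (leq_trans (isT : (1 < 5)%N) Y5) isT.
  rewrite (_ : 2 * 4%:R = 8 :> R) in h; last by rewrite -natrM.
  apply: le_trans h; rewrite [X in _ <= X](bigID prime) /= -[leLHS]addr0 lerD //; last first.
    by rewrite sumr_ge0 // => p _; rewrite divr_ge0 ?exprn_ge0 ?ln_nat_ge0.
  rewrite big_nat_cond [X in _ <= X]big_nat_cond; apply: ler_sum => p /andP[/andP[Yp _] pp].
  rewrite /fam' gtn_eqF ?prime_gt0 //.
  rewrite (_ : _ / _ = (ln p%:R ^+ 2 * p%:R^-1) ^+ 2); last by rewrite exprMn -exprM exprVn.
  rewrite ler_sqr ?nnegrE ?normc_ge0 ?mulr_ge0 ?exprn_ge0 ?ln_nat_ge0 ?invr_ge0 //.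
  by apply: fam_le => //; rewrite (leq_trans _ Yp) // ltnW.
have Csum : \sum_(i < 3) \sum_(Y <= r < X | prime r) normc (fam' i r) ^+ 2 <=
    6 * 8 ^+ 4 * pw Y.-1 (1 / 2).
  rewrite !big_ord_recr big_ord0 /= add0r; have := C1; move=> h.
  apply: le_trans (lerD (lerD (h _) (h _)) (h _)) _; lra.
have i0 : 0 <= 4 / m.+1%:R :> R by rewrite divr_ge0.
have hV2 : \sum_(0 <= p < Y | prime p) p%:R^-1 * normc (ch t p - target q chi y c p) ^+ 2 +
    \sum_i normc (\sum_(Y <= r < X | prime r) fam' i r * ch t r) ^+ 2 <= th ^+ 2.
  apply: le_trans hV _; apply: le_trans small; rewrite lerD2r.
  apply: lerD; last by move: Csum; lra.
  by rewrite [leLHS]mulrAC [leRHS]mulrAC ler_wpM2l.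
have def0 : 0 <= \sum_(0 <= p < Y | prime p) p%:R^-1 * normc (ch t p - target q chi y c p) ^+ 2.
  by rewrite sumr_ge0 // => p _; rewrite mulr_ge0 ?exprn_ge0 ?normc_ge0 ?invr_ge0.
have fam_small i : normc (\sum_(Y <= r < X | prime r) fam i r * ch t r) <= th.
  rewrite -fE -(ler_pXn2r (isT : (0 < 2)%N)) ?nnegrE ?normc_ge0 ?(ltW th0) //.
  apply: le_trans hV2; rewrite (bigD1 i) //= addrCA lerDl addr_ge0 //.
  by rewrite sumr_ge0 // => j _; rewrite exprn_ge0 ?normc_ge0.
split => //.
- have V2 : \sum_(0 <= p < Y | prime p) p%:R^-1 * normc (ch t p - target q chi y c p) ^+ 2 <= th ^+ 2.
    by apply: le_trans hV2; rewrite lerDl sumr_ge0 // => j _; rewrite exprn_ge0 ?normc_ge0.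
  (* From squares to first powers by [th * x <= th ^ 2 / 2 + x ^ 2 / 2], summed with weights
     [1 / p]. *)
  rewrite -(ler_pM2l th0).
  apply: (@le_trans _ _ (th ^+ 2 / 2 * H + th ^+ 2 / 2)); last first.
    have := ln_nat_ge0 (R := R) Y; have t20 : 0 <= th ^+ 2 by exact: sqr_ge0.
    rewrite mulrA -expr2; nra.
  apply: (@le_trans _ _ (th ^+ 2 / 2 * H + (\sum_(0 <= p < Y | prime p)
     p%:R^-1 * normc (ch t p - target q chi y c p) ^+ 2) / 2)); last by lra.
  rewrite /defect /H !mulr_sumr mulr_suml -big_split /=; apply: ler_sum => p _.
  have i1 : 0 <= p%:R^-1 :> R by rewrite invr_ge0.
  set x := normc _; have : 0 <= (x - th) ^+ 2 by exact: sqr_ge0.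
  by rewrite !expr2 => hx; have := ler_wpM2l i1 hx; lra.
- split.
  + exact: (fam_small ord0).
  + have := fam_small (inord 1); rewrite /fam inordK //= => h.
    rewrite (_ : \sum_(Y <= r < X | prime r) _ = 4%:R * \sum_(Y <= r < X | prime r)
       (ln r%:R * ln r%:R * pw r (1 + d) / 4)%:C * ch t r); last first.
      rewrite mulr_sumr; apply: eq_bigr => p _; rewrite mulrA; congr (_ * _).
      rewrite -[4%:R]/((4%:R)) -(rmorph_nat (@real_complex R) 4) -rmorphM /=; congr (_%:C).
      by field.
    rewrite normcM (_ : normc 4%:R = 4) ?ler_pM2l //.
    by rewrite -(rmorph_nat (@real_complex R) 4) normc_real ger0_norm.
  + have := fam_small (inord 2); rewrite /fam inordK //=.
Qed.

End ResonanceApplied.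

(** * Choice of the parameters *)

Section CriticalPoint.
Context {R : realType}.
Variables (q : nat) (chi : int -> R[i]) (C : R).
Hypothesis q1 : (1 < q)%N.
Hypothesis chiP : dirichlet_character q chi.
Hypothesis chiC : forall Z, normc (\sum_(1 <= n < Z) chi n%:Z * (vonM n / n%:R)%:C) <= C.
Variables K u : nat.
Let g : R := u%:R * ln 2.
Let k : R := K%:R.
Let Lam : R := (4 * K + 4)%:R * g.
(** With [B = g ^ 2 / 8] and [d = 1 / (4 k ^ 2 g)], the condition [200 * 200 * r <= B * d ^ 3] of
    [zeta_critical_near] becomes an equality for [r = rho / g]. *)
Let rho : R := (200 * 200 * 8 ^+ 3 * k ^+ 6)^-1.
Hypothesis K3 : (3 <= K)%N.
Hypothesis u7 : (7 <= u)%N.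
Hypothesis qu : (q < 2 ^ u)%N.
Hypothesis Ku : (K < 2 ^ u)%N.
(** This and the following conditions hold for fixed [K] and all large [u]: either [2 ^ u] beats a
    polynomial in [u], or a higher power of [g] beats a lower one. *)
Hypothesis exp_th :
  (4 * (1 + Lam) + 12 * 8 ^+ 4 + 2) * (k ^+ 2 * (1 + Lam) ^+ 6) <= 2 ^+ u.
Hypothesis exp_tail : 8 ^+ 5 * k ^+ 7 * u%:R ^+ 3 <= 2 ^+ u.
Hypothesis exp_im : ((40 * K + 50) * u <= 2 ^ u)%N.
Hypothesis g_cut : g ^+ 2 / 8 <= g * (1 / 2 * (g - 203)) - 2 * Lam - (2 * C * Lam + 4 * q%:R + 390).
Hypothesis g_newton : 16 * (C + 4 * q%:R + 389) <= rho * g.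

(* All cut-offs are powers of [2 ^ u]: with [g = u ln 2] one has [ln y = 4 K g],
   the window [[y, Y)] consists of four blocks of logarithmic length [g], and
   [d = 1 / (K ln y)]. *)
Let y := (2 ^ (4 * K * u))%N.
Let z i := (2 ^ ((4 * K + i) * u))%N.
Let Y := z 4.
Let m := (2 ^ u)%N.
Let X := (2 ^ (2 ^ u))%N.
(** The three terms are the binary logarithms of [X], of [Y ^ (m + 1)], and of [Y ^ (m * Y)], which
    bounds the product of the [p ^ m]. *)
Let E := (2 ^ u + (4 * K + 4) * u * m.+1 + (4 * K + 4) * u * (m * Y))%N.
Let B := (2 ^ E)%N.
Let d : R := (4 * k ^+ 2 * g)^-1.
(** The defect is at most [th * (1 + Lam)] and gets multiplied by [(ln Y) ^ 2]; the cube leaves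
    [1 / k]. *)
Let th : R := (k * (1 + Lam) ^+ 3)^-1.
Let r : R := rho / g.

Let k3 : 3 <= k. Proof. by rewrite (ler_nat R 3). Qed.
Let k0 : 0 < k. Proof. by move: k3; lra. Qed.
Let u7R : 7 <= u%:R :> R. Proof. by rewrite (ler_nat R 7). Qed.

Let ln2_le1 : ln 2 <= 1 :> R.
Proof. by have := @ln_sublinear R 2 (ltr0n _ 2); have := @le_ln1Dx R 1; rewrite -[1 + 1]/2; lra. Qed.

Let g_ge : 7 / 2 <= g.
Proof. by have := @ln2_ge_half R; move: u7R; rewrite /g; nra. Qed.

Let g0 : 0 < g. Proof. by move: g_ge; lra. Qed.

Let g_le : g <= u%:R. Proof. by rewrite /g ler_piMr. Qed.

Let ln_pow n : ln (2 ^ n)%:R = n%:R * ln 2 :> R. Proof. exact: lnX_nat. Qed.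

Let lny : ln y%:R = 4 * k * g :> R.
Proof. by rewrite ln_pow !natrM /g /k mulrA. Qed.

Let lnz i : ln (z i)%:R = (4 * k + i%:R) * g :> R.
Proof. by rewrite ln_pow natrM natrD natrM /g /k mulrA. Qed.

Let lnY : ln Y%:R = Lam :> R.
Proof. by rewrite lnz /Lam natrD natrM. Qed.

Let LamE : Lam = (4 * k + 4) * g. Proof. by rewrite /Lam natrD natrM. Qed.

Let Lam0 : 0 < Lam. Proof. by rewrite LamE mulr_gt0 //; move: k0; lra. Qed.

Let rho0 : 0 < rho.
Proof.
rewrite invr_gt0; apply: mulr_gt0; last exact: exprn_gt0.
by apply: mulr_gt0; [rewrite mulr_gt0 ?ltr0n|rewrite exprn_gt0 ?ltr0n].
Qed.

Let rhoE : rho * (200 * 200 * 8 ^+ 3 * k ^+ 6) = 1.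
Proof. by apply: mulVf; rewrite -invr_eq0; exact: lt0r_neq0. Qed.

Let D0 : 0 < 4 * k ^+ 2 * g.
Proof. by apply: mulr_gt0 => //; rewrite mulr_gt0 ?exprn_gt0. Qed.

Let kg0 : 0 < 4 * k * g.
Proof. by apply: mulr_gt0 => //; rewrite mulr_gt0. Qed.

Let d0 : 0 < d. Proof. by rewrite invr_gt0 D0. Qed.

Let k2 : 9 <= k ^+ 2. Proof. by rewrite expr2; move: k3; nra. Qed.

Let d_le : d <= 1 / 2.
Proof.
rewrite /d invf_ple ?posrE ?D0 //.
by rewrite invf_div divr1; move: k2 g_ge; move: (k ^+ 2) g => a b; nra.
Qed.

Let th0 : 0 < th.
Proof. by rewrite invr_gt0 mulr_gt0 // exprn_gt0 //; move: Lam0; lra. Qed.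

Let th_le : th * (1 + Lam) ^+ 3 = k^-1.
Proof. by rewrite /th invfM divfK // gt_eqF // exprn_gt0 //; move: Lam0; lra. Qed.

Let two_le (a b : nat) : (a <= b)%N -> (2 ^ a <= 2 ^ b)%N.
Proof. by move=> ab; rewrite leq_exp2l. Qed.

Let uy : (2 ^ u <= y)%N. Proof. by apply: two_le; rewrite leq_pmull // muln_gt0 (leq_trans _ K3). Qed.
Let yz1 : (y <= z 1)%N. Proof. by apply: two_le; rewrite leq_mul2r leq_addr orbT. Qed.
Let zz i j : (i <= j)%N -> (z i <= z j)%N.
Proof. by move=> ij; apply: two_le; rewrite leq_mul2r leq_add2l ij orbT. Qed.
Let yY : (y <= Y)%N. Proof. exact: leq_trans yz1 (zz (isT : (1 <= 4)%N)). Qed.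
Let y0 : (0 < y)%N. Proof. by rewrite expn_gt0. Qed.
Let YX : (Y <= X)%N.
Proof.
apply: two_le; apply: leq_trans exp_im; rewrite leq_mul2r.
by apply/orP; right; clear; lia.
Qed.

Let Y5 : (4 < Y)%N.
Proof.
have h : (3 <= (4 * K + 4) * u)%N.
  by apply: leq_trans (leq_mul (_ : 3 <= 4 * K + 4)%N (_ : 1 <= u)%N); clear -K3 u7; lia.
exact: leq_trans (two_le h).
Qed.

Let B_ge : (2 ^ u <= B)%N.
Proof.
by apply: two_le; rewrite /E -addnA (leq_trans _ (leq_addr _ _)) // ltnW // ltn_expl.
Qed.

Let BP : (X * Y ^ m.+1 * \prod_(0 <= p < Y | prime p) p ^ m <= B)%N.
Proof.
rewrite /B /E !expnD leq_mul //; first by rewrite leq_mul // /Y /z -expnM.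
apply: (@leq_trans (\prod_(0 <= p < Y) Y ^ m)).
  rewrite big_mkcond big_nat_cond [X in (_ <= X)%N]big_nat_cond.
  apply: leq_prod => p /andP[/andP[_ pY] _]; case: ifP => _.
    by rewrite leq_exp2r ?expn_gt0 // ltnW.
  by rewrite expn_gt0 expn_gt0.
by rewrite prod_nat_const_nat subn0 -expnM {1}/Y /z -expnM.
Qed.

Let small : 4 * (1 + ln Y%:R) / m.+1%:R + 12 * 8 ^+ 4 * pw Y.-1 (1 / 2) + 2 / B%:R <= th ^+ 2.
Proof.
have W0 : 0 < 2 ^+ u :> R by rewrite exprn_gt0.
have x1 : 0 < 1 + Lam by move: Lam0; lra.
have thE : th ^+ 2 = (k ^+ 2 * (1 + Lam) ^+ 6)^-1 by rewrite /th exprVn exprMn -exprM.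
have Dx : 0 < k ^+ 2 * (1 + Lam) ^+ 6 by rewrite mulr_gt0 ?exprn_gt0.
apply: (@le_trans _ _ ((4 * (1 + Lam) + 12 * 8 ^+ 4 + 2) / 2 ^+ u)); last first.
  by rewrite thE ler_pdivrMr // ler_pdivlMl // mulrC.
have nW : (2 ^ u)%:R = 2 ^+ u :> R by rewrite natrX.
rewrite lnY [leRHS]mulrDl [X in _ <= X + _]mulrDl; apply: lerD; first apply: lerD.
- rewrite ler_wpM2l //; first by rewrite mulr_ge0 // ltW.
  rewrite lef_pV2 ?posrE ?ltr0n //.
  by rewrite -nW ler_nat.
- rewrite ler_wpM2l ?mulr_ge0 ?exprn_ge0 // -nW -[leRHS]pw_inv ?expn_gt0 //.
  have -> : pw (2 ^ u) 1 = pw (2 ^ (2 * u)) (1 / 2) :> R.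
    by rewrite /pw !ln_pow natrM; congr expR; field.
  apply: pw_mono; first by lra.
  rewrite expn_gt0 /= -ltnS prednK ?expn_gt0 //.
  by rewrite ltn_exp2l // ltn_mul2r; move: K3 u7; clear; lia.
- by rewrite ler_wpM2l // lef_pV2 ?posrE ?ltr0n ?expn_gt0 // -nW ler_nat.
Qed.

Let X4 : (4 <= X)%N. Proof. exact: leq_trans (ltnW Y5) YX. Qed.

(** Half of [d] is spent on [X ^ (- d / 2) = expR (- 2 ^ u / (8 k ^ 2 u))], of which only
    [expR (- x) <= 1 / x] is used; [exp_tail] then beats the powers of [1 / d]. *)
Let tail_ln Z : \sum_(X <= n < Z) vonM n * ln n%:R * pw n (1 + d) <= k^-1.
Proof.
have W0 : 0 < 2 ^+ u :> R by rewrite exprn_gt0.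
have d2 : 0 < d / 2 <= 1 by move: d0 d_le; lra.
have h := @sum_vonM_lnk_pw R Z 1 _ d2 isT; rewrite expr1 mulr1 in h.
have X0 : (0 < X)%N by rewrite expn_gt0.
have pX : pw X (d / 2) <= 8 * k ^+ 2 * u%:R / 2 ^+ u.
  have xE : d / 2 * ln X%:R = 2 ^+ u / (8 * k ^+ 2 * u%:R).
    have l2 : ln 2 != 0 :> R by rewrite gt_eqF //; have := @ln2_ge_half R; lra.
    rewrite ln_pow natrX /d /g; field; rewrite l2 /= !gt_eqF //; move: u7R; lra.
  have x0 : 0 < 2 ^+ u / (8 * k ^+ 2 * u%:R) :> R.
    by rewrite divr_gt0 // !mulr_gt0 ?exprn_gt0 //; move: u7R; lra.
  rewrite /pw xE expRN -[leRHS]invf_div lef_pV2 ?posrE ?expR_gt0 //.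
  by have := expR_ge1Dx (2 ^+ u / (8 * k ^+ 2 * u%:R) : R); lra.
have t0 n : 0 <= vonM n * ln n%:R * pw n (1 + d / 2) :> R.
  by rewrite !mulr_ge0 ?vonM_ge0 ?ln_nat_ge0 ?pw_ge0.
apply: (@le_trans _ _ (14 / (d / 2) * (2 / (d / 2)) * (8 * k ^+ 2 * u%:R / 2 ^+ u))).
  apply: (@le_trans _ _ ((\sum_(1 <= n < Z) vonM n * ln n%:R ^+ 1 * pw n (1 + d / 2)) *
     (8 * k ^+ 2 * u%:R / 2 ^+ u))); last first.
    by rewrite ler_wpM2r // (le_trans _ pX) // pw_ge0.
  have [XZ|ZX] := leqP X Z; last first.
    rewrite big_geq ?(ltnW ZX) // mulr_ge0 ?(le_trans _ pX) ?pw_ge0 //.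
    by rewrite sumr_ge0 // => n _; rewrite expr1.
  rewrite (@big_cat_nat _ _ _ X 1 Z) //= mulrDl -[leLHS]add0r lerD //.
    by rewrite mulr_ge0 ?(le_trans _ pX) ?pw_ge0 // sumr_ge0.
  rewrite mulr_suml; apply: ler_sum_nat => n /andP[Xn _].
  rewrite expr1 (_ : 1 + d = (1 + d / 2) + d / 2); last by lra.
  rewrite pwD mulrA ler_wpM2l // (le_trans _ pX) //.
  by apply: pw_mono; [case/andP: d2 => /ltW|rewrite X0].
have dE : 14 / (d / 2) * (2 / (d / 2)) = 28 * 64 * k ^+ 4 * g ^+ 2.
  by rewrite /d; field; rewrite !gt_eqF.
rewrite dE mulrA ler_pdivrMr // ler_pdivlMl //.
apply: le_trans exp_tail.
have g2 : g ^+ 2 <= u%:R ^+ 2 by rewrite ler_sqr ?nnegrE ?(ltW g0).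
have k7 : 0 <= 8 * k ^+ 7 * u%:R by rewrite !mulr_ge0 ?exprn_ge0 // ltW.
have := ler_wpM2l k7 g2.
have : 0 <= 8 * k ^+ 7 * u%:R * u%:R ^+ 2 by rewrite mulr_ge0 // exprn_ge0.
rewrite (_ : k * _ = 28 * 64 * (8 * k ^+ 7 * u%:R * g ^+ 2)); last by ring.
rewrite (_ : 8 ^+ 5 * _ * _ = 64 * 64 * (8 * k ^+ 7 * u%:R * u%:R ^+ 2)); last by ring.
by lra.
Qed.

Let ln_ge1 n : (X <= n)%N -> 1 <= ln n%:R :> R.
Proof. by move=> Xn; apply: ln4_ge1; exact: leq_trans Xn. Qed.

Let tail Z : \sum_(X <= n < Z) vonM n * pw n (1 + d) <= k^-1.
Proof.
apply: le_trans (tail_ln Z); apply: ler_sum_nat => n /andP[Xn _].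
by rewrite ler_wpM2r ?pw_ge0 // ler_peMr ?vonM_ge0 // ln_ge1.
Qed.

Let tail_prime Z : \sum_(X <= p < Z | prime p) pw p (1 + d) <= k^-1.
Proof.
apply: le_trans (tail Z); rewrite [X in _ <= X](bigID prime) /= -[leLHS]addr0 lerD //; last first.
  by rewrite sumr_ge0 // => n _; rewrite mulr_ge0 ?vonM_ge0 ?pw_ge0.
rewrite big_nat_cond [X in _ <= X]big_nat_cond; apply: ler_sum => p /andP[/andP[Xp _] pp].
by rewrite vonM_prime // ler_peMl ?pw_ge0 // ln_ge1.
Qed.

Let kV_le1 : k^-1 <= 1. Proof. by rewrite invf_le1 //; move: k3; lra. Qed.

(** [5 + 5 * E] is the binary logarithm of [32 * B ^ 5], the bound for the ordinate; it is dominated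
    by [m * Y] up to a factor [2 ^ u]. *)
Let Im_le : (5 + 5 * E <= 2 ^ ((4 * K + 6) * u))%N.
Proof.
have e1 : (2 ^ ((4 * K + 6) * u) = m * Y * 2 ^ u)%N by rewrite /m /Y /z -!expnD; congr (_ ^ _)%N; clear; lia.
have m1 : (1 <= m)%N by rewrite expn_gt0.
have Y2 : (2 <= Y)%N by apply: leq_trans Y5.
have h1 : (m.+1 <= m * Y)%N by apply: leq_trans (leq_mul (leqnn m) Y2); move: m1; clear; lia.
rewrite e1; apply: leq_trans (leq_mul (leqnn _) exp_im).
rewrite /E -/m; move: h1 u7; set M := (m * Y)%N; set v := ((4 * K + 4) * u)%N => h1 u7'.
have h2 : (v * m.+1 <= v * M)%N by rewrite leq_mul2l h1 orbT.
have h3 : ((40 * K + 50) * u = 10 * v + 10 * u)%N by rewrite /v; clear; lia.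
have h4 : (M <= M * u)%N by rewrite leq_pmulr // (leq_trans _ u7').
rewrite h3 [(M * (_ + _))%N]mulnDr (_ : M * (10 * v) = 10 * (v * M))%N; last by clear; lia.
rewrite (_ : M * (10 * u) = 10 * (M * u))%N; last by clear; lia.
have M2 : (2 ^ u <= M)%N by rewrite /M leq_pmulr // ltnW.
clearbody M v; move: M2 h1 h2 h4 m1; rewrite -/m; move: M (v * m.+1)%N (v * M)%N (M * u)%N => M' a b c.
by move: m; clear; lia.
Qed.

Lemma critical_point_exists : exists s : R[i],
  [/\ zeta_critical_points s, 2 ^+ u <= ImC s,
      ImC s <= 2 ^+ (2 ^ ((4 * K + 6) * u))%N &
      (totient q)%:R / q%:R * (4 * k * g) <=
        normc (dirichlet_L chi s) * expR (10 / k - euler_constant R)].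
Proof.
pose e p : R := if prime p then ln p%:R * pw p (1 + d) else 0.
have e01 p : 0 <= e p <= 1.
  rewrite /e; case: ifP => pp; last by rewrite lexx ler01.
  by rewrite (ln_pw_le1 d0 (prime_gt0 pp)) mulr_ge0 ?ln_nat_ge0 ?pw_ge0.
have sumE (a b : nat) (f : nat -> R) : \sum_(a <= p < b) f p * e p =
    \sum_(a <= p < b | prime p) f p * (ln p%:R * pw p (1 + d)).
  by rewrite [RHS]big_mkcond; apply: eq_bigr => p _; rewrite /e; case: ifP => // _; rewrite mulr0.
have sumE1 (a b : nat) : \sum_(a <= p < b) e p =
    \sum_(a <= p < b | prime p) ln p%:R * pw p (1 + d).
  by rewrite [RHS]big_mkcond.
have sumE2 (a b : nat) : \sum_(a <= p < b) ln p%:R * e p =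
    \sum_(a <= p < b | prime p) ln p%:R * ln p%:R * pw p (1 + d).
  by rewrite sumE; apply: eq_bigr => p _; rewrite mulrA.
have [c /andP[yc cY] hc] := exists_median yY e01.
have [t [t1 t2 hdef [f1 f2 f3]]] := resonant_ordinate q1 chiP y c Y5 YX d0 th0 BP small.
have d1 : d <= 1 by move: d_le; lra.
have x1 : 1 <= 1 + Lam by move: Lam0; lra.
have thk : th <= k^-1.
  rewrite -th_le -[leLHS]mulr1 ler_wpM2l ?(ltW th0) // exprn_ege1 //.
have defk : defect q chi y c Y t <= k^-1.
  apply: le_trans hdef _; rewrite lnY -th_le ler_wpM2l ?(ltW th0) // ler_eXnr //.
have def0 : 0 <= defect q chi y c Y t.
  by rewrite sumr_ge0 // => p _; rewrite mulr_ge0 ?normc_ge0 ?invr_ge0.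
have def2 : ln Y%:R * ln Y%:R * defect q chi y c Y t <= k^-1.
  apply: (@le_trans _ _ ((1 + Lam) * (1 + Lam) * (th * (1 + Lam)))); last first.
    by rewrite -th_le le_eqVlt; apply/orP; left; apply/eqP; ring.
  have aux (L x D W : R) : 0 <= L -> L <= x -> 0 <= D -> D <= W -> L * L * D <= x * x * W.
    by move=> L0 Lx D0' DW; rewrite ler_pM ?mulr_ge0 // ler_pM.
  rewrite lnY; apply: aux => //; first exact: ltW.
    by lra.
  by rewrite -lnY.
have def1 : ln Y%:R * defect q chi y c Y t <= k^-1.
  apply: le_trans def2; rewrite -mulrA lnY; apply: ler_peMl.
    by apply: mulr_ge0 => //; exact: ltW.
  by rewrite LamE; move: k3 g_ge; move: g k => a b; nra.
pose s0 : R[i] := (1 + d) +i* t.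
have F0 : normc (vonM_series s0) <= C + 4 * q%:R + 389.
  apply: (vonM_series_small q1 chiP chiC y0 yc cY YX d0 d1).
  - by apply: le_trans def1 _.
  - by apply: le_trans f1 _; apply: le_trans thk _.
  - by move=> Z; apply: le_trans (tail Z) _.
  - by rewrite -!sumE1.
(* [d * ln Y = (k + 1) / k ^ 2] is at most [1 / 2], so [p ^ (- 1 - d)] loses at most half against
   [1 / p] in the window. *)
have Yd : 1 / 2 <= pw Y d.
  have h := expR_ge1Dx (- (d * ln Y%:R)); apply: le_trans h.
  have -> : d * ln Y%:R = (k + 1) / k ^+ 2 by rewrite lnY LamE /d; field; rewrite !gt_eqF.
  suff : (k + 1) / k ^+ 2 <= 1 / 2 by lra.
  by rewrite ler_pdivrMr ?exprn_gt0 // expr2; move: k3; nra.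
have Gz i j : (i < j)%N -> g <= ln (z j)%:R - ln (z i)%:R.
  move=> ij; rewrite !lnz -mulrBl ler_peMl ?(ltW g0) //.
  have : i.+1%:R <= j%:R :> R by rewrite ler_nat.
  by rewrite -natr1; lra.
have Wz a b : (0 < a <= b)%N -> (b <= Y)%N -> g <= ln b%:R - ln a%:R ->
    1 / 2 * (g - 203) <= \sum_(a <= p < b) e p.
  move=> ab bY gab; have [g203|g203] := leP 203 g.
    rewrite sumE1; apply: le_trans (prime_window_pw d0 ab bY).
    by apply: ler_pM; lra.
  apply: (@le_trans _ _ 0); first lra.
  by rewrite sumr_ge0 // => p _; case/andP: (e01 p).
have F1 : g ^+ 2 / 8 <= normc (vonM_ln_series s0).
  have ht Z : \sum_(X <= n < Z) vonM n * ln n%:R * pw n (1 + d) <= 1.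
    exact: le_trans (tail_ln Z) _.
  have f2' : normc (\sum_(Y <= r < X | prime r) (ln r%:R * ln r%:R * pw r (1 + d))%:C * ch t r) <= 4.
    by apply: le_trans f2 _; have := le_trans thk kV_le1; lra.
  have hL := vonM_ln_series_large q1 chiP chiC y0 yc cY YX d0 d1 (le_trans def2 kV_le1) f2' ht.
  have e0 n : 0 <= e n by case/andP: (e01 n).
  have z12 := zz (isT : (1 <= 2)%N); have z23 := zz (isT : (2 <= 3)%N).
  have z34 : (z 3 <= Y)%N by exact: zz.
  have W1 : 1 / 2 * (g - 203) <= \sum_(y <= p < z 1) e p.
    apply: Wz; rewrite ?y0 ?yz1 //; first exact: zz.
    by rewrite lny lnz -mulrBl [_ - _]addrC addKr mul1r.
  have W2 : 1 / 2 * (g - 203) <= \sum_(z 3 <= p < Y) e p.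
    by apply: Wz; rewrite ?expn_gt0 ?z34 //; exact: Gz.
  have hc2 : \sum_(y <= p < c) e p - \sum_(c <= p < Y) e p <= 2 by case/andP: hc.
  have := cut_lower y0 yc cY yz1 z12 z23 z34 e0 (ltW g0) (Gz _ _ (isT : (1 < 2)%N))
    (Gz _ _ (isT : (2 < 3)%N)) W1 W2 hc2.
  by move: hL g_cut; rewrite !sumE2 lnY; lra.
have kr : 336 * k ^+ 2 * rho <= k^-1.
  have k31 : 1 <= k ^+ 3 by rewrite exprn_ege1 //; move: k3; lra.
  have h : k ^+ 3 * rho <= k ^+ 3 * k ^+ 3 * rho.
    by rewrite ler_wpM2r ?(ltW rho0) // ler_peMr //; lra.
  rewrite -(ler_pM2r k0) (mulVf (lt0r_neq0 k0)) (_ : 336 * k ^+ 2 * rho * k = 336 * (k ^+ 3 * rho)); last by ring.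
  have e6 : 200 * 200 * 8 ^+ 3 * (k ^+ 3 * k ^+ 3 * rho) = 1.
    by apply: etrans rhoE; ring.
  have p0 : 0 <= k ^+ 3 * k ^+ 3 * rho by rewrite mulr_ge0 ?mulr_ge0 ?exprn_ge0 ?(ltW rho0) // ltW.
  by move: h e6 p0; move: (k ^+ 3 * rho) (k ^+ 3 * k ^+ 3 * rho) => a b; lra.
have rE : r = d * (4 * k ^+ 2 * rho).
  by rewrite /r /d; field; rewrite !gt_eqF.
have r0 : 0 < r by rewrite divr_gt0.
have rd : 3 * r <= d / 2.
  have := ler_wpM2l (ltW d0) (le_trans kr kV_le1); rewrite rE.
  have := d0; rewrite (_ : d * (336 * k ^+ 2 * rho) = 84 * (d * (4 * k ^+ 2 * rho))); last by ring.
  lra.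
have r1 : r <= 1 by move: rd d_le r0; lra.
have gr : g * r = rho by rewrite /r mulrC divfK // gt_eqF.
have [s sr sP] : exists2 s, normc (s - s0) <= r & zeta_critical_points s.
  apply: (@zeta_critical_near R s0 d r (C + 4 * q%:R + 389) (g ^+ 2 / 8)) => //.
  - by rewrite d0 d_le.
  - by rewrite divr_gt0 // exprn_gt0.
  - by rewrite le_eqVlt; apply/orP; left; apply/eqP; rewrite /r /rho /d; field; rewrite !gt_eqF.
  - rewrite (_ : g ^+ 2 / 8 * r = rho * g / 8); last by rewrite -gr; ring.
    by move: g_newton; lra.
exists s.
have B1 : 1 <= B%:R :> R by rewrite ler1n expn_gt0.
have BW : 2 ^+ u <= B%:R :> R by rewrite -natrX ler_nat.
have B5 : B%:R <= B%:R ^+ 5 :> R by rewrite ler_eXnr.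
have := le_trans (normc_im _) sr; rewrite ImD ImN ler_norml -[ImC s0]/t => /andP[i1 i2].
split => //.
- by move: i1 i2 t1 r1; lra.
- apply: (@le_trans _ _ (32 * B%:R ^+ 5)); first by move: i1 i2 t2 r1; lra.
  rewrite (_ : 32 * B%:R ^+ 5 = (2 ^ (5 + 5 * E))%:R).
    by rewrite -natrX ler_nat two_le.
  by rewrite expnD (mulnC 5 E) expnM natrM [X in _ = _ * X]natrX (_ : (2 ^ 5 = 32)%N).
have qy : (q < y)%N by exact: leq_trans uy.
(* [8 = 1 + 2 + 2 + 1 + 1 + 1], in the order of the terms. The window costs
   [(4 g + 11) / (4 k g) <= 2 / k] because its logarithmic length is [4 g] against
   [ln y = 4 k g]. *)
have hE : 84 * r / d + 2 * defect q chi y c Y t + \sum_(y <= p < Y | prime p) p%:R^-1 +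
    normc (\sum_(Y <= p < X | prime p) (chi p%:Z * (pw p (1 + d))%:C) * ch t p) + k^-1 +
    y.-1%:R^-1 <= 8 * k^-1.
  have a1 : 84 * r / d <= k^-1.
    apply: le_trans kr; rewrite le_eqVlt; apply/orP; left; apply/eqP.
    by rewrite rE; field; rewrite gt_eqF.
  have a2 : y.-1%:R^-1 <= k^-1.
    by rewrite lef_pV2 ?posrE ?ltr0n // ?ler_nat; move: (leq_trans Ku uy) K3; clear; lia.
  have a3 : \sum_(y <= p < Y | prime p) p%:R^-1 <= 2 * k^-1.
    have ly0 : 0 < ln y%:R :> R by rewrite lny.
    have yYn : (0 < y <= Y)%N by rewrite y0.
    have [_ h] := @prime_window R y Y yYn.
    rewrite -(ler_pM2l ly0) mulr_sumr; apply: (@le_trans _ _ (ln Y%:R - ln y%:R + 11)).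
      apply: le_trans h; rewrite big_nat_cond [X in _ <= X]big_nat_cond.
      apply: ler_sum => p /andP[/andP[yp _] _].
      by rewrite ler_wpM2r ?invr_ge0 // ler_ln_nat.
    rewrite lnY lny LamE (_ : 4 * k * g * (2 * k^-1) = 8 * g); last by field; rewrite gt_eqF.
    by move: g_ge; lra.
  move: a1 a2 a3 f3 thk defk; move: (k^-1) => kk; lra.
have := dirichlet_L_lower q1 chiP qy yc cY YX d0 d1 rd sr tail_prime hE.
have kk01 : 0 < k^-1 <= 1 by rewrite invr_gt0 k0.
have a1 : (1 < 4 * K * u)%N.
  by apply: leq_trans (leq_mul (_ : 2 <= 4 * K)%N (_ : 1 <= u)%N); move: K3 u7; clear; lia.
have := @mertens_product R (4 * K * u) k^-1 a1 kk01.
rewrite -/y (_ : k^-1 / ln y%:R = d); last by rewrite lny /d; field; rewrite !gt_eqF.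
rewrite lny; set P := \prod_(0 <= p < y | prime p) _ => hP hL.
have n0 := normc_ge0 (dirichlet_L chi s).
have := ler_wpM2r (expR_ge0 (8 * k^-1)) (ler_wpM2l n0 hP).
move=> /(le_trans hL) h.
rewrite -ler_pdivlMr //; apply: le_trans h _.
rewrite mulrA mulrAC ler_wpM2r ?invr_ge0 ?(ltW kg0) // -mulrA ler_wpM2l // -expRD ler_expR.
(* [10 = 8 + 1 + 1]: the previous exponent, and in [mertens_product] the terms [1 / k] and
   [27 / (4 K u)]. *)
have : 27 / (4 * K * u)%:R <= k^-1 :> R.
  rewrite !natrM invfM invfM -/k.
  have : u%:R^-1 <= 7^-1 :> R by rewrite lef_pV2 ?posrE //; move: u7R; lra.
  case/andP: kk01; move: (k^-1) (u%:R^-1) => kk uu; nra.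
by move: (k^-1) (_ / _) => kk uu; lra.
Qed.

End CriticalPoint.

(** * Passage to the limit in the parameters *)

Section LimitSuperior.
Context {R : realType}.

Lemma poly_le_exp2 (A : R) n : exists u0, forall u, (u0 <= u)%N ->
  A * u%:R ^+ n <= 2 ^+ u.
Proof.
have N0 : 0 < n.+1%:R :> R by rewrite ltr0n.
pose D : R := (2 * n.+1%:R) ^+ n.+1.
have D0 : 0 < D by rewrite exprn_gt0 // mulr_gt0.
have [u0 hu0] : exists u0 : nat, `|A| * D <= u0%:R.
  by exists (Num.bound (`|A| * D)); rewrite ltW // archi_boundP // mulr_ge0 // ltW.
exists u0 => u u0u; have u1 : `|A| * D <= u%:R by rewrite (le_trans hu0) // ler_nat.
have un0 : 0 <= u%:R ^+ n :> R by rewrite exprn_ge0.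
have d0 : 0 < 1 / n.+1%:R :> R by rewrite divr_gt0.
have := @ln_pw_le_exp R (2 ^ u) n.+1 _ d0.
rewrite lnX_nat // mulrCA divff ?gt_eqF // mulr1 pw_inv ?expn_gt0 // natrX invf_div divr1.
rewrite ler_pdivrMr ?exprn_gt0 // => h.
have h2 : u%:R ^+ n.+1 <= D * 2 ^+ u.
  rewrite /D exprMn -mulrA; apply: le_trans (ler_wpM2l _ h); last by rewrite exprn_ge0.
  rewrite -exprMn lerXn2r ?nnegrE ?mulr_ge0 ?ln_nat_ge0 //.
  by have := @ln2_ge_half R; have := ler0n R u; nra.
rewrite -(ler_pM2l D0); apply: le_trans h2.
rewrite exprS (_ : D * (A * u%:R ^+ n) = A * D * u%:R ^+ n); last by ring.
rewrite ler_wpM2r // (le_trans _ u1) // ler_wpM2r ?(ltW D0) //.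
exact: ler_norm.
Qed.

Lemma nat_above (A : R) : exists u0 : nat, forall u, (u0 <= u)%N -> A <= u%:R.
Proof.
exists (Num.bound `|A|) => u hu; apply: le_trans (ler_norm A) _.
by rewrite (le_trans (ltW (archi_boundP (normr_ge0 A)))) // ler_nat.
Qed.

Variables (q : nat) (chi : int -> R[i]).
Hypothesis q1 : (1 < q)%N.
Hypothesis chiP : primitive_character q chi.

Lemma critical_points_exist (K T : nat) : (3 <= K)%N ->
  exists (u : nat) (s : R[i]), [/\ zeta_critical_points s, (T <= u)%N, 2 ^+ u <= ImC s,
    ImC s <= 2 ^+ (2 ^ ((4 * K + 6) * u))%N &
    (totient q)%:R / q%:R * (4 * K%:R * (u%:R * ln 2)) <=
      normc (dirichlet_L chi s) * expR (10 / K%:R - euler_constant R)].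
Proof.
move=> K3; have [chiD _] := chiP.
have [C C0 hC] := chi_vonM_bounded q1 chiD (primitive_nontrivial q1 chiP).
pose k : R := K%:R.
have k3 : 3 <= k by rewrite (ler_nat R 3).
(* [1 + Lam <= b * u], so that [exp_th] follows from a polynomial of degree [7 = 1 + 6] in [u]. In
   [c1], 102 rounds up [203 / 2]; once [g >= 4 * c1], the quadratic term of [g_cut] wins. *)
pose b : R := 4 * k + 5.
pose c1 : R := 102 + (2 + 2 * C) * (4 * k + 4) + 4 * q%:R + 390.
pose A1 : R := (4 * b + 12 * 8 ^+ 4 + 2) * (k ^+ 2 * b ^+ 6).
pose rho : R := (200 * 200 * 8 ^+ 3 * k ^+ 6)^-1.
have [v1 h1] := poly_le_exp2 A1 7.
have [v2 h2] := poly_le_exp2 (8 ^+ 5 * k ^+ 7) 3.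
have [v3 h3] := poly_le_exp2 (40 * K + 50)%:R 1.
have [v4 h4] := poly_le_exp2 q.+1%:R 0.
have [v5 h5] := poly_le_exp2 K.+1%:R 0.
have [v6 h6] := nat_above (8 * c1).
have [v7 h7] := nat_above (2 * (16 * (C + 4 * q%:R + 389) / rho)).
pose u := (maxn T (maxn 7 (maxn v1 (maxn v2 (maxn v3 (maxn v4 (maxn v5 (maxn v6 v7))))))))%N.
have [Tu u7 [w1 w2 w3 [w4 w5 w6 w7]]] : [/\ (T <= u)%N, (7 <= u)%N &
   [/\ (v1 <= u)%N, (v2 <= u)%N, (v3 <= u)%N & [/\ (v4 <= u)%N, (v5 <= u)%N, (v6 <= u)%N & (v7 <= u)%N]]].
  by split; [| |split; [| | |split]]; rewrite /u !leq_max leqnn ?orbT.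
exists u; have u7R : 7 <= u%:R :> R by rewrite (ler_nat R 7).
have l2 := @ln2_ge_half R.
have l2' : ln 2 <= 1 :> R.
  by have := @le_ln1Dx R 1; rewrite -[1 + 1]/2; apply; lra.
pose g : R := u%:R * ln 2.
have g_ge : u%:R / 2 <= g by rewrite /g; nra.
have g_le : g <= u%:R by rewrite /g ler_piMr.
pose Lam : R := (4 * K + 4)%:R * g.
have LamE : Lam = (4 * k + 4) * g by rewrite /Lam natrD natrM.
have [|||||||s [s1 s2 s3 s4]] := @critical_point_exists R q chi C q1 chiD hC K u K3 u7.
- by have := h4 u w4; rewrite expr0 mulr1 -natrX ler_nat.
- by have := h5 u w5; rewrite expr0 mulr1 -natrX ler_nat.
- rewrite -/g -/Lam -/k; apply: le_trans (h1 u w1).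
  have Lb : 1 + Lam <= b * u%:R.
    by rewrite LamE /b; clear -g_le u7R k3; nra.
  have L0 : 0 <= 1 + Lam by rewrite LamE; clear -g_ge u7R k3; nra.
  have b0 : 0 <= b by rewrite /b; lra.
  rewrite /A1 (_ : _ * u%:R ^+ 7 = (4 * b + 12 * 8 ^+ 4 + 2) * u%:R * (k ^+ 2 * (b * u%:R) ^+ 6)); last by ring.
  have c0 : 0 <= 12 * 8 ^+ 4 :> R by rewrite mulr_ge0 ?exprn_ge0.
  apply: ler_pM.
  + by move: c0 L0; lra.
  + by apply: mulr_ge0; apply: exprn_ge0 => //; lra.
  + move: c0; move: (12 * 8 ^+ 4 : R) => c0 c0'.
    by clear -Lb c0' u7R; nra.
  + by rewrite ler_wpM2l ?exprn_ge0 // lerXn2r ?nnegrE // (le_trans L0).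
- exact: h2.
- by have := h3 u w3; rewrite expr1 -natrX -natrM ler_nat.
- rewrite -/g -/Lam LamE; have := h6 u w6.
  have : 0 <= (2 + 2 * C) * (4 * k + 4) by rewrite mulr_ge0 //; lra.
  have : 0 <= q%:R :> R by [].
  have : 1 <= g by lra.
  rewrite (_ : 2 * C * _ = (2 * C * (4 * k + 4)) * g); last by ring.
  rewrite /c1 (_ : (2 + 2 * C) * (4 * k + 4) = 2 * (4 * k + 4) + 2 * C * (4 * k + 4)); last by ring.
  move: (4 * k + 4) (q%:R : R) g_ge => w Q gu; move: (2 * C * w) => x g1 Q0 xw h.
  have hg : 4 * (102 + (2 * w + x) + 4 * Q + 390) <= g by lra.
  by clear -hg g1 Q0 xw; nra.
- rewrite -/g -/rho; have := h7 u w7.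
  have r0 : 0 < rho.
    rewrite invr_gt0; apply: mulr_gt0; last by rewrite exprn_gt0 //; lra.
    by apply: mulr_gt0; [rewrite mulr_gt0 ?ltr0n|rewrite exprn_gt0 ?ltr0n].
  move=> h; have {h} : 16 * (C + 4 * q%:R + 389) / rho <= g by lra.
  by rewrite ler_pdivrMr // [rho * g]mulrC.
by exists s.
Qed.

(** Numerator at least [tau * 4 k g * (1 - 10 / k)], denominator at most [(4 k + 6) g]; as
    [(1 - 12 / k) (4 k + 6) <= 4 k - 40], the ratio is at least [tau * (1 - 12 / k)], and
    [k >= 12 tau / e] finishes. *)
Lemma ratio_near (e T : R) : 0 < e -> exists s : R[i],
  [/\ zeta_critical_points s, T < ImC s &
     expR (euler_constant R) * ((totient q)%:R / q%:R) - e <=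
       normc (dirichlet_L chi s) / ln (ln (ImC s))].
Proof.
move=> e0; set a := (totient q)%:R / q%:R; set c := euler_constant R.
have a0 : 0 <= a by rewrite divr_ge0.
pose tau := expR c * a; have tau0 : 0 <= tau by rewrite mulr_ge0 ?expR_ge0.
have [K0 hK0] := nat_above (12 * tau / e).
have [T0 hT0] := nat_above T.
pose K := maxn 12 K0; have K12 : (12 <= K)%N by rewrite leq_maxl.
have [u [s [s1 Tu s2 s3 s4]]] := @critical_points_exist K (maxn 3 T0) (leq_trans (isT : (3 <= 12)%N) K12).
exists s; pose k : R := K%:R; rewrite -/k in s4.
have k12 : 12 <= k by rewrite (ler_nat R 12).
have k0 : 0 < k by lra.
have u3 : (3 <= u)%N by rewrite (leq_trans _ Tu) // leq_maxl.
have u3R : 3 <= u%:R :> R by rewrite (ler_nat R 3).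
pose g : R := u%:R * ln 2; rewrite -/g -/a -/c in s4.
have g1 : 1 < g by have := @ln2_ge_half R; rewrite /g; nra.
have W0 : 0 < 2 ^+ u :> R by rewrite exprn_gt0.
have Im0 : 0 < ImC s by exact: lt_le_trans s2.
have lnpow n : ln (2 ^+ n) = n%:R * ln 2 :> R by rewrite -natrX lnX_nat.
have l1 : g <= ln (ImC s) by rewrite /g -lnpow ler_ln ?posrE.
have l0 : 0 < ln (ImC s) by lra.
have l2' : ln 2 <= 1 :> R.
  by have := @le_ln1Dx R 1; rewrite -[1 + 1]/2; apply; lra.
have ll0 : 0 < ln (ln (ImC s)) by rewrite ln_gt0 //; lra.
have l2 : ln (ImC s) <= 2 ^+ ((4 * K + 6) * u).
  apply: (@le_trans _ _ (ln (2 ^+ (2 ^ ((4 * K + 6) * u))))).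
    by rewrite ler_ln ?posrE // exprn_gt0.
  by rewrite lnpow natrX ler_piMr // exprn_ge0.
have ll1 : ln (ln (ImC s)) <= (4 * k + 6) * g.
  apply: (@le_trans _ _ (ln (2 ^+ ((4 * K + 6) * u)))).
    by rewrite ler_ln ?posrE // exprn_gt0.
  by rewrite lnpow natrM natrD natrM /g mulrA.
split => //.
  apply: lt_le_trans s2; apply: (@le_lt_trans _ _ u%:R).
    by apply: hT0; rewrite (leq_trans _ Tu) // leq_maxr.
  by rewrite -natrX ltr_nat ltn_expl.
have hL : tau * (4 * k * g) * (1 - 10 / k) <= normc (dirichlet_L chi s).
  have x1 := expR_ge1Dx (- (10 / k)); have x0 := expR_ge0 (c - 10 / k).
  have := ler_wpM2l x0 s4; rewrite [X in _ <= X]mulrCA -expRD (_ : c - 10 / k + (10 / k - c) = 0); last by ring.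
  rewrite expR0 mulr1; apply: le_trans.
  rewrite expRD /tau (_ : expR c * a * _ * _ = expR c * (a * (4 * k * g)) * (1 - 10 / k)); last by ring.
  rewrite [leRHS](_ : _ = expR c * (a * (4 * k * g)) * expR (- (10 / k))); last by ring.
  have kg0 : 0 <= 4 * k * g by apply: mulr_ge0; lra.
  by rewrite ler_wpM2l //; apply: mulr_ge0; rewrite ?expR_ge0 // mulr_ge0.
rewrite -/tau; apply: (@le_trans _ _ (tau * (1 - 12 / k))).
  have : 12 * tau / e <= k by apply: hK0; rewrite leq_maxr.
  rewrite ler_pdivrMr // => h.
  have : 12 / k * tau <= e by rewrite mulrAC ler_pdivrMr // mulrC [e * k]mulrC; move: h; lra.
  by rewrite mulrBr mulr1 [tau * _]mulrC; lra.
rewrite ler_pdivlMr //; apply: le_trans hL.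
have t1 : 0 <= tau * (1 - 12 / k).
  by rewrite mulr_ge0 // subr_ge0 ler_pdivrMr // mul1r.
apply: le_trans (ler_wpM2l t1 ll1) _.
rewrite -[leLHS]mulrA -[leRHS]mulrA ler_wpM2l // mulrA.
rewrite [leRHS](_ : _ = (4 * k - 40) * g); last by field; rewrite gt_eqF.
rewrite ler_wpM2r //; first lra.
rewrite (_ : (1 - 12 / k) * (4 * k + 6) = 4 * k - 42 - 72 / k); last by field; rewrite gt_eqF.
by have : 0 <= 72 / k by [rewrite divr_ge0 // ltW]; lra.
Qed.

End LimitSuperior.

Theorem theorem2 (R : realType) (q : nat) (chi : int -> R[i]) :
  (2 < q)%N ->
  primitive_character q chi ->
  ((expR (euler_constant R) * ((totient q)%:R / q%:R))%:E <=
    limsup_Im_pinfty (@zeta_critical_points R)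
      (fun s => ComplexField.Normc.normc (dirichlet_L chi s) /
                  ln (ln (complex.Im s)))%R)%E.
Proof.
(* The limsup is an infimum of suprema over sets containing all critical points above some height
   [T]; [ratio_near] supplies one such point for each [e]. *)
move=> /ltnW q1 chiP; apply: le_ereal_inf_tmp => _ [V [T _ TV] <-].
apply/lee_addgt0Pr => e e0.
have [s [s1 s2 s3]] := ratio_near q1 chiP T e0.
have sV : V s by exact: TV.
apply: (@le_trans _ _ ((normc (dirichlet_L chi s) / ln (ln (ImC s)))%:E + e%:E)%E).
  by rewrite -EFinD lee_fin -lerBlDr.
by rewrite leeD2r //; apply: ereal_sup_ubound; exists s.
Qed.
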